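(* Let $w$ be a doubling weight on $\mathbb{R}^n$. Set $\phi(x) := \pi^{-n/2}e^{-|x|^2}$ and define the measure $\mu_w$ on $(0,\infty)\times\mathbb{R}^n$ by $$d\mu_w(r,x) := |\nabla_x \log(\phi_r * w)(x)|^2\, r\, dx\, dr,$$ where $\phi_r(x) := r^{-n}\phi(x/r)$. There exist $\varepsilon>0$ and $C_1,C_2>0$, depending on $n$ and the doubling constant of $w$, such that if the Carleson norm of $\mu_w$ satisfies $\|\mu_w\|_{\mathcal{C}}\le\varepsilon$, then $$\log [w]_{A_\infty}\le C_1\sqrt{\|\mu_w\|_{\mathcal{C}}},\qquad \|\log w\|_{\mathrm{BMO}}\le C_2\sqrt[4]{\|\mu_w\|_{\mathcal{C}}}.$$
   Context: The dimension $n\in\mathbb{N}$ is fixed. $\Delta(x,r)\subset\mathbb{R}^n$ denotes the open Euclidean ball with center $x$ and radius $r>0$; suprema over $\Delta$ below are over all such balls. A weight is a non-negative locally integrable function $w$ on $\mathbb{R}^n$; one also writes $w$ for the measure $w\,dx$, so $w(E)=\int_E w(x)\,dx$. $|E|$ is Lebesgue measure, and $f_E=\frac{1}{|E|}\int_E f(x)\,dx$. Doubling: a Borel measure $\nu$ on $\mathbb{R}^n$ is doubling if it is non-trivial and there is a constant $C_\nu$ with $\nu(\Delta(x,2r))\le C_\nu\,\nu(\Delta(x,r))$ for all $x\in\mathbb{R}^n$, $r>0$; the least such $C_\nu$ is the doubling constant. A weight $w$ is doubling if the measure $w\,dx$ is. $A_\infty$ constant: $[w]_{A_\infty}:=\sup_{\Delta}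 w_\Delta\exp\left(-\frac{1}{|\Delta|}\int_\Delta\log w(x)\,dx\right)$. BMO norm: $\|f\|_{\mathrm{BMO}}:=\sup_\Delta\frac{1}{|\Delta|}\int_\Delta|f(y)-f_\Delta|\,dy$ for locally integrable $f$. Carleson norm: for a Borel measure $\nu$ on $\mathbb{R}^{n+1}_+=(0,\infty)\times\mathbb{R}^n$, $\|\nu\|_{\mathcal{C}}:=\sup_\Delta\frac{\nu(T(\Delta))}{|\Delta|}$, where $T(\Delta(x,r)):=(0,r)\times\Delta(x,r)$. *)

(* Defs.v *)
From HB Require Import structures.
From mathcomp Require Import all_boot all_order all_algebra.
From mathcomp Require Import all_classical all_reals all_analysis.
Set Implicit Arguments.
Unset Strict Implicit.
Unset Printing Implicit Defensive.
Import Order.TTheory GRing.Theory Num.Theory.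
Import numFieldNormedType.Exports.
Local Open Scope classical_set_scope.
Local Open Scope ring_scope.

(** The points of R^n are the row vectors ['rV[R]_n].  Its sigma-algebra is
    generated by the coordinate functions, as for tuples in the library; it is
    the Borel sigma-algebra (see [open_measurable_rV]). *)

Definition measure_rV_display : measure_display.
Proof. exact: (measure_tuple_display default_measure_display). Qed.

Section measurable_rV.
Context {R : realType} (n : nat).

Definition coord_rV (i : 'I_n) (x : 'rV[R]_n) : measurableTypeR R := x 0 i.

Let rV_set0 : g_sigma_preimage coord_rV set0.
Proof. exact: sigma_algebra0. Qed.

Let rV_setC A : g_sigma_preimage coord_rV A -> g_sigma_preimage coord_rV (~` A).
Proof. exact: sigma_algebraC. Qed.

Let rV_bigcup (F : (set 'rV[R]_n)^nat) :
  (forall i, g_sigma_preimage coord_rV (F i)) ->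
  g_sigma_preimage coord_rV (\bigcup_i (F i)).
Proof. exact: sigma_algebra_bigcup. Qed.

HB.instance Definition _ := @isMeasurable.Build measure_rV_display 'rV[R]_n
  (g_sigma_preimage coord_rV) rV_set0 rV_setC rV_bigcup.

Lemma measurable_coord_rV (i : 'I_n) : measurable_fun setT (coord_rV i).
Proof.
move=> _ Y mY; rewrite setTI; apply: sub_sigma_algebra => /=.
rewrite -bigcup_seq/=; exists i => /=; first by rewrite mem_index_enum.
by exists Y => //; rewrite setTI.
Qed.

Lemma measurable_fun_rVP d (T : measurableType d) (f : T -> 'rV[R]_n) :
  (forall i, measurable_fun setT (coord_rV i \o f)) -> measurable_fun setT f.
Proof.
move=> mf _ A mA; rewrite setTI.
suff : g_sigma_preimage coord_rV `<=` [set B | measurable (f @^-1` B)].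
  exact.
apply: smallest_sub.
  split => /=; first by rewrite preimage_set0.
    by move=> B mB; rewrite setTD -preimage_setC; exact: measurableC.
  by move=> F mF; rewrite preimage_bigcup; exact: bigcup_measurable.
move=> B; rewrite -bigcup_seq => -[i _ [C mC <-]] /=.
by rewrite setTI -comp_preimage -[X in measurable X]setTI; exact: mf.
Qed.

End measurable_rV.

Lemma open_measurable_rV (R : realType) n (A : set 'rV[R]_n) :
  open A -> measurable A.
Proof.
move=> oA.
pose box (q : 'rV[rat]_n * nat) :=
  [set x : 'rV[R]_n | forall i, `|x 0 i - ratr (q.1 0 i)| < q.2.+1%:R^-1].
pose F q := if `[< box q `<=` A >] then box q else set0.
have mF q : measurable (F q).
  rewrite /F; case: ifP => // _.
  rewrite (_ : box q = \bigcap_(i in [set: 'I_n]) (coord_rV i @^-1`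
      `]ratr (q.1 0 i) - q.2.+1%:R^-1, ratr (q.1 0 i) + q.2.+1%:R^-1[)).
    apply: fin_bigcap_measurable => // i _.
    rewrite -[X in measurable X]setTI.
    by apply: (measurable_coord_rV i) => //; exact: measurable_itv.
  apply/seteqP; split=> x /= xq i.
    by move=> _; rewrite /= in_itv/= -ltr_distl; exact: xq.
  by have := xq i Logic.I; rewrite /= in_itv/= -ltr_distl.
suff -> : A = \bigcup_q F q by apply: countable_bigcupT_measurable.
apply/seteqP; split=> [x Ax|x [q _]]; last first.
  by rewrite /F; case: ifPn => // /asboolP + xq; apply.
have /nbhs_ballP[e /= e0 xeA] : nbhs x A by exact: open_nbhs_nbhs.
have [k ke] : exists k, k.+1%:R^-1 < e / 2.
  have e20 : 0 < e / 2 by rewrite divr_gt0.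
  near \oo => k; exists k; near: k; exact: near_infty_natSinv_lt (PosNum e20).
have k0 : (0 : R) < k.+1%:R^-1 by rewrite invr_gt0.
have dq i : exists q : rat, `|x 0 i - ratr q| < k.+1%:R^-1.
  have [|q] := @rat_in_itvoo R (x 0 i) (x 0 i + k.+1%:R^-1).
    by rewrite ltrDl.
  rewrite in_itv/= => /andP[xq qx]; exists q.
  by rewrite distrC gtr0_norm ?subr_gt0// ltrBlDl.
pose q : 'rV[rat]_n := \row_i sval (cid (dq i)).
have xq : box (q, k) x by move=> i; rewrite /= mxE; case: cid.
exists (q, k) => //; rewrite /F ifT//; apply/asboolP => y yq.
apply: xeA; split=> // i j; rewrite ord1 /ball/=.
rewrite (le_lt_trans (ler_distD (ratr (q 0 j)) _ _))//.
rewrite [ltRHS](splitr e) ltrD//; last rewrite distrC.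
- exact: lt_trans (xq j) ke.
- exact: lt_trans (yq j) ke.
Unshelve. all: by end_near. Qed.

(** [lebesgue_rV n] is the n-fold product of the Lebesgue measure of the line:
    the Dirac mass on the one-point space R^0, and the image of
    [lebesgue_measure \x lebesgue_rV n] by [(t, x) |-> (t, x_1, .., x_n)]
    on R^(n+1). *)

Section lebesgue_rV.
Context {R : realType}.

Definition cons_rV n (z : measurableTypeR R * 'rV[R]_n) : 'rV[R]_n.+1 :=
  row_mx (z.1 : R)%:M z.2.

Definition uncons_rV n (x : 'rV[R]_n.+1) : measurableTypeR R * 'rV[R]_n :=
  (x 0 0, \row_i x 0 (lift 0 i)).

Lemma cons_rV0 n z : @cons_rV n z 0 0 = z.1.
Proof.
rewrite /cons_rV (_ : 0 = lshift n (0 : 'I_1)); last exact/val_inj.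
by rewrite (@row_mxEl _ 1 1 n) mxE.
Qed.

Lemma cons_rVS n z i : @cons_rV n z 0 (lift 0 i) = z.2 0 i.
Proof.
rewrite /cons_rV (_ : lift 0 i = rshift 1 i); last exact/val_inj.
by rewrite (@row_mxEr _ 1 1 n).
Qed.

Lemma cons_rVK n : cancel (@cons_rV n) (@uncons_rV n).
Proof.
move=> z; rewrite /uncons_rV cons_rV0 [RHS]surjective_pairing; congr pair.
by apply/rowP => i; rewrite mxE cons_rVS.
Qed.

Lemma uncons_rVK n : cancel (@uncons_rV n) (@cons_rV n).
Proof.
move=> x; apply/rowP => i; have [j ->|->] := unliftP 0 i.
  by rewrite cons_rVS mxE.
by rewrite cons_rV0.
Qed.

Lemma measurable_cons_rV n : measurable_fun setT (@cons_rV n).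
Proof.
apply: measurable_fun_rVP => i; have [j ->|->] := unliftP 0 i.
  rewrite (_ : _ \o _ = coord_rV j \o snd); last first.
    by apply/funext => z; rewrite /= /coord_rV cons_rVS.
  exact: (measurableT_comp (measurable_coord_rV j) measurable_snd).
rewrite (_ : _ \o _ = fst); first exact: measurable_fst.
by apply/funext => z; rewrite /= /coord_rV cons_rV0.
Qed.

Lemma measurable_uncons_rV n : measurable_fun setT (@uncons_rV n).
Proof.
apply/measurable_fun_pairP; split; first exact: (measurable_coord_rV 0).
apply: measurable_fun_rVP => i.
rewrite (_ : _ \o _ = coord_rV (lift 0 i)); first exact: measurable_coord_rV.
by apply/funext => x; rewrite /= /coord_rV mxE.
Qed.

Section succ.
Context (n : nat) (m : {sigma_finite_measure set 'rV[R]_n -> \bar R}).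

Definition lebesgue_rV_succ : set 'rV[R]_n.+1 -> \bar R :=
  pushforward (lebesgue_measure \x m)%E (@cons_rV n).

Let succ0 : lebesgue_rV_succ set0 = 0%E.
Proof. by rewrite /lebesgue_rV_succ /pushforward preimage_set0 measure0. Qed.

Let succ_ge0 A : (0 <= lebesgue_rV_succ A)%E.
Proof. by rewrite /lebesgue_rV_succ /pushforward; exact: measure_ge0. Qed.

Let mpreimage A : measurable A -> measurable (@cons_rV n @^-1` A).
Proof.
by move=> mA; rewrite -[X in measurable X]setTI; exact: measurable_cons_rV.
Qed.

Let succ_semi_sigma_additive : semi_sigma_additive lebesgue_rV_succ.
Proof.
move=> F mF tF mUF; rewrite /lebesgue_rV_succ /pushforward preimage_bigcup.
apply: measure_semi_sigma_additive.
- by move=> k; exact: mpreimage.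
- apply/trivIsetP => /= i j _ _ ij; rewrite -preimage_setI.
  by move/trivIsetP : tF => /(_ _ _ _ _ ij) ->//; rewrite preimage_set0.
- by rewrite -preimage_bigcup; exact: mpreimage.
Qed.

HB.instance Definition _ := isMeasure.Build _ _ _ lebesgue_rV_succ
  succ0 succ_ge0 succ_semi_sigma_additive.

Let sigma_finite_succ : sigma_finite setT lebesgue_rV_succ.
Proof.
have /sigma_finiteP[F [TF ndF Foo]] := sigma_finiteT (@lebesgue_measure R).
have /sigma_finiteP[G [TG ndG Goo]] := sigma_finiteT m.
exists (fun k => @uncons_rV n @^-1` (F k `*` G k)).
  rewrite -preimage_bigcup (_ : \bigcup_k _ = setT) ?preimage_setT//.
  rewrite -subTset -setXTT TF TG => -[x y] [/= [k _ Fkx] [l _ Gly]].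
  exists (maxn k l) => //; split => /=.
    by move: x Fkx; exact/subsetPset/ndF/leq_maxl.
  by move: y Gly; exact/subsetPset/ndG/leq_maxr.
move=> k; have [mF Fk] := Foo k; have [mG Gk] := Goo k; split.
  rewrite -[X in measurable X]setTI; apply: measurable_uncons_rV => //.
  exact: measurableX.
rewrite /lebesgue_rV_succ /pushforward -comp_preimage.
rewrite (_ : _ \o _ = id); last by apply/funext => z; exact: cons_rVK.
by rewrite preimage_id product_measure1E// lte_mul_pinfty// ge0_fin_numE.
Qed.

HB.instance Definition _ :=
  Measure_isSigmaFinite.Build _ _ _ lebesgue_rV_succ sigma_finite_succ.

End succ.

Fixpoint lebesgue_rV n : {sigma_finite_measure set 'rV[R]_n -> \bar R} :=
  if n is n'.+1 then lebesgue_rV_succ (lebesgue_rV n') else \d_(0 : 'rV[R]_0).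

End lebesgue_rV.

Section euclidean.
Context {R : realType} (n : nat).
Local Notation Rn := 'rV[R]_n.
Local Notation mu := (@lebesgue_rV R n).

(* The library norm on ['rV[R]_n] is the sup norm. *)
Definition enorm (x : Rn) : R := Num.sqrt (\sum_i x 0 i ^+ 2).

Definition eball (x : Rn) (r : R) : set Rn := [set y | enorm (y - x) < r].

Definition sup_balls (F : Rn -> R -> \bar R) : \bar R :=
  ereal_sup [set F x r | x in [set: Rn] & r in [set r : R | 0 < r]].

Definition average (f : Rn -> \bar R) (E : set Rn) : \bar R :=
  ((\int[mu]_(x in E) f x) / mu E)%E.

(* Values in [\bar R] allow [f = log w] with [log 0 = -oo].  If the average of
   [f] over a ball is infinite then so is the average of [|f - f_B|] there;
   hence finiteness of the norm of a measurable [f] entails that [f] is locally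
   integrable. *)
Definition BMO_norm (f : Rn -> \bar R) : \bar R :=
  sup_balls (fun x r =>
    average (fun y => `|f y - average f (eball x r)|%E) (eball x r)).

Definition tent (x : Rn) (r : R) : set (measurableTypeR R * Rn)%type :=
  [set t : measurableTypeR R | 0 < (t : R) < r] `*` eball x r.

Definition carleson_norm (nu : set (measurableTypeR R * Rn)%type -> \bar R) :
    \bar R :=
  sup_balls (fun x r => (nu (tent x r) / mu (eball x r))%E).

End euclidean.

Section weights.
Context {R : realType} (n : nat).
Local Notation Rn := 'rV[R]_n.
Local Notation mu := (@lebesgue_rV R n).

Definition is_weight (w : Rn -> R) : Prop :=
  [/\ forall x, 0 <= w x, measurable_fun setT w &
      forall K, compact K -> (\int[mu]_(x in K) (w x)%:E < +oo)%E].

Definition weight_measure (w : Rn -> R) (E : set Rn) : \bar R :=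
  (\int[mu]_(x in E) (w x)%:E)%E.

Definition doubling_bound (nu : set Rn -> \bar R) (C : R) : Prop :=
  forall x r, 0 < r -> (nu (eball x (2 * r)) <= C%:E * nu (eball x r))%E.

Definition doubling (nu : set Rn -> \bar R) : Prop :=
  nu setT != 0%E /\ exists C, doubling_bound nu C.

Definition is_doubling_constant (nu : set Rn -> \bar R) (C : R) : Prop :=
  doubling_bound nu C /\ forall C', doubling_bound nu C' -> C <= C'.

Definition doubling_weight (w : Rn -> R) : Prop :=
  is_weight w /\ doubling (weight_measure w).

(* [lne 0 = -oo], and a doubling weight has positive averages, so that the
   supremum is [+oo] as soon as [log w] is not integrable on some ball. *)
Definition Ainfty_constant (w : Rn -> R) : \bar R :=
  sup_balls (fun x r =>
    (average (EFin \o w) (eball x r) *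
     expeR (- average (fun y => lne (w y)%:E) (eball x r)))%E).

Definition gaussian (x : Rn) : R :=
  (pi `^ (- (n%:R / 2))) * expR (- enorm x ^+ 2).

Definition dilate (phi : Rn -> R) (r : R) (x : Rn) : R :=
  r ^- n * phi (r^-1 *: x).

Definition convolution (f g : Rn -> R) (x : Rn) : R :=
  \int[mu]_y (f (x - y) * g y).

Definition gradient (f : Rn -> R) (x : Rn) : Rn :=
  \row_i 'D_(delta_mx 0 i) (f : Rn -> R^o) x.

(* The density is taken with respect to [dr dx] on [r > 0]. *)
Definition gradient_measure (w : Rn -> R)
    (A : set (measurableTypeR R * Rn)%type) : \bar R :=
  (\int[lebesgue_measure \x mu]_(z in A `&` [set z | (0 < (z.1 : R))%R])
     (enorm (gradient (fun x => ln (convolution (dilate gaussian z.1) w x)) z.2)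
        ^+ 2 * (z.1 : R))%:E)%E.

End weights.

(* Main.v *)
Require Import Defs.
From HB Require Import structures.
From mathcomp Require Import all_boot all_order all_algebra.
From mathcomp Require Import all_classical all_reals all_analysis.
From mathcomp Require Import measurable_realfun.
From mathcomp Require Import ring lra.
Import Order.TTheory GRing.Theory Num.Theory.
Import numFieldNormedType.Exports.
Set Implicit Arguments.
Unset Strict Implicit.
Unset Printing Implicit Defensive.
Local Open Scope classical_set_scope.
Local Open Scope ring_scope.

(** Write [u r = phi_r * w] for the heat extension of the weight, [v = ln u],
    and let [Delta] be the ball of centre [x0] and radius [rad].  The density of
    the measure is [r |grad v|^2], and [delta] is its Carleson norm.

    Entropy.  The Gaussian satisfies [d_r phi_r = (r/2) Lap phi_r], hence
    [d_r v = (r/2) (Lap v + |grad v|^2)].  Let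
      [H(r) = int phi_rho(y - x0) v(r, y) dy],  [rho^2 + r^2 = 2 rad^2].
    The kernel [phi_rho] runs backwards in the same equation, so the two
    Laplacian terms of [H'] cancel after two integrations by parts and
      [H'(r) = (r/2) int phi_rho(y - x0) |grad v|^2 dy]
    ([is_derive_entropy]).  Thus [H(rad) - H(a)] is half the integral of a
    Gaussian at scale [rad] against the measure on a strip.  Covering by the
    tents of radii [2^k rad] and using the Gaussian decay, it is at most
    [K delta] ([entropy_growth]).

    Jensen deficit.  Let [P_s] denote convolution with [phi_s] and let
    [s^2 = rad^2 - a^2].  By the semigroup law ([gauss_semigroup]),
      [H(rad) - H(a) = int phi_rad(x0 - x) (ln (P_s u_a) - P_s (ln u_a))(x) dx].
    The integrand is [P_s] of a function that is nonnegative by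
    [t - 1 - ln t >= 0], so restricting both integrations to [Delta] gives
      [ln (avg u_a) - avg (ln u_a) <= K delta],
    averages over [Delta], for every [a <= rad / 2] ([entropy_lower_bound]).

    Passage to the weight.  As [a] tends to 0, [u_a] tends to [w] in
    [L^1 (Delta)] ([heat_cvg_L1]).  The logarithm is not continuous there, but
    [ln u_a <= ln (u_a + b)] and the right side is Lipschitz in [u_a], whence
    [ln (avg w) - avg (ln (w + b)) <= K delta] ([avg_ln_shift]).  The bound is
    uniform in [b], and monotone convergence as [b] tends to 0 shows that [ln w]
    is integrable on [Delta] with
      [ln (avg w) - avg (ln w) <= K delta]  ([log_mean]).

    Conclusion.  The last inequality says [ln [w]_Ainfty <= K delta], and
    [delta <= sqrt delta].  For the other estimate put [f = ln (w / avg w)]: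
    it bounds the average of [G = exp f - 1 - f] by [K delta], while
    [|f| <= lam + G / lam] for [0 < lam < 1] ([abs_le_exp]).  With [lam] close to
    [sqrt delta] the mean oscillation of [ln w] is at most a multiple of
    [sqrt delta], which is at most [delta^(1/4)] ([Ainfty_BMO]).

    Doubling makes [w] integrable against every Gaussian and bounds convolutions
    of [w] with derivatives of [phi_r] by multiples of [u r] ([conv_ratio]).
    Hence [v] grows at most quadratically and its derivatives are bounded, which
    justifies differentiating under the integrals and integrating by parts. *)

(** * Lebesgue measure on row vectors: Fubini and translation invariance *)

Section rowvec.
Context {R : realType}.
Implicit Types n : nat.

Lemma measurable_fun_coord_rV n (i : 'I_n) :
  measurable_fun setT (fun x : 'rV[R]_n => x 0 i).
Proof. exact: (measurable_coord_rV i). Qed.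

Lemma measurable_funD_rV d (T : measurableType d) n (f g : T -> 'rV[R]_n) :
  measurable_fun setT f -> measurable_fun setT g ->
  measurable_fun setT (fun x => f x + g x).
Proof.
move=> mf mg; apply: measurable_fun_rVP => i.
rewrite (_ : _ \o _ = (fun x => f x 0 i + g x 0 i)); last first.
  by apply/funext => x /=; rewrite /coord_rV mxE.
apply: measurable_funD.
  exact: (measurableT_comp (measurable_fun_coord_rV i) mf).
exact: (measurableT_comp (measurable_fun_coord_rV i) mg).
Qed.

Lemma measurable_funB_rV d (T : measurableType d) n (f g : T -> 'rV[R]_n) :
  measurable_fun setT f -> measurable_fun setT g ->
  measurable_fun setT (fun x => f x - g x).
Proof.
move=> mf mg; apply: measurable_fun_rVP => i.
rewrite (_ : _ \o _ = (fun x => f x 0 i - g x 0 i)); last first.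
  by apply/funext => x /=; rewrite /coord_rV !mxE.
apply: measurable_funB.
  exact: (measurableT_comp (measurable_fun_coord_rV i) mf).
exact: (measurableT_comp (measurable_fun_coord_rV i) mg).
Qed.

Lemma measurable_pair_real d (T : measurableType d) (t : R) :
  measurable_fun setT ((fun y => (t, y)) : T -> measurableTypeR R * T).
Proof. by apply/measurable_fun_pairP; split; [exact: measurable_cst|exact: measurable_id]. Qed.

Lemma measurable_section d d' (T : measurableType d) (U : measurableType d')
    (t : R) (g : measurableTypeR R * T -> U) :
  measurable_fun setT g -> measurable_fun setT (fun y => g (t, y)).
Proof. by move=> mg; exact: (measurableT_comp mg (measurable_pair_real t)). Qed.

Lemma cons_rVD n (t s : R) (x y : 'rV[R]_n) :
  cons_rV (t, x) + cons_rV (s, y) = cons_rV (t + s, x + y).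
Proof.
apply/rowP => i; rewrite mxE; have [j ->|->] := unliftP 0 i.
  by rewrite !cons_rVS/= mxE.
by rewrite !cons_rV0.
Qed.

Lemma cons_rVB n (t s : R) (x y : 'rV[R]_n) :
  cons_rV (t, x) - cons_rV (s, y) = cons_rV (t - s, x - y).
Proof.
apply/rowP => i; rewrite mxE [X in _ + X]mxE; have [j ->|->] := unliftP 0 i.
  by rewrite !cons_rVS/= !mxE.
by rewrite !cons_rV0.
Qed.

(** The iterated form of the recursive definition of Lebesgue measure; the
    inductions on the dimension below go through it. *)
Lemma integral_rV_succ n (f : 'rV[R]_n.+1 -> \bar R) :
  measurable_fun setT f -> (forall x, 0 <= f x)%E ->
  (\int[lebesgue_rV n.+1]_x f x =
   \int[lebesgue_measure]_t \int[lebesgue_rV n]_y f (cons_rV (t, y)))%E.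
Proof.
move=> mf f0.
rewrite [LHS](ge0_integral_pushforward (@measurable_cons_rV R n)
  (lebesgue_measure \x lebesgue_rV n)%E measurableT mf)//.
rewrite preimage_setT fubini_tonelli1//=.
by apply: measurableT_comp => //; exact: measurable_cons_rV.
Qed.

Lemma integral_translate_real (f : measurableTypeR R -> \bar R) (c : R) :
  measurable_fun setT f -> (forall x, 0 <= f x)%E ->
  (\int[lebesgue_measure]_x f ((x : R) + c)%R = \int[lebesgue_measure]_x f x)%E.
Proof.
move=> mf f0.
have mc : measurable_fun setT
    ((fun x : R => x + c) : measurableTypeR R -> measurableTypeR R).
  by apply: measurable_funD => //; exact: measurable_id.
transitivity (\int[pushforward lebesgue_measure
    ((fun x : R => (x + c)%R) : measurableTypeR R -> measurableTypeR R)]_x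
    f x)%E.
  by rewrite ge0_integral_pushforward// preimage_setT.
apply: eq_measure_integral => A mA _; apply/esym/lebesgue_measure_unique => //.
move=> _ [[a b]] _ <-.
change (lebesgue_measure `]a, b]%classic =
  lebesgue_measure ((fun x : R => (x + c)%R) @^-1` `]a, b]%classic)).
rewrite (_ : _ @^-1` _ = [set` `](a - c), (b - c)]]); last first.
  by apply/seteqP; split => x /=; rewrite !in_itv/= ltrBlDr lerBrDr.
rewrite !lebesgue_measure_itv/= !lte_fin ltrD2r; case: ifP => // _.
by rewrite -!EFinB; congr EFin; ring.
Qed.

Lemma ge0_integral_translate n (f : 'rV[R]_n -> \bar R) (c : 'rV[R]_n) :
  measurable_fun setT f -> (forall x, 0 <= f x)%E ->
  (\int[lebesgue_rV n]_x f (x + c)%R = \int[lebesgue_rV n]_x f x)%E.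
Proof.
elim: n f c => [|n IHn] f c mf f0.
  by apply: eq_integral => x _; congr f; rewrite [LHS]thinmx0 [RHS]thinmx0.
have mfc : measurable_fun setT (fun x : 'rV[R]_n.+1 => f (x + c)).
  by apply: (measurableT_comp mf); exact: measurable_funD_rV.
rewrite (integral_rV_succ mf f0) (integral_rV_succ mfc (fun x => f0 _)).
rewrite -(uncons_rVK c); set c0 := (uncons_rV c).1; set c' := (uncons_rV c).2.
rewrite -[uncons_rV c]/(c0, c').
pose F t := (\int[lebesgue_rV n]_y f (cons_rV (t, y)))%E.
have mfcons : measurable_fun setT (f \o @cons_rV R n).
  by apply: (measurableT_comp mf); exact: measurable_cons_rV.
have mF : measurable_fun setT F.
  by apply: (measurable_fun_fubini_tonelli_F (f \o @cons_rV R n)) => // t /=.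
have F0 t : (0 <= F t)%E by apply: integral_ge0.
rewrite -[RHS](integral_translate_real c0 mF F0).
apply: eq_integral => t _; rewrite /F.
rewrite -(IHn (fun y => f (cons_rV (t + c0, y))) c').
- by apply: eq_integral => y _; rewrite cons_rVD.
- exact: (measurable_section (t + c0) mfcons).
- by [].
Qed.

End rowvec.

(** * Gaussian kernels *)

Section gauss.
Context {R : realType}.
Implicit Types n : nat.

Definition nsq n (x : 'rV[R]_n) : R := \sum_i x 0 i ^+ 2.

Lemma nsq_ge0 n (x : 'rV[R]_n) : 0 <= nsq x.
Proof. by apply: sumr_ge0 => i _; exact: sqr_ge0. Qed.

Lemma enorm_sqr n (x : 'rV[R]_n) : enorm x ^+ 2 = nsq x.
Proof. by rewrite sqr_sqrtr//; exact: nsq_ge0. Qed.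

Lemma enorm_lt n (x : 'rV[R]_n) r : 0 < r -> (enorm x < r) = (nsq x < r ^+ 2).
Proof. by move=> r0; rewrite -enorm_sqr ltr_pXn2r// nnegrE ?sqrtr_ge0// ltW. Qed.

Lemma nsqZ n (x : 'rV[R]_n) a : nsq (a *: x) = a ^+ 2 * nsq x.
Proof. by rewrite /nsq mulr_sumr; apply: eq_bigr => i _; rewrite mxE exprMn. Qed.

Lemma nsqN n (x : 'rV[R]_n) : nsq (- x) = nsq x.
Proof. by apply: eq_bigr => i _; rewrite mxE sqrrN. Qed.

Lemma nsqBC n (x y : 'rV[R]_n) : nsq (x - y) = nsq (y - x).
Proof. by rewrite -nsqN opprB. Qed.

Lemma coord_le_nsq n (x : 'rV[R]_n) i : x 0 i ^+ 2 <= nsq x.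
Proof.
by rewrite /nsq (bigD1 i)//= lerDl; apply: sumr_ge0 => j _; exact: sqr_ge0.
Qed.

Lemma nsqD_le n (x y : 'rV[R]_n) : nsq (x + y) <= 2 * nsq x + 2 * nsq y.
Proof.
rewrite /nsq !mulr_sumr -big_split/=; apply: ler_sum => i _; rewrite mxE.
by have := sqr_ge0 (x 0 i - y 0 i); nra.
Qed.

Lemma nsq_cons n (t : R) (y : 'rV[R]_n) : nsq (cons_rV (t, y)) = t ^+ 2 + nsq y.
Proof.
rewrite /nsq big_ord_recl cons_rV0; congr (_ + _).
by apply: eq_bigr => i _; rewrite cons_rVS.
Qed.

Lemma measurable_nsq n : measurable_fun setT (@nsq n).
Proof.
apply: measurable_sum => i; apply: measurable_funX.
exact: measurable_fun_coord_rV.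
Qed.

Lemma measurable_inv : measurable_fun [set: R] (@GRing.inv R).
Proof.
rewrite -(setUv [set (0 : R)]); apply/measurable_funU => //.
  exact: measurableC.
split.
  rewrite (_ : [set 0] = [set 0] `&` [set (0 : R)]) ?setIid//.
  exact: measurable_fun_set1.
apply: open_continuous_measurable_fun.
  rewrite (_ : [set~ 0] = [set x : R | x < 0] `|` [set x | 0 < x]).
    by apply: openU; [exact: open_lt|exact: open_gt].
  apply/seteqP; split => [x /= /eqP|x /= [x0|x0]].
  - by rewrite neq_lt => /orP.
  - by apply/eqP; rewrite lt_eqF.
  - by apply/eqP; rewrite gt_eqF.
by move=> x /set_mem/= /eqP x0; exact: inv_continuous.
Qed.

(** The heat kernel, with the normalisation [phi_r (x) = r^-n phi (x / r)]: time is
    [r^2 / 4] in the usual convention, so that scales add as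
    [sqrt (r^2 + s^2)]. *)
Definition gk n (r : R) (x : 'rV[R]_n) : R := dilate (@gaussian R n) r x.

Lemma gkE n r (x : 'rV[R]_n) :
  gk r x = pi `^ (- (n%:R / 2)) * r ^- n * expR (- nsq x / r ^+ 2).
Proof.
rewrite /gk /dilate /gaussian enorm_sqr nsqZ exprVn.
by rewrite mulrCA mulrA; congr (_ * expR _); rewrite mulNr mulrC.
Qed.

Lemma gk_gt0 n r (x : 'rV[R]_n) : 0 < r -> 0 < gk r x.
Proof.
move=> r0; rewrite gkE !mulr_gt0 ?expR_gt0// ?powR_gt0 ?pi_gt0//.
by rewrite invr_gt0 exprn_gt0.
Qed.

Lemma gk_ge0 n r (x : 'rV[R]_n) : 0 < r -> 0 <= gk r x.
Proof. by move=> r0; apply/ltW; exact: gk_gt0. Qed.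

Lemma measurable_gk2 n :
  measurable_fun setT (fun z : measurableTypeR R * 'rV[R]_n => gk z.1 z.2).
Proof.
under eq_fun do rewrite gkE.
apply: measurable_funM.
  apply: measurable_funM => //.
  apply: (measurableT_comp measurable_inv); apply: measurable_funX.
  exact: measurable_fst.
apply: measurableT_comp => //; apply: measurable_funM.
  apply: measurableT_comp => //; apply: (measurableT_comp (@measurable_nsq n)).
  exact: measurable_snd.
apply: (measurableT_comp measurable_inv); apply: measurable_funX.
exact: measurable_fst.
Qed.

Lemma measurable_gk n r : measurable_fun setT (@gk n r).
Proof. by have := measurable_section r (@measurable_gk2 n). Qed.

Lemma integral_gauss_real (r m : R) : 0 < r ->
  (\int[lebesgue_measure]_t
     (pi `^ (- 2^-1) * r^-1 * expR (- (m - t) ^+ 2 / r ^+ 2))%:E = 1)%E.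
Proof.
move=> r0; pose s := r / Num.sqrt 2.
have s20 : 0 < Num.sqrt 2 :> R by rewrite sqrtr_gt0.
have s0 : 0 < s by rewrite divr_gt0.
have s2 : s ^+ 2 *+ 2 = r ^+ 2.
  by rewrite /s expr_div_n sqr_sqrtr// -mulr_natr divfK.
rewrite -(integral_normal_pdf m s); apply: eq_integral => t _.
rewrite normal_pdfE ?gt_eqF// /normal_peak /normal_fun s2 -(sqrrN (t - m)) opprB.
congr (_ * _)%:E; rewrite -mulrnAl s2 sqrtrM ?sqr_ge0// sqrtr_sqr gtr0_norm//.
by rewrite powRN powR12_sqrt ?pi_ge0// invfM mulrC.
Qed.

(** In dimension [n.+1] the kernel is a product of kernels in dimensions 1 and [n];
    the case of the line is the total mass of the normal law of variance [r^2 / 2]. *)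
Lemma integral_gk n r (x : 'rV[R]_n) : 0 < r ->
  (\int[lebesgue_rV n]_y (gk r (x - y))%:E = 1)%E.
Proof.
move=> r0; elim: n x => [|n IHn] x.
  rewrite integral_dirac//; last first.
    apply/measurable_EFinP; apply: (measurableT_comp (measurable_gk r)).
    exact: measurable_funB_rV.
  rewrite diracT mul1e gkE /nsq big_ord0 !mul0r !oppr0 mul0r expR0 expr0.
  by rewrite powRr0 invr1 !mulr1.
have mB k (z : 'rV[R]_k) : measurable_fun setT (fun y : 'rV[R]_k => gk r (z - y)).
  by apply: (measurableT_comp (measurable_gk r)); exact: measurable_funB_rV.
rewrite integral_rV_succ; last 2 first.
- by apply/measurable_EFinP; exact: mB.
- by move=> y; rewrite lee_fin gk_ge0.
rewrite -(uncons_rVK x); set x0 : R := (uncons_rV x).1; set x' := (uncons_rV x).2.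
rewrite -[uncons_rV x]/(x0, x') -(@integral_gauss_real r x0 r0).
apply: eq_integral => t _.
under eq_integral => y _.
  rewrite cons_rVB gkE nsq_cons opprD mulrDl expRD.
  rewrite (_ : pi `^ _ * _ * _ = pi `^ (- 2^-1) * r^-1 *
    expR (- (x0 - t) ^+ 2 / r ^+ 2) * gk r (x' - y)); last first.
    rewrite gkE exprS invfM -addn1 natrD mulrDl mul1r opprD powRD; last first.
      by apply/implyP => _; rewrite gt_eqF// pi_gt0.
    by ring.
  rewrite EFinM; over.
rewrite ge0_integralZl ?IHn ?mule1//.
- by apply/measurable_EFinP; exact: mB.
- by move=> y _; rewrite lee_fin gk_ge0.
- by rewrite lee_fin !mulr_ge0 ?powR_ge0 ?expR_ge0// invr_ge0 ltW.
Qed.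

Lemma integrable_gk n r (x : 'rV[R]_n) : 0 < r ->
  (lebesgue_rV n).-integrable setT (fun y => (gk r (x - y))%:E).
Proof.
move=> r0; apply/integrableP; split.
  apply/measurable_EFinP; apply: (measurableT_comp (measurable_gk r)).
  exact: measurable_funB_rV.
under eq_integral do rewrite gee0_abs ?lee_fin ?gk_ge0//.
by rewrite integral_gk// ltry.
Qed.

Lemma Rintegral_gk n r (x : 'rV[R]_n) : 0 < r ->
  \int[lebesgue_rV n]_y gk r (x - y) = 1.
Proof. by move=> r0; rewrite /Rintegral integral_gk. Qed.

(** Completing the square in [y]: the product of two Gaussians is a Gaussian in [y]
    around a weighted mean of [x] and [z], times the kernel at scale
    [sqrt (r^2 + s^2)].  Integrating in [y] yields the semigroup law. *)
Lemma gk_mul n r s (x y z : 'rV[R]_n) : 0 < r -> 0 < s ->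
  let t := Num.sqrt (r ^+ 2 + s ^+ 2) in
  gk r (x - y) * gk s (y - z) =
  gk t (x - z) *
  gk (r * s / t) ((r ^+ 2 + s ^+ 2)^-1 *: (s ^+ 2 *: x + r ^+ 2 *: z) - y).
Proof.
move=> r0 s0 t.
have rs0 : 0 < r ^+ 2 + s ^+ 2 by rewrite addr_gt0// exprn_gt0.
have t2 : t ^+ 2 = r ^+ 2 + s ^+ 2 by rewrite sqr_sqrtr// ltW.
have t0 : 0 < t by rewrite sqrtr_gt0.
rewrite !gkE !expr_div_n.
rewrite [LHS](_ : _ = pi `^ (- (n%:R / 2)) ^+ 2 * ((r ^- n) * (s ^- n)) *
  expR (- nsq (x - y) / r ^+ 2 - nsq (y - z) / s ^+ 2)); last first.
  rewrite expRD !mulNr; move: (r ^- n) (s ^- n) => rn sn; ring.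
rewrite [RHS](_ : _ = pi `^ (- (n%:R / 2)) ^+ 2 * ((r ^- n) * (s ^- n)) *
  expR (- nsq (x - z) / t ^+ 2 - nsq ((r ^+ 2 + s ^+ 2)^-1 *: (s ^+ 2 *: x + r ^+ 2 *: z) - y) / ((r * s) ^+ 2 / t ^+ 2))); last first.
  rewrite expRD !mulNr exprMn; field.
  by rewrite !expf_neq0 ?gt_eqF.
congr (_ * expR _).
rewrite /nsq !mulNr -!opprD; congr (- _).
rewrite !mulr_suml -!big_split/=; apply: eq_bigr => i _; rewrite !mxE t2.
by field; rewrite ?gt_eqF.
Qed.

End gauss.

(** * The volume of Euclidean balls *)

Section balls.
Context {R : realType}.
Implicit Types n : nat.

Lemma eballE n (x : 'rV[R]_n) r : 0 < r ->
  eball x r = [set y | nsq (y - x) < r ^+ 2].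
Proof. by move=> r0; apply/seteqP; split=> y /=; rewrite /eball/= enorm_lt. Qed.

Lemma measurable_nsqB n (x : 'rV[R]_n) :
  measurable_fun setT (fun y : 'rV[R]_n => nsq (y - x)).
Proof.
by apply: (measurableT_comp (@measurable_nsq _ n)); exact: measurable_funB_rV.
Qed.

Lemma measurable_lt_cst d (T : measurableType d) (f : T -> R) (c : R) :
  measurable_fun setT f -> measurable [set x | f x < c].
Proof.
move=> mf; rewrite -[X in measurable X]setTI.
rewrite (_ : [set x | f x < c] = f @^-1` `]-oo, c[); first exact: mf.
by apply/seteqP; split => x /=; rewrite in_itv.
Qed.

Lemma measurable_eball n (x : 'rV[R]_n) r : 0 < r -> measurable (eball x r).
Proof. by move=> r0; rewrite eballE//; apply: measurable_lt_cst; exact: measurable_nsqB. Qed.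

(** Comparison of balls with cubes gives the only information on the volume of a
    ball that the proof uses: it is between two multiples of [r ^+ n]. *)
Definition cube n (x : 'rV[R]_n) (h : R) : set 'rV[R]_n :=
  [set y | forall i, `|y 0 i - x 0 i| < h].

Lemma measurable_cube n (x : 'rV[R]_n) h : measurable (cube x h).
Proof.
rewrite (_ : cube x h = \bigcap_(i in [set: 'I_n]) [set y | `|y 0 i - x 0 i| < h]).
  apply: fin_bigcap_measurable => // i _.
  apply: (@measurable_lt_cst _ _ (fun y : 'rV[R]_n => `|y 0 i - x 0 i|)).
  apply: measurableT_comp => //; apply: measurable_funB => //.
  exact: measurable_fun_coord_rV.
by apply/seteqP; split => y/= yx i; [move=> _; exact: yx|exact: (yx i I)].
Qed.

Lemma lebesgue_cube n (x : 'rV[R]_n) h : 0 < h ->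
  lebesgue_rV n (cube x h) = ((2 * h) ^+ n)%:E.
Proof.
move=> h0; elim: n x => [|n IHn] x.
  by rewrite /= diracE mem_set// => -[].
rewrite -(uncons_rVK x); set x0 : R := (uncons_rV x).1; set x' := (uncons_rV x).2.
rewrite -[uncons_rV x]/(x0, x').
change ((lebesgue_measure \x lebesgue_rV n)%E
  (@cons_rV R n @^-1` (cube (cons_rV (x0, x')) h)) = ((2 * h) ^+ n.+1)%:E).
rewrite (_ : _ @^-1` _ = [set` `]x0 - h, x0 + h[] `*` cube x' h); last first.
  apply/seteqP; split => [[t y]/= H|[t y]/= [+ H] i].
    split; first by have := H 0; rewrite !cons_rV0/= in_itv/= -ltr_distl.
    by move=> i; have := H (lift 0 i); rewrite !cons_rVS.
  rewrite in_itv/= -ltr_distl => th.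
  by have [j ->|->] := unliftP 0 i; rewrite ?cons_rVS ?cons_rV0//; exact: H.
rewrite product_measure1E//; last exact: measurable_cube.
have L : lebesgue_measure [set` `]x0 - h, x0 + h[] = (2 * h)%:E.
  rewrite lebesgue_measure_itv/= lte_fin ifT; last lra.
  by rewrite -EFinB; congr EFin; ring.
by rewrite exprS EFinM; congr (_ * _)%E; [exact: L|exact: IHn].
Qed.

Lemma eball_sub_cube n (x : 'rV[R]_n) r : 0 < r -> eball x r `<=` cube x r.
Proof.
move=> r0 y; rewrite eballE//= => yr i.
have := le_lt_trans (coord_le_nsq (y - x) i) yr; rewrite !mxE => h.
by rewrite -(@ltr_pXn2r _ 2) ?nnegrE ?(ltW r0)// real_normK ?num_real.
Qed.

Lemma cube_sub_eball n (x : 'rV[R]_n) r : 0 < r ->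
  cube x (r / n.+1%:R) `<=` eball x r.
Proof.
move=> r0 y; rewrite eballE//= => yr.
have n0 : (0 : R) < n.+1%:R by rewrite ltr0n.
apply: (@le_lt_trans _ _ (\sum_(i < n) (r / n.+1%:R) ^+ 2)).
  apply: ler_sum => i _; rewrite -[leLHS]real_normK ?num_real// !mxE.
  by have h := yr i; rewrite lerXn2r ?nnegrE ?divr_ge0 ?(ltW h) ?(ltW r0).
rewrite sumr_const card_ord expr_div_n -[X in X < _]mulr_natr.
rewrite [X in X < _](_ : _ = r ^+ 2 * n%:R / n.+1%:R ^+ 2); last by rewrite mulrAC.
rewrite ltr_pdivrMr ?exprn_gt0//.
rewrite ltr_pM2l ?exprn_gt0// -natrX ltr_nat.
by rewrite expnS expn1 leq_pmulr.
Qed.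

Lemma lebesgue_eball_le n (x : 'rV[R]_n) r : 0 < r ->
  (lebesgue_rV n (eball x r) <= ((2 * r) ^+ n)%:E)%E.
Proof.
move=> r0; rewrite -(lebesgue_cube x r0); apply: le_measure; rewrite ?inE.
- exact: measurable_eball.
- exact: measurable_cube.
- exact: eball_sub_cube.
Qed.

Lemma lebesgue_eball_ge n (x : 'rV[R]_n) r : 0 < r ->
  (((2 * r / n.+1%:R) ^+ n)%:E <= lebesgue_rV n (eball x r))%E.
Proof.
move=> r0; have rn0 : 0 < r / n.+1%:R by rewrite divr_gt0 ?ltr0n.
rewrite -mulrA -(lebesgue_cube x rn0); apply: le_measure; rewrite ?inE.
- exact: measurable_cube.
- exact: measurable_eball.
- exact: cube_sub_eball.
Qed.

Lemma lebesgue_eball_fin n (x : 'rV[R]_n) r : 0 < r ->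
  lebesgue_rV n (eball x r) \is a fin_num.
Proof.
move=> r0; rewrite ge0_fin_numE//.
exact: (le_lt_trans (lebesgue_eball_le x r0) (ltry _)).
Qed.

Lemma lebesgue_eball_gt0 n (x : 'rV[R]_n) r : 0 < r ->
  (0 < lebesgue_rV n (eball x r))%E.
Proof.
move=> r0; apply: (lt_le_trans _ (lebesgue_eball_ge x r0)).
by rewrite lte_fin exprn_gt0// divr_gt0 ?ltr0n// mulr_gt0.
Qed.

End balls.

(** * Exponential decay against polynomial growth *)

(** Cut the space into the annuli [4^k <= s < 4^(k+1)].  On the k-th one the
    exponential is smaller than any geometric sequence, in particular than
    [(2 A)^-k], against a mass [M A^k].  The lemma serves twice: for the mass of a
    doubling weight on balls, and for a Carleson measure on tents. *)
Lemma annuli_bound (R : realType) (A kappa : R) : 1 <= A -> 0 < kappa ->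
  exists2 K : R, 0 < K & forall d (T : measurableType d)
    (m : {measure set T -> \bar R}) (f : T -> \bar R) (s : T -> R) (M : R),
  measurable_fun setT f -> (forall x, 0 <= f x)%E ->
  measurable_fun setT s -> (forall x, 0 <= s x) -> 0 <= M ->
  (forall k, (\int[m]_(x in [set x | (s x < 4 ^+ k)%R]) f x <= (M * A ^+ k)%:E)%E) ->
  (\int[m]_x ((expR (- (kappa * s x)))%:E * f x) <= (K * M)%:E)%E.
Proof.
move=> A1 k0.
have A0 : 0 < A by lra.
(* The ratio 4^-N of the majorant beats A^k by a further factor 2^-k. *)
pose N := Num.bound (2 * A).
have N2A : 2 * A < N%:R by apply: archi_boundP; lra.
have N0 : (0 < N)%N by rewrite -(ltr_nat R); lra.
have N4 : 2 * A <= 4 ^+ N.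
  apply: (le_trans (ltW N2A)); rewrite -natrX ler_nat ltnW//.
  exact: ltn_expl.
pose B := (4 * N%:R / kappa) ^+ N.
have B0 : 0 <= B by rewrite exprn_ge0// divr_ge0 ?(ltW k0)// mulr_ge0.
pose C := 1 + B.
have C0 : 0 < C by rewrite /C; lra.
pose c k := C * (4 ^+ N)^-1 ^+ k.
have c0 k : 0 <= c k.
  by rewrite /c mulr_ge0 ?(ltW C0)// exprn_ge0// invr_ge0 exprn_ge0.
have key (t : R) : 0 <= t -> exists k, t < 4 ^+ k /\ expR (- (kappa * t)) <= c k.
  move=> t0.
  have ex : exists k, t < 4 ^+ k.
    exists (Num.bound t); apply: (lt_trans (archi_boundP t0)).
    by rewrite -natrX ltr_nat ltn_expl.
  exists (ex_minn ex); case: ex_minnP => k tk mink; split => //.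
  case: k tk mink => [|k] tk mink.
    rewrite /c expr0 mulr1 (@le_trans _ _ 1)//; last by rewrite /C; lra.
    by rewrite -expR0 ler_expR oppr_le0 mulr_ge0// ltW.
  have kt : 4 ^+ k <= t.
    by rewrite leNgt; apply/negP => /mink; rewrite ltnn.
  have p4 : (0 : R) < 4 ^+ k by rewrite exprn_gt0.
  have NR0 : (0 : R) < N%:R by rewrite ltr0n.
  apply: (@le_trans _ _ (B * (4 ^+ N)^-1 ^+ k.+1)); last first.
    by rewrite ler_wpM2r ?exprn_ge0 ?invr_ge0 ?exprn_ge0// /C; lra.
  rewrite (_ : B * _ = ((kappa * 4 ^+ k / N%:R) ^+ N)^-1); last first.
    rewrite [X in _ * X](_ : _ = (4 ^+ k.+1)^-1 ^+ N); last first.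
      by rewrite !exprVn -!exprM mulnC.
    rewrite /B -exprMn -[RHS]exprVn; congr (_ ^+ _).
    by rewrite exprS; field; rewrite !gt_eqF.
  rewrite expRN lef_pV2 ?posrE ?expR_gt0 ?exprn_gt0 ?divr_gt0 ?mulr_gt0//.
  rewrite (_ : kappa * t = (kappa * t / N%:R) * N%:R); last first.
    by rewrite divfK// gt_eqF.
  rewrite expRM_natr lerXn2r ?nnegrE ?expR_ge0//.
    by rewrite divr_ge0 ?(ltW NR0)// mulr_ge0 ?(ltW k0)// ltW.
  apply: (@le_trans _ _ (kappa * t / N%:R)).
    by rewrite ler_wpM2r ?invr_ge0 ?(ltW NR0)// ler_wpM2l// ltW.
  by have := expR_ge1Dx (kappa * t / N%:R); lra.
exists (2 * C); first lra.
move=> d T m f s M mf f0 ms s0 M0 fM.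
pose E k := [set x | s x < 4 ^+ k].
have mE k : measurable (E k).
  rewrite -[X in measurable X]setTI (_ : E k = s @^-1` `]-oo, 4 ^+ k[).
    exact: ms.
  by apply/seteqP; split => x /=; rewrite /E/= in_itv.
pose g k x := ((c k)%:E * (f \_ (E k)) x)%E.
have fE0 k x : (0 <= (f \_ (E k)) x)%E by rewrite patchE; case: ifP.
have mfE k : measurable_fun setT (f \_ (E k)).
  exact: (measurable_restrictT f (mE k)).1 (measurable_funTS mf).
have g0 k x : (0 <= g k x)%E by rewrite mule_ge0// lee_fin.
have mg k : measurable_fun setT (g k) by exact: measurable_funeM.
apply: (@le_trans _ _ (\int[m]_x \sum_(0 <= k <oo) g k x)%E).
  apply: ge0_le_integral => //.
  - by move=> x _; rewrite mule_ge0// lee_fin expR_ge0.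
  - apply: emeasurable_funM => //; apply/measurable_EFinP.
    apply: measurableT_comp => //; apply: measurableT_comp => //.
    exact: measurable_funM.
  - exact: ge0_emeasurable_sum.
  move=> x _; have [k [sk ek]] := key _ (s0 x).
  apply: (@le_trans _ _ (g k x)).
    rewrite /g patchE mem_set//; apply: lee_wpmul2r => //.
  apply: (le_trans _ (@nneseries_lim_ge R (fun k => g k x) xpredT 0 k.+1 _)) => //.
  by rewrite big_nat_recr//= leeDr// sume_ge0.
rewrite integral_nneseries//.
apply: (le_trans _ (@epsilon_trick0 R (2 * C * M) xpredT _)); last first.
  by rewrite mulr_ge0// mulr_ge0// ltW.
apply: lee_nneseries => [k _ _|k _]; first exact: integral_ge0.
have -> : (\int[m]_x g k x = (c k)%:E * \int[m]_(x in E k) f x)%E.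
  by rewrite [in RHS]integral_mkcond -ge0_integralZl// lee_fin.
apply: (@le_trans _ _ ((c k)%:E * (M * A ^+ k)%:E)%E).
  by apply: lee_wpmul2l; [rewrite lee_fin|exact: fM].
have e2 : 2 * C * M / (2 ^ k.+1)%:R = C * M * (2 ^+ k)^-1.
  rewrite natrX exprS; have : (2 : R) ^+ k != 0 by rewrite expf_neq0.
  by move: (2 ^+ k) => u u0; field.
rewrite -EFinM lee_fin /c e2.
rewrite [leLHS](_ : _ = C * M * (A / 4 ^+ N) ^+ k); last first.
  by rewrite exprMn; move: (4 ^- N ^+ k) (A ^+ k) => u v; ring.
apply: ler_wpM2l; first by rewrite mulr_ge0// ltW.
rewrite -[leRHS]exprVn; apply: lerXn2r; rewrite ?nnegrE ?invr_ge0//.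
  by rewrite divr_ge0 ?(ltW A0)// exprn_ge0.
by rewrite ler_pdivrMr ?exprn_gt0//; lra.
Qed.

(** * Differentiation under the integral, and derivatives of the Gaussian *)

Section kernels.
Context {R : realType}.
Implicit Types n : nat.

Lemma is_derive_integral d (T : measurableType d)
    (m : {measure set T -> \bar R}) (f f' : R -> T -> R) (G : T -> R) (a u v : R) :
  a \in `]u, v[ ->
  (forall x, x \in `]u, v[ -> m.-integrable setT (EFin \o f x)) ->
  (forall x y, x \in `]u, v[ -> is_derive x (1 : R) (f ^~ y) (f' x y)) ->
  m.-integrable setT (EFin \o G) ->
  (forall x y, x \in `]u, v[ -> `|f' x y| <= G y) ->
  is_derive a (1 : R) (fun x => \int[m]_y f x y) (\int[m]_y f' a y).
Proof.
move=> auv intf df intG f'G.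
have d1E x y : x \in `]u, v[ -> partial1of2 f x y = f' x y.
  by move=> xuv; rewrite partial1of2E; have := df x y xuv => ?; rewrite derive_val.
have G0 y : 0 <= G y by exact: le_trans (f'G a y auv).
have intf' x : `]u, v[%classic x -> m.-integrable setT (EFin \o f x).
  by move=> xuv; exact: intf.
have df1 x y : `]u, v[%classic x -> [set: T] y -> derivable (f ^~ y) x 1.
  by move=> xuv _; have [] := df x y xuv.
have Gb x y : `]u, v[%classic x -> [set: T] y -> `|partial1of2 f x y| <= G y.
  by move=> xuv _; rewrite d1E//; exact: f'G.
have D := derivable_under_integral measurableT auv intf' df1 G0 intG Gb.
have E := differentiation_under_integral measurableT auv intf' df1 G0 intG Gb.
apply: DeriveDef => //; rewrite -derive1E E.
by apply: eq_Rintegral => y _; rewrite d1E.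
Qed.

(** Directional derivatives are computed along a line, where the rules for functions
    of one real variable apply. *)
Lemma is_derive_line n (f : 'rV[R]_n -> R) (x v : 'rV[R]_n) (l : R) :
  is_derive (0 : R) (1 : R) (fun h : R => f (x + h *: v)) l ->
  is_derive x v (f : 'rV[R]_n -> R^o) l.
Proof.
move=> [D E].
have EQ : (fun h : R => h^-1 *: (((fun h : R => f (x + h *: v)) \o shift 0) (h *: 1) - f (x + 0 *: v)))
    = (fun h : R => h^-1 *: (((f : 'rV[R]_n -> R^o) \o shift x) (h *: v) - (f : 'rV[R]_n -> R^o) x)).
  apply/funext => h /=; have hA : (h%:A : R) = h := mulr1 h.
  by rewrite scale0r !addr0 hA [x + _]addrC.
apply: DeriveDef.
  by move: D; rewrite /derivable EQ.
by rewrite -E /derive EQ.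
Qed.

Lemma is_derive_shift (f : R -> R) (c h l : R) :
  is_derive (c + h) (1 : R) f l -> is_derive h (1 : R) (fun t => f (c + t)) l.
Proof.
move=> D.
have dc : is_derive h (1 : R) (fun t : R => c + t) 1.
  exact: (is_derive_eq (is_deriveD (is_derive_cst c h 1) (is_derive_id h 1))
    (add0r 1)).
by have := @is_derive1_comp _ f (fun t => c + t) h l 1 D dc; rewrite mulr1.
Qed.

Definition unit_rV n (i : 'I_n) : 'rV[R]_n := delta_mx 0 i.

Lemma coord_unit n (x : 'rV[R]_n) h i j :
  (x + h *: unit_rV i) 0 j = x 0 j + h * (j == i)%:R.
Proof. by rewrite !mxE eqxx. Qed.

Lemma nsq_unit n (x : 'rV[R]_n) h i :
  nsq (x + h *: unit_rV i) = nsq x + (2 * x 0 i * h + h ^+ 2).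
Proof.
rewrite /nsq (bigD1 i)//= [X in _ = X + _](bigD1 i)//= coord_unit eqxx mulr1.
rewrite (eq_bigr (fun j => x 0 j ^+ 2)); last first.
  by move=> j ji; rewrite coord_unit (negbTE ji) mulr0 addr0.
by ring.
Qed.

(** The derivatives of the heat kernel: first and second in the direction [i], and
    (for [gkr]) in the scale.  They are polynomials times the kernel, which is what
    makes them [gauss_kernel]s. *)
Definition gk1 n (i : 'I_n) (r : R) (x : 'rV[R]_n) : R :=
  - (2 * x 0 i / r ^+ 2) * gk r x.

Definition gk2 n (i : 'I_n) (r : R) (x : 'rV[R]_n) : R :=
  (4 * x 0 i ^+ 2 / r ^+ 4 - 2 / r ^+ 2) * gk r x.

Definition gkr n (r : R) (x : 'rV[R]_n) : R :=
  (2 * nsq x / r ^+ 3 - n%:R / r) * gk r x.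

(** The heat equation. *)
Lemma gkrE n r (x : 'rV[R]_n) : r != 0 -> gkr r x = r / 2 * \sum_i gk2 i r x.
Proof.
move=> r0; rewrite /gkr /gk2 -mulr_suml mulrA; congr (_ * _).
rewrite big_split/= sumr_const card_ord -mulr_suml -mulr_sumr -/(nsq x) -mulr_natr.
by field.
Qed.

Lemma is_derive_gk n (i : 'I_n) r (x : 'rV[R]_n) h :
  is_derive h (1 : R) (fun t => gk r (x + t *: unit_rV i))
    (gk1 i r (x + h *: unit_rV i)).
Proof.
pose p (t : R) : R := - (nsq x + (2 * x 0 i * t + t ^+ 2)) / r ^+ 2.
have dp : is_derive h (1 : R) p (- (2 * x 0 i + 2 * h) / r ^+ 2).
  rewrite /p; apply: is_derive_eq.
  by rewrite /GRing.scale/=; ring.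
have de : is_derive h (1 : R) (expR \o p) (- (2 * x 0 i + 2 * h) / r ^+ 2 * expR (p h)).
  by apply: is_derive_eq; rewrite /GRing.scale/= mulrC.
have -> : (fun t => gk r (x + t *: unit_rV i)) =
    (fun t => pi `^ (- (n%:R / 2)) * r ^- n * (expR \o p) t).
  by apply/funext => t; rewrite gkE nsq_unit.
apply: is_derive_eq; rewrite /gk1 gkE nsq_unit coord_unit eqxx mulr1.
by rewrite /GRing.scale/= -/(p h); ring.
Qed.

Lemma is_derive_gk1 n (i : 'I_n) r (x : 'rV[R]_n) h :
  is_derive h (1 : R) (fun t => gk1 i r (x + t *: unit_rV i))
    (gk2 i r (x + h *: unit_rV i)).
Proof.
have D := is_derive_gk i r x h.
have -> : (fun t => gk1 i r (x + t *: unit_rV i)) =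
    (fun t => - (2 * (x 0 i + t) / r ^+ 2) * gk r (x + t *: unit_rV i)).
  by apply/funext => t; rewrite /gk1 coord_unit eqxx mulr1.
apply: is_derive_eq.
rewrite /gk2 /gk1 !coord_unit eqxx mulr1; set g := gk _ _.
by rewrite /GRing.scale/= -!exprVn; ring.
Qed.

Lemma is_derive_gkr n (r : R) (x : 'rV[R]_n) : 0 < r ->
  is_derive r (1 : R) (fun t => gk t x) (gkr r x).
Proof.
move=> r0; have rn0 : r != 0 by rewrite gt_eqF.
have -> : (fun t => gk t x) =
    (fun t => pi `^ (- (n%:R / 2)) * t ^- n * expR (- nsq x / t ^+ 2)).
  by apply/funext => t; rewrite gkE.
have d2 : is_derive r (1 : R) (fun t : R => - nsq x / t ^+ 2) (2 * nsq x / r ^+ 3).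
  have : r ^+ 2 != 0 by rewrite expf_neq0.
  move=> r20; apply: is_derive_eq.
  by rewrite /GRing.scale/=; field.
have de : is_derive r (1 : R) (fun t : R => expR (- nsq x / t ^+ 2))
    (2 * nsq x / r ^+ 3 * expR (- nsq x / r ^+ 2)).
  rewrite (_ : (fun t : R => _) = expR \o (fun t : R => - nsq x / t ^+ 2))//.
  by apply: is_derive_eq; rewrite /GRing.scale/= mulrC.
rewrite /gkr gkE; case: n x d2 de => [|k] x d2 de.
  rewrite (_ : (fun t : R => _) =
    (fun t => pi `^ (- (0%:R / 2)) * expR (- nsq x / t ^+ 2))); last first.
    by apply/funext => t; rewrite expr0 invr1 mulr1.
  apply: is_derive_eq.
  by rewrite /GRing.scale/= !mul0r expr0 invr1; ring.
have rk0 : r ^+ k.+1 != 0 by rewrite expf_neq0.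
have dX : is_derive r (1 : R) (fun t : R => t ^+ k.+1) (k.+1%:R * r ^+ k).
  by apply: DeriveDef; [exact: exprn_derivable|rewrite -derive1E exp_derive1].
have dV := @is_deriveV _ (fun t : R => t ^+ k.+1) r _ 1 rk0 dX.
apply: is_derive_eq; rewrite /GRing.scale/=.
have rk1 : r ^+ k != 0 by rewrite expf_neq0.
by rewrite !exprS; move: (r ^+ k) rk1 => u u0; field; rewrite ?rn0 ?u0.
Qed.

End kernels.

(** * Convolution with Gaussian-like kernels *)

Section conv.
Context {R : realType}.
Implicit Types n : nat.

(** A linear factor is absorbed by giving up half of the rate of decay. *)
Lemma expR_absorb (s kappa : R) : 0 <= s -> 0 < kappa ->
  (1 + s) * expR (- (kappa * s)) <= (1 + 2 / kappa) * expR (- (kappa / 2 * s)).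
Proof.
move=> s0 k0.
have -> : - (kappa * s) = - (kappa / 2 * s) + - (kappa / 2 * s) by field.
rewrite expRD mulrA ler_wpM2r ?expR_ge0//.
rewrite expRN ler_pdivrMr ?expR_gt0//.
have k2 : 0 < 2 / kappa by rewrite divr_gt0.
have := expR_ge1Dx (kappa / 2 * s) => h.
apply: (@le_trans _ _ ((1 + 2 / kappa) * (1 + kappa / 2 * s))).
  have -> : (1 + 2 / kappa) * (1 + kappa / 2 * s) =
    1 + s + (2 / kappa + kappa / 2 * s) by field; rewrite gt_eqF.
  have : 0 <= kappa / 2 * s by rewrite mulr_ge0// divr_ge0// ltW.
  by lra.
by rewrite ler_wpM2l//; lra.
Qed.

Lemma gk_le n (lo hi r : R) (x : 'rV[R]_n) : 0 < lo -> lo <= r -> r <= hi ->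
  gk r x <= pi `^ (- (n%:R / 2)) * lo ^- n * expR (- (hi ^- 2 * nsq x)).
Proof.
move=> lo0 lor rhi; have r0 : 0 < r by lra.
rewrite gkE -!mulrA ler_wpM2l ?powR_ge0//; apply: ler_pM.
- by rewrite invr_ge0 exprn_ge0// ltW.
- exact: expR_ge0.
- by rewrite lef_pV2 ?posrE ?exprn_gt0// lerXn2r ?nnegrE// ltW.
rewrite ler_expR mulNr lerN2 mulrC ler_wpM2l ?nsq_ge0//.
by rewrite lef_pV2 ?posrE ?exprn_gt0 ?lerXn2r ?nnegrE//; lra.
Qed.

Lemma nsq_shift n (y z : 'rV[R]_n) : nsq z / 2 - nsq y <= nsq (y - z).
Proof.
by have := nsqD_le y (z - y); rewrite addrC subrK (nsqBC z y); lra.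
Qed.

(** Uniformity in [y] on bounded sets and in [r] on compact subsets of the half line
    provides the majorants for differentiation under the integral. *)
Lemma gk_dom n (lo hi B : R) : 0 < lo -> lo <= hi ->
  exists C kappa : R, [/\ 0 < C, 0 < kappa & forall r (y z : 'rV[R]_n),
    lo <= r -> r <= hi -> nsq y <= B ->
    (1 + nsq (y - z)) * gk r (y - z) <= C * expR (- (kappa * nsq z))].
Proof.
move=> lo0 lohi; have hi0 : 0 < hi by lra.
pose k0 := hi ^- 2; have k00 : 0 < k0 by rewrite invr_gt0 exprn_gt0.
pose A := pi `^ (- (n%:R / 2)) * lo ^- n : R.
have A0 : 0 < A by rewrite mulr_gt0 ?powR_gt0 ?pi_gt0// invr_gt0 exprn_gt0.
have c0 : 0 < 1 + 2 / k0 by rewrite addr_gt0// divr_gt0.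
exists (A * (1 + 2 / k0) * expR (k0 / 2 * B)), (k0 / 4); split.
- by apply: mulr_gt0; [exact: mulr_gt0|exact: expR_gt0].
- by rewrite divr_gt0.
move=> r y z lor rhi yB.
apply: (@le_trans _ _ ((1 + nsq (y - z)) * (A * expR (- (k0 * nsq (y - z)))))).
  by rewrite ler_wpM2l ?addr_ge0 ?nsq_ge0//; exact: gk_le.
rewrite mulrCA -[leRHS]mulrA -[leRHS]mulrA (ler_wpM2l (ltW A0))//.
apply: (le_trans (expR_absorb (nsq_ge0 _) k00)).
rewrite (ler_wpM2l (ltW c0))// -expRD ler_expR.
have := nsq_shift y z => h.
have : k0 / 2 * (nsq z / 2 - nsq y) <= k0 / 2 * nsq (y - z).
  by rewrite ler_wpM2l// divr_ge0// ltW.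
have : k0 / 2 * nsq y <= k0 / 2 * B by rewrite ler_wpM2l// divr_ge0// ltW.
by lra.
Qed.

(** Integrability against all centred Gaussians, equivalently against all
    translates: this is the natural domain of the heat semigroup. *)
Definition gauss_integrable n (w : 'rV[R]_n -> R) :=
  forall kappa : R, 0 < kappa ->
  (lebesgue_rV n).-integrable setT
    (fun z => (expR (- (kappa * nsq z)) * w z)%:E).

(** The pointwise bound shared by the heat kernel and its first two derivatives; all
    the convolution lemmas are proved for kernels of this kind. *)
Definition gauss_kernel n (P r : R) (k : 'rV[R]_n -> R) :=
  measurable_fun setT k /\ forall x, `|k x| <= P * ((1 + nsq x) * gk r x).

Lemma measurable_subl n (y : 'rV[R]_n) (k : 'rV[R]_n -> R) :
  measurable_fun setT k -> measurable_fun setT (fun z : 'rV[R]_n => k (y - z)).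
Proof. by move=> mk; apply: (measurableT_comp mk); exact: measurable_funB_rV. Qed.

Lemma integrable_dom n (w : 'rV[R]_n -> R) (C kappa : R) : 0 < kappa ->
  gauss_integrable w ->
  (lebesgue_rV n).-integrable setT
    (EFin \o (fun z => C * `|expR (- (kappa * nsq z)) * w z|)).
Proof.
move=> k0 gw.
have /(integrableZl measurableT C) := integrable_norm (gw _ k0).
exact.
Qed.

Lemma integrable_conv n P r k (w : 'rV[R]_n -> R) y :
  0 < r -> 0 <= P -> gauss_kernel P r k -> measurable_fun setT w ->
  gauss_integrable w ->
  (lebesgue_rV n).-integrable setT (fun z => (k (y - z) * w z)%:E).
Proof.
move=> r0 P0 [mk kP] mw gw.
have [C [kappa [C0 k0 H]]] := @gk_dom n r r (nsq y) r0 (lexx r).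
apply: (le_integrable measurableT _ _ (integrable_dom (P * C) k0 gw)).
  by apply/measurable_EFinP/measurable_funM => //; exact: measurable_subl.
move=> z _; rewrite /= lee_fin !normrM !normr_id.
rewrite (ger0_norm P0) (gtr0_norm C0) !mulrA ler_wpM2r//.
apply: (le_trans (kP _)); rewrite -mulrA ler_wpM2l//.
by rewrite (ger0_norm (expR_ge0 _)); exact: H.
Qed.

Lemma is_derive_line0 n (F F' : 'rV[R]_n -> R) i y h :
  (forall y, is_derive (0 : R) (1 : R) (fun t : R => F (y + t *: unit_rV i)) (F' y)) ->
  is_derive (h : R) (1 : R) (fun t : R => F (y + t *: unit_rV i))
    (F' (y + h *: unit_rV i)).
Proof.
move=> D; have := D (y + h *: unit_rV i).
set g := (fun t : R => _).
have -> : (fun t : R => F (y + t *: unit_rV i)) = (fun t => g (- h + t)).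
  apply/funext => t; rewrite /g -addrA -scalerDl; congr (F (_ + _ *: _)).
  by ring.
move=> Dg; apply: is_derive_shift; by rewrite addNr.
Qed.

Lemma is_derive_conv_line n P r (k k' : 'rV[R]_n -> R) i (w : 'rV[R]_n -> R) y :
  0 < r -> 0 <= P -> gauss_kernel P r k -> gauss_kernel P r k' ->
  (forall x h, is_derive (h : R) (1 : R) (fun t : R => k (x + t *: unit_rV i))
    (k' (x + h *: unit_rV i))) ->
  measurable_fun setT w -> gauss_integrable w ->
  is_derive (0 : R) (1 : R) (fun t : R => convolution k w (y + t *: unit_rV i))
    (convolution k' w y).
Proof.
move=> r0 P0 gk gk' dk mw gw.
have [C [kappa [C0 k0 H]]] := @gk_dom n r r (2 * nsq y + 2) r0 (lexx r).
pose f (h : R) z := k (y + h *: unit_rV i - z) * w z.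
pose f' (h : R) z := k' (y + h *: unit_rV i - z) * w z.
have -> : convolution k' w y = \int[lebesgue_rV n]_z f' 0 z.
  by apply: eq_Rintegral => z _; rewrite /f' scale0r addr0.
apply: (@is_derive_integral _ _ _ _ f f'
  (fun z => P * C * `|expR (- (kappa * nsq z)) * w z|) 0 (-1) 1).
- by rewrite in_itv/=; lra.
- by move=> h _; exact: (integrable_conv _ r0 P0 gk).
- move=> h z _; rewrite /f /f'.
  have e t : y + t *: unit_rV i - z = (y - z) + t *: unit_rV i by rewrite addrAC.
  have -> : (fun x : R => k (y + x *: unit_rV i - z) * w z) =
     (fun x : R => k (y - z + x *: unit_rV i) * w z).
    by apply/funext => t; rewrite e.
  rewrite e; have D := dk (y - z) h.
  by apply: is_derive_eq; rewrite /GRing.scale/=; ring.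
- exact: integrable_dom.
- move=> h z; rewrite in_itv/= => /andP[h1 h2].
  rewrite /f' !normrM (ger0_norm (expR_ge0 _)) !mulrA ler_wpM2r//.
  apply: (le_trans (gk'.2 _)); rewrite -mulrA ler_wpM2l//.
  apply: H => //; rewrite nsq_unit.
  have := coord_le_nsq y i; have := sqr_ge0 (y 0 i - h).
  have : h ^+ 2 < 1 by rewrite -sqrrN expr2; nra.
  by nra.
Qed.

Lemma is_derive_conv_time n P (lo hi : R) (k k' : R -> 'rV[R]_n -> R) (w : 'rV[R]_n -> R) y r :
  0 < lo -> lo < r -> r < hi -> 0 <= P ->
  (forall t, lo < t -> t < hi -> gauss_kernel P t (k t)) ->
  (forall t, lo < t -> t < hi -> gauss_kernel P t (k' t)) ->
  (forall x t, lo < t -> t < hi -> is_derive (t : R) (1 : R) (fun t => k t x) (k' t x)) ->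
  measurable_fun setT w -> gauss_integrable w ->
  is_derive (r : R) (1 : R) (fun t => convolution (k t) w y) (convolution (k' r) w y).
Proof.
move=> lo0 lor rhi P0 gk gk' dk mw gw.
have lohi : lo <= hi by lra.
have [C [kappa [C0 k0 H]]] := @gk_dom n lo hi (nsq y) lo0 lohi.
pose f (t : R) (z : 'rV[R]_n) := k t (y - z) * w z.
pose f' (t : R) (z : 'rV[R]_n) := k' t (y - z) * w z.
apply: (@is_derive_integral _ _ _ _ f f'
  (fun z => P * C * `|expR (- (kappa * nsq z)) * w z|) r lo hi).
- by rewrite in_itv/= lor.
- move=> t; rewrite in_itv/= => /andP[h1 h2].
  by apply: (integrable_conv _ _ P0 (gk t h1 h2)) => //; lra.
- move=> t z; rewrite in_itv/= => /andP[h1 h2].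
  have D := dk (y - z) t h1 h2; rewrite /f /f'.
  by apply: is_derive_eq; rewrite /GRing.scale/=; ring.
- exact: integrable_dom.
- move=> t z; rewrite in_itv/= => /andP[h1 h2].
  rewrite !normrM (ger0_norm (expR_ge0 _)) !mulrA ler_wpM2r//.
  apply: (le_trans ((gk' t h1 h2).2 _)); rewrite -mulrA ler_wpM2l//.
  by apply: H => //; exact: ltW.
Qed.

Lemma continuous_conv_time n P (lo hi : R) (k : R -> 'rV[R]_n -> R) (w : 'rV[R]_n -> R) y r :
  0 < lo -> lo < r -> r < hi -> 0 <= P ->
  (forall t, lo < t -> t < hi -> gauss_kernel P t (k t)) ->
  (forall x t, lo < t -> t < hi -> {for t, continuous (fun t => k t x)}) ->
  measurable_fun setT w -> gauss_integrable w ->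
  {for r, continuous (fun t => convolution (k t) w y)}.
Proof.
move=> lo0 lor rhi P0 gk ck mw gw.
have lohi : lo <= hi by lra.
have [C [kappa [C0 k0 H]]] := @gk_dom n lo hi (nsq y) lo0 lohi.
have rI : r \in `]lo, hi[%classic by rewrite inE/= in_itv/= lor.
apply: (@continuity_under_integral R _ _ (lebesgue_rV n)
  (fun t z => k t (y - z) * w z) setT measurableT lo hi _ _
  (fun z => P * C * `|expR (- (kappa * nsq z)) * w z|) _ _ r rI).
- move=> t; rewrite /= in_itv/= => /andP[h1 h2].
  by apply: (integrable_conv _ _ P0 (gk t h1 h2)) => //; lra.
- apply: aeW => z _ t; rewrite inE/= in_itv/= => /andP[h1 h2].
  by apply: cvgM; [exact: ck|exact: cvg_cst].
- exact: integrable_dom.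
- move=> t; rewrite /= in_itv/= => /andP[h1 h2]; apply: aeW => z _.
  rewrite !normrM (ger0_norm (expR_ge0 _)) !mulrA ler_wpM2r//.
  apply: (le_trans ((gk t h1 h2).2 _)); rewrite -mulrA ler_wpM2l//.
  by apply: H => //; exact: ltW.
Qed.

End conv.

(** * Measurability of convolutions, and the derivatives of the Gaussian as kernels *)

Section weights.
Context {R : realType} (n : nat).
Local Notation Rn := 'rV[R]_n.
Local Notation mu := (@lebesgue_rV R n).
Implicit Types w : Rn -> R.

(** The joint measurability in scale and point is needed to integrate over strips;
    it reduces to Tonelli's theorem for the positive and negative parts. *)
Lemma measurable_conv2 (k : R -> Rn -> R) w :
  measurable_fun setT (fun p : measurableTypeR R * Rn => k p.1 p.2) ->
  measurable_fun setT w ->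
  measurable_fun setT
    (fun p : measurableTypeR R * Rn => convolution (k p.1) w p.2).
Proof.
move=> mk mw.
pose T := (measurableTypeR R * Rn)%type.
pose F (q : T * Rn) : \bar R := (k q.1.1 (q.1.2 - q.2) * w q.2)%:E.
have mF : measurable_fun setT F.
  apply/measurable_EFinP; apply: measurable_funM.
    apply: (measurableT_comp mk (g := fun q : T * Rn => (q.1.1, q.1.2 - q.2))).
    apply/measurable_fun_pairP; split => /=.
      exact: (measurableT_comp measurable_fst measurable_fst).
    apply: measurable_funB_rV; last exact: measurable_snd.
    exact: (measurableT_comp measurable_snd measurable_fst).
  exact: (measurableT_comp mw measurable_snd).
pose Fp := fun q => (F^\+ q)%E; pose Fn := fun q => (F^\- q)%E.
have mFp : measurable_fun setT Fp by exact: measurable_funepos.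
have mFn : measurable_fun setT Fn by exact: measurable_funeneg.
have -> : (fun p : T => convolution (k p.1) w p.2) =
    (fun p => fine (fubini_F mu Fp p - fubini_F mu Fn p)%E).
  apply/funext => p; rewrite /convolution /Rintegral integralE.
  rewrite /fubini_F /Fp /Fn; congr (fine (_ - _)%E).
    by apply: eq_integral => z _; rewrite !funeposE.
  by apply: eq_integral => z _; rewrite !funenegE.
apply: measurableT_comp => //.
have Fp0 q : (0 <= Fp q)%E by exact: funepos_ge0.
have Fn0 q : (0 <= Fn q)%E by exact: funeneg_ge0.
apply: emeasurable_funB.
  exact: (measurable_fun_fubini_tonelli_F Fp mFp Fp0).
exact: (measurable_fun_fubini_tonelli_F Fn mFn Fn0).
Qed.

Lemma measurable_conv (k : Rn -> R) w :
  measurable_fun setT k -> measurable_fun setT w ->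
  measurable_fun setT (fun y => convolution k w y).
Proof.
move=> mk mw.
have mk2 : measurable_fun setT (fun p : measurableTypeR R * Rn => k p.2).
  exact: (measurableT_comp mk measurable_snd).
by have := measurable_section (0 : R) (@measurable_conv2 (fun=> k) w mk2 mw).
Qed.

(** One constant large enough for the heat kernel and all its derivatives at scales
    [r >= lo]. *)
Definition kernel_cst (lo : R) : R :=
  1 + 2 / lo ^+ 2 + (4 / lo ^+ 4 + 2 / lo ^+ 2) + (2 / lo ^+ 3 + n%:R / lo).

Lemma kernel_cst_ge0 lo : 0 < lo -> 0 <= kernel_cst lo.
Proof. by move=> lo0; rewrite !addr_ge0// divr_ge0// ?exprn_ge0// ltW. Qed.

Lemma gauss_kernelW P P' r (k : Rn -> R) : 0 < r -> P <= P' ->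
  gauss_kernel P r k -> gauss_kernel P' r k.
Proof.
move=> r0 PP' [mk kP]; split => // x; apply: (le_trans (kP x)).
by rewrite ler_wpM2r// mulr_ge0 ?gk_ge0// addr_ge0// nsq_ge0.
Qed.

Lemma measurable_coord (i : 'I_n) : measurable_fun setT (fun x : Rn => x 0 i).
Proof. exact: measurable_fun_coord_rV. Qed.

Lemma gauss_kernelM (q : Rn -> R) P r : 0 < r -> measurable_fun setT q ->
  (forall x, `|q x| <= P * (1 + nsq x)) ->
  gauss_kernel P r (fun x => q x * gk r x).
Proof.
move=> r0 mq qP; split; first by apply: measurable_funM => //; exact: measurable_gk.
move=> x; rewrite normrM (gtr0_norm (gk_gt0 x r0)) mulrA.
by rewrite ler_wpM2r// gk_ge0.
Qed.

Lemma kernel_gk lo r : 0 < lo -> lo <= r ->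
  gauss_kernel (kernel_cst lo) r (@gk R n r).
Proof.
move=> lo0 lor; have r0 : 0 < r by lra.
have -> : @gk R n r = (fun x => 1 * gk r x) by apply/funext => x; rewrite mul1r.
apply: (@gauss_kernelW 1) => //.
  by rewrite /kernel_cst -!addrA lerDl !addr_ge0// divr_ge0// ?exprn_ge0// ltW.
apply: gauss_kernelM => // x; rewrite normr1 mul1r.
by have := nsq_ge0 x; lra.
Qed.

Lemma invX_le lo r k : 0 < lo -> lo <= r -> r ^- k <= lo ^- k :> R.
Proof.
by move=> lo0 lor; rewrite lef_pV2 ?posrE ?exprn_gt0 ?lerXn2r ?nnegrE//; lra.
Qed.

Lemma kernel_gk1 lo r i : 0 < lo -> lo <= r ->
  gauss_kernel (kernel_cst lo) r (@gk1 R n i r).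
Proof.
move=> lo0 lor; have r0 : 0 < r by lra.
apply: (@gauss_kernelW (2 / lo ^+ 2)) => //.
  rewrite /kernel_cst.
  have : 0 <= 4 / lo ^+ 4 by rewrite divr_ge0// exprn_ge0// ltW.
  have : 0 <= 2 / lo ^+ 2 by rewrite divr_ge0// exprn_ge0// ltW.
  have : 0 <= 2 / lo ^+ 3 by rewrite divr_ge0// exprn_ge0// ltW.
  have : 0 <= n%:R / lo by rewrite divr_ge0// ltW.
  by lra.
apply: gauss_kernelM => //.
  by apply: measurableT_comp => //; apply: measurable_funM => //;
    apply: measurable_funM => //; exact: measurable_coord.
move=> x; rewrite normrN !normrM mulrAC ger0_norm//.
apply: ler_pM => //.
  rewrite ger0_norm ?ler_wpM2l ?invX_le// invr_ge0 exprn_ge0//; lra.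
have := coord_le_nsq x i; have := sqr_ge0 (`|x 0 i| - 1).
by rewrite -[x 0 i ^+ 2]real_normK ?num_real//; nra.
Qed.

Lemma kernel_gk2 lo r i : 0 < lo -> lo <= r ->
  gauss_kernel (kernel_cst lo) r (@gk2 R n i r).
Proof.
move=> lo0 lor; have r0 : 0 < r by lra.
have a4 : 0 <= 4 / lo ^+ 4 by rewrite divr_ge0// exprn_ge0// ltW.
have a2 : 0 <= 2 / lo ^+ 2 by rewrite divr_ge0// exprn_ge0// ltW.
apply: (@gauss_kernelW (4 / lo ^+ 4 + 2 / lo ^+ 2)) => //.
  rewrite /kernel_cst.
  have : 0 <= 2 / lo ^+ 3 by rewrite divr_ge0// exprn_ge0// ltW.
  have : 0 <= n%:R / lo by rewrite divr_ge0// ltW.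
  by lra.
apply: gauss_kernelM => //.
  apply: measurable_funB => //; apply: measurable_funM => //.
  by apply: measurable_funM => //; apply: measurable_funX; exact: measurable_coord.
move=> x; apply: (le_trans (ler_normB _ _)).
have h4 : r ^- 4 <= lo ^- 4 by exact: invX_le.
have h2 : r ^- 2 <= lo ^- 2 by exact: invX_le.
have r4 : 0 <= r ^- 4 by rewrite invr_ge0 exprn_ge0// ltW.
have r2 : 0 <= r ^- 2 by rewrite invr_ge0 exprn_ge0// ltW.
have N0 := nsq_ge0 x; have xN := coord_le_nsq x i; have x0 := sqr_ge0 (x 0 i).
rewrite [X in X + _]ger0_norm ?[X in _ + X]ger0_norm; last 2 first.
- by rewrite mulr_ge0.
- by rewrite mulr_ge0// mulr_ge0.
rewrite [leRHS]mulrDl; apply: lerD.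
  rewrite mulrAC; apply: ler_pM => //; first by rewrite mulr_ge0.
    by rewrite ler_wpM2l.
  by lra.
rewrite -[leLHS]mulr1; apply: ler_pM => //; first by rewrite mulr_ge0.
  by rewrite ler_wpM2l.
by lra.
Qed.

Lemma kernel_gkr lo r : 0 < lo -> lo <= r ->
  gauss_kernel (kernel_cst lo) r (@gkr R n r).
Proof.
move=> lo0 lor; have r0 : 0 < r by lra.
have a3 : 0 <= 2 / lo ^+ 3 by rewrite divr_ge0// exprn_ge0// ltW.
have a1 : 0 <= n%:R / lo by rewrite divr_ge0// ltW.
apply: (@gauss_kernelW (2 / lo ^+ 3 + n%:R / lo)) => //.
  rewrite /kernel_cst.
  have : 0 <= 4 / lo ^+ 4 by rewrite divr_ge0// exprn_ge0// ltW.
  have : 0 <= 2 / lo ^+ 2 by rewrite divr_ge0// exprn_ge0// ltW.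
  by lra.
apply: gauss_kernelM => //.
  apply: measurable_funB => //; apply: measurable_funM => //.
  by apply: measurable_funM => //; exact: measurable_nsq.
move=> x; apply: (le_trans (ler_normB _ _)).
have h3 : r ^- 3 <= lo ^- 3 by exact: invX_le.
have h1 : r^-1 <= lo^-1 by rewrite lef_pV2 ?posrE.
have r3 : 0 <= r ^- 3 by rewrite invr_ge0 exprn_ge0// ltW.
have r1 : 0 <= r^-1 by rewrite invr_ge0 ltW.
have N0 := nsq_ge0 x.
rewrite [X in X + _]ger0_norm ?[X in _ + X]ger0_norm; last 2 first.
- by rewrite mulr_ge0.
- by rewrite mulr_ge0// mulr_ge0.
rewrite [leRHS]mulrDl; apply: lerD.
  rewrite mulrAC; apply: ler_pM => //; first by rewrite mulr_ge0.
    by rewrite ler_wpM2l.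
  by lra.
rewrite -[leLHS]mulr1; apply: ler_pM => //; first by rewrite mulr_ge0.
  by rewrite ler_wpM2l.
by lra.
Qed.

Lemma measurable_gk1_2 i :
  measurable_fun setT (fun p : measurableTypeR R * Rn => gk1 i p.1 p.2).
Proof.
apply: measurable_funM; last exact: measurable_gk2.
apply: measurableT_comp => //; apply: measurable_funM.
  apply: measurable_funM => //.
  exact: (measurableT_comp (measurable_coord i) measurable_snd).
apply: (measurableT_comp measurable_inv); apply: measurable_funX.
exact: measurable_fst.
Qed.

End weights.

(** * Doubling weights *)

Section doubling.
Context {R : realType} (n : nat).
Local Notation Rn := 'rV[R]_n.
Local Notation mu := (@lebesgue_rV R n).
Implicit Types w : Rn -> R.

Lemma weight_ball_lty w (x : Rn) (r : R) : is_weight w -> 0 < r ->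
  (\int[mu]_(z in eball x r) (w z)%:E < +oo)%E.
Proof.
move=> [w0 mw wK] r0.
pose K := [set z : Rn | forall i, `[x 0 i - r, x 0 i + r]%classic (z 0 i)].
have cK : compact K.
  have := @rV_compact R n (fun i => `[x 0 i - r, x 0 i + r]%classic).
  by apply => i; exact: segment_compact.
have mK : measurable K.
  rewrite (_ : K = \bigcap_(i in [set: 'I_n])
      ((fun z : Rn => z 0 i) @^-1` `[x 0 i - r, x 0 i + r])).
    apply: fin_bigcap_measurable => // i _.
    by rewrite -[X in measurable X]setTI; apply: measurable_fun_coord_rV.
  by apply/seteqP; split => z zK i; [move=> _; exact: zK|exact: (zK i I)].
apply: (le_lt_trans _ (wK K cK)).
apply: ge0_subset_integral => //.
- exact: measurable_eball.
- by apply/measurable_EFinP; exact: measurable_funTS.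
- by move=> z _; rewrite lee_fin.
move=> z /(eball_sub_cube r0) zc i.
by have := zc i; rewrite /= in_itv/= ltr_distl => /andP[/ltW -> /ltW ->].
Qed.

Lemma weight_ball_ge0 w (A : set Rn) : is_weight w ->
  (0 <= \int[mu]_(z in A) (w z)%:E)%E.
Proof. by move=> [w0 _ _]; apply: integral_ge0 => z _; rewrite lee_fin. Qed.

Lemma weight_ball_fin w (x : Rn) (r : R) : is_weight w -> 0 < r ->
  (\int[mu]_(z in eball x r) (w z)%:E)%E \is a fin_num.
Proof.
by move=> ww r0; rewrite ge0_fin_numE ?weight_ball_ge0//; exact: weight_ball_lty.
Qed.

Lemma doubling_iter w D (x : Rn) (r : R) k : is_weight w ->
  doubling_bound (weight_measure w) D -> 0 < r ->
  (\int[mu]_(z in eball x (2 ^+ k * r)) (w z)%:E <=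
   ((1 + `|D|) ^+ k)%:E * \int[mu]_(z in eball x r) (w z)%:E)%E.
Proof.
move=> ww dw r0; elim: k => [|k IH]; first by rewrite !expr0 mul1r mul1e.
have r2 : 0 < 2 ^+ k * r by rewrite mulr_gt0// exprn_gt0.
rewrite exprS -mulrA; apply: (le_trans (dw x _ r2)).
apply: (@le_trans _ _ ((1 + `|D|)%:E * weight_measure w (eball x (2 ^+ k * r)))%E).
  apply: lee_wpmul2r; first exact: weight_ball_ge0.
  by rewrite lee_fin; have := ler_norm D; lra.
by rewrite exprS EFinM -muleA; apply: lee_wpmul2l.
Qed.

(** Under doubling the mass of the ball of radius [2^k r] grows at most geometrically
    in [k], so this is [annuli_bound] at scale [r]. *)
Lemma doubling_tail (D kappa : R) : 0 < kappa -> exists2 K : R, 0 < K &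
  forall w, is_weight w -> doubling_bound (weight_measure w) D ->
  forall (y : Rn) r, 0 < r ->
  (\int[mu]_z (expR (- (kappa * (nsq (z - y) / r ^+ 2))) * w z)%:E <=
   K%:E * \int[mu]_(z in eball y r) (w z)%:E)%E.
Proof.
move=> k0; have A1 : 1 <= 1 + `|D| by rewrite lerDl.
have [K K0 HK] := annuli_bound A1 k0.
exists K => // w ww dw y r r0; have [w0 mw _] := ww.
have Wf := weight_ball_fin y ww r0.
rewrite -(fineK Wf) -EFinM; under eq_integral do rewrite EFinM.
have r20 : 0 < r ^+ 2 by rewrite exprn_gt0.
apply: (HK _ _ mu (EFin \o w) (fun z => nsq (z - y) / r ^+ 2)).
- exact/measurable_EFinP.
- by move=> z; rewrite /= lee_fin.
- by apply: measurable_funM => //; exact: measurable_nsqB.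
- by move=> z; rewrite divr_ge0 ?nsq_ge0 ?(ltW r20).
- by rewrite fine_ge0// weight_ball_ge0.
move=> k; have r2 : 0 < 2 ^+ k * r by rewrite mulr_gt0// exprn_gt0.
rewrite (_ : [set _ | _] = eball y (2 ^+ k * r)); last first.
  rewrite eballE//; apply/seteqP; split => z /=; rewrite ltr_pdivrMr// exprMn;
  by rewrite -exprM muln2 -mul2n exprM (_ : 2 ^+ 2 = 4)//; ring.
apply: (le_trans (doubling_iter y k ww dw r0)).
by rewrite mulrC EFinM fineK.
Qed.

(** If one ball had mass zero then so would all its dyadic dilates, hence the space. *)
Lemma doubling_gt0 w D (y : Rn) r : is_weight w ->
  doubling_bound (weight_measure w) D -> weight_measure w setT != 0%E -> 0 < r ->
  (0 < \int[mu]_(z in eball y r) (w z)%:E)%E.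
Proof.
move=> ww dw wT r0; rewrite lt_neqAle weight_ball_ge0// andbT eq_sym.
apply: contra_neqN wT => /eqP W0; have [w0 mw _] := ww.
pose F k := eball y (2 ^+ k * r).
have r2 k : 0 < 2 ^+ k * r by rewrite mulr_gt0// exprn_gt0.
have FT : \bigcup_k F k = setT.
  apply/seteqP; split => // z _.
  exists (Num.bound (enorm (z - y) / r)) => //; rewrite /F /eball/=.
  rewrite -ltr_pdivrMr//; apply: (lt_trans (archi_boundP _)).
    by rewrite divr_ge0 ?sqrtr_ge0// ltW.
  by rewrite -natrX ltr_nat ltn_expl.
have Fnd : {homo F : a b / (a <= b)%N >-> (a <= b)%O}.
  move=> a b ab; apply/subsetPset => z; rewrite /F /eball/= => h.
  apply: (lt_le_trans h); rewrite ler_wpM2r ?(ltW r0)//.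
  by rewrite ler_weXn2l// ler1n.
have := @ge0_nondecreasing_set_cvg_integral _ _ R F (EFin \o w) mu Fnd.
rewrite FT => C; apply/esym.
have {}C := C (fun k => measurable_eball y (r2 k)).
have {}C := C (fun k => measurable_funTS ((measurable_EFinP _ _).2 mw)).
have C' := C (fun _ x _ => w0 x : (0 <= (EFin \o w) x)%E).
have Z k : (\int[mu]_(x in F k) (EFin \o w) x = 0)%E.
  apply/eqP; rewrite eq_le weight_ball_ge0// andbT.
  by apply: (le_trans (doubling_iter y k ww dw r0)); rewrite W0 mule0.
rewrite (_ : (fun i => _) = cst 0%E) in C'; last by apply/funext => k; exact: Z.
by apply: (cvg_unique _ (cvg_cst 0%E) C').
Qed.

Lemma doubling_gauss_integrable w D : is_weight w ->
  doubling_bound (weight_measure w) D -> gauss_integrable w.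
Proof.
move=> ww dw kappa k0; have [w0 mw _] := ww.
have [K K0 HK] := @doubling_tail D _ k0.
apply/integrableP; split.
  apply/measurable_EFinP; apply: measurable_funM => //.
  apply: measurableT_comp => //; apply: measurableT_comp => //.
  by apply: measurable_funM => //; exact: measurable_nsq.
under eq_integral do rewrite gee0_abs ?lee_fin ?mulr_ge0 ?expR_ge0//.
rewrite [X in (X < _)%E](_ : _ = \int[mu]_z
    (expR (- (kappa * (nsq (z - 0) / 1 ^+ 2))) * w z)%:E)%E; last first.
  by apply: eq_integral => z _; rewrite subr0 expr1n divr1.
apply: (le_lt_trans (HK w ww dw 0 1 ltr01)).
by rewrite lte_mul_pinfty ?lee_fin ?(ltW K0) ?weight_ball_lty.
Qed.

End doubling.

(** * The heat extension of a doubling weight *)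

Lemma affine_norm_bound (R : realDomainType) (a b k l N L : R) :
  0 <= N -> 0 <= k -> 0 <= l -> L <= a + k * N -> b - 2 * l * N <= L ->
  `|L| <= (`|a| + `|b| + k + 2 * l + 1) * (1 + N).
Proof.
move=> N0 k0 l0 aL bL.
have a1 := ler_norm a; have b1 := ler_norm (- b); rewrite normrN in b1.
have a0 := normr_ge0 a; have b0 := normr_ge0 b.
have d1 := mulr_ge0 a0 N0; have d2 := mulr_ge0 b0 N0.
have d3 := mulr_ge0 k0 N0; have d4 := mulr_ge0 l0 N0.
by rewrite ler_norml; apply/andP; split; lra.
Qed.

Section heat_extension.
Context {R : realType} (n : nat) (D : R) (w : 'rV[R]_n -> R).
Hypothesis ww : is_weight w.
Hypothesis dw : doubling_bound (weight_measure w) D.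
Hypothesis wT : weight_measure w setT != 0%E.
Local Notation Rn := 'rV[R]_n.
Local Notation mu := (@lebesgue_rV R n).

Let w0 : forall x, 0 <= w x. Proof. by have [] := ww. Qed.
Let mw : measurable_fun setT w. Proof. by have [] := ww. Qed.
Let gw : gauss_integrable w. Proof. exact: doubling_gauss_integrable dw. Qed.

(** The heat extension of the weight; [u1], [u2] and [ur] are its derivatives, in
    space (direction [i]) and in the scale. *)
Definition u r y := convolution (@gk R n r) w y.
Definition u1 i r y := convolution (@gk1 R n i r) w y.
Definition u2 i r y := convolution (@gk2 R n i r) w y.
Definition ur r y := convolution (@gkr R n r) w y.

Lemma EFin_conv P r k y : 0 < r -> 0 <= P -> gauss_kernel P r k ->
  (convolution k w y)%:E = (\int[mu]_z (k (y - z) * w z)%:E)%E.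
Proof.
move=> r0 P0 kk; rewrite /convolution /Rintegral fineK//.
by apply: integrable_fin_num => //; exact: (integrable_conv _ r0 P0 kk).
Qed.

Lemma EFin_u r y : 0 < r ->
  (u r y)%:E = (\int[mu]_z (gk r (y - z) * w z)%:E)%E.
Proof.
by move=> r0; apply: (EFin_conv _ r0 (kernel_cst_ge0 n r0)); exact: kernel_gk.
Qed.

Let c r : R := pi `^ (- (n%:R / 2)) * r ^- n.

Let c_gt0 r : 0 < r -> 0 < c r.
Proof. by move=> r0; rewrite mulr_gt0 ?powR_gt0 ?pi_gt0// invr_gt0 exprn_gt0. Qed.

Lemma u_ge_ball r y : 0 < r ->
  ((c r * expR (- 1))%:E * \int[mu]_(z in eball y r) (w z)%:E <= (u r y)%:E)%E.
Proof.
move=> r0; rewrite EFin_u// -ge0_integralZl; last 4 first.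
- exact: measurable_eball.
- by apply/measurable_EFinP; exact: measurable_funTS.
- by move=> z _; rewrite lee_fin.
- by rewrite lee_fin mulr_ge0 ?expR_ge0// ltW// c_gt0.
have mg : measurable_fun setT (fun z : Rn => gk r (y - z) * w z).
  by apply: measurable_funM => //; apply: measurable_subl; exact: measurable_gk.
have mB := @measurable_eball R n y r r0.
apply: (@le_trans _ _ (\int[mu]_(z in eball y r) (gk r (y - z) * w z)%:E)%E).
  apply: ge0_le_integral => //.
  - by move=> z _; rewrite -EFinM lee_fin mulr_ge0// mulr_ge0 ?expR_ge0// ltW// c_gt0.
  - by apply: measurable_funeM; apply/measurable_EFinP; exact: measurable_funTS.
  - by apply/measurable_EFinP; exact: measurable_funTS.
  move=> z; rewrite eballE//= => zr; rewrite -EFinM lee_fin ler_wpM2r//.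
  rewrite gkE -/(c r) ler_wpM2l ?(ltW (c_gt0 r0))// ler_expR mulNr lerN2.
  by rewrite ler_pdivrMr ?exprn_gt0// mul1r nsqBC ltW.
apply: ge0_subset_integral => //; first exact/measurable_EFinP.
by move=> z _; rewrite lee_fin mulr_ge0// gk_ge0.
Qed.

Lemma u_gt0 r y : 0 < r -> 0 < u r y.
Proof.
move=> r0; rewrite -lte_fin; apply: (lt_le_trans _ (u_ge_ball y r0)).
rewrite mule_gt0 ?(doubling_gt0 y ww dw wT r0)// lte_fin mulr_gt0 ?expR_gt0//.
exact: c_gt0.
Qed.

(** Both sides compare with the mass of the ball of radius [r] around [y]: the left
    by [doubling_tail], the right because the heat kernel is bounded below on that
    ball. *)
Lemma conv_ratio hi : 0 < hi -> exists2 C, 0 < C & forall P r k y,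
  0 < r -> r <= hi -> 0 <= P -> gauss_kernel P r k ->
  `|convolution k w y| <= P * C * u r y.
Proof.
move=> hi0; have [K K0 HK] := @doubling_tail R n D 2^-1 ltac:(by rewrite invr_gt0).
have hi2 : 0 <= hi ^+ 2 by rewrite exprn_ge0// ltW.
have C0 : 0 < 1 + 4 * hi ^+ 2 by lra.
exists ((1 + 4 * hi ^+ 2) * K * expR 1); first by rewrite !mulr_gt0 ?expR_gt0.
move=> P r k y r0 rhi P0 kk; have [mk kP] := kk.
have r20 : 0 < r ^+ 2 by rewrite exprn_gt0.
have cr0 := c_gt0 r0.
pose E (z : Rn) := expR (- (2^-1 * (nsq (z - y) / r ^+ 2))) * w z.
have E0 z : 0 <= E z by rewrite mulr_ge0 ?expR_ge0.
have mE : measurable_fun setT E.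
  apply: measurable_funM => //; apply: measurableT_comp => //.
  apply: measurableT_comp => //; apply: measurable_funM => //.
  by apply: measurable_funM => //; exact: measurable_nsqB.
have mkw : measurable_fun setT (fun z : Rn => k (y - z) * w z).
  by apply: measurable_funM => //; exact: measurable_subl.
pose Q := P * (c r * (1 + 4 * hi ^+ 2)).
have Q0 : 0 <= Q by rewrite mulr_ge0// mulr_ge0 ?(ltW C0)// ltW.
have step1 : (`|convolution k w y|%:E <= Q%:E * \int[mu]_z (E z)%:E)%E.
  rewrite EFin_normr_Rintegral//; last exact: (integrable_conv _ r0 P0 kk).
  apply: (le_trans (le_abse_integral _ _ _)) => //; first exact/measurable_EFinP.
  have mE' : measurable_fun setT (fun z => (E z)%:E) by exact/measurable_EFinP.
  have -> : (Q%:E * \int[mu]_z (E z)%:E = \int[mu]_z (Q%:E * (E z)%:E))%E.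
    by rewrite ge0_integralZl// => z _; rewrite lee_fin.
  apply: ge0_le_integral => //.
  - by apply: measurableT_comp => //; exact/measurable_EFinP.
  - by apply: measurable_funeM; exact/measurable_EFinP.
  move=> z _; rewrite -EFinM lee_fin normrM (ger0_norm (w0 z)) mulrA.
  rewrite ler_wpM2r//; apply: (le_trans (kP _)).
  rewrite -mulrA (ler_wpM2l P0)// gkE -/(c r) mulrCA -[leRHS]mulrA.
  rewrite (ler_wpM2l (ltW cr0))//.
  have s0 := nsq_ge0 (y - z).
  have k0 : 0 < r ^- 2 by rewrite invr_gt0.
  have h := expR_absorb s0 k0.
  rewrite (_ : - nsq (y - z) / r ^+ 2 = - (r ^- 2 * nsq (y - z))); last first.
    by rewrite mulNr mulrC.
  apply: (le_trans h); rewrite (nsqBC z y) invrK.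
  rewrite (_ : 2^-1 * (nsq (y - z) / r ^+ 2) = r ^- 2 / 2 * nsq (y - z)); last ring.
  rewrite ler_wpM2r ?expR_ge0// lerD2l.
  have : r ^+ 2 <= hi ^+ 2 by rewrite lerXn2r ?nnegrE ?(ltW r0) ?(ltW hi0).
  by lra.
have Wf := weight_ball_fin y ww r0.
pose W := fine (\int[mu]_(z in eball y r) (w z)%:E)%E.
have cW : c r * expR (- 1) * W <= u r y.
  by have := u_ge_ball y r0; rewrite -(fineK Wf) -EFinM lee_fin.
have step2 : (`|convolution k w y|%:E <= (Q * (K * W))%:E)%E.
  apply: (le_trans step1); rewrite [leRHS]EFinM; apply: lee_wpmul2l => //.
  by rewrite EFinM (fineK Wf); exact: HK.
rewrite lee_fin in step2; apply: (le_trans step2).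
have e1 : expR 1 * expR (- 1) = 1 :> R by rewrite -expRD subrr expR0.
have ceu : c r * W <= expR 1 * u r y.
  have h : expR 1 * (expR (- 1) * (c r * W)) <= expR 1 * u r y.
    by rewrite (ler_wpM2l (expR_ge0 _))// mulrA [expR _ * c r]mulrC.
  by move: h; rewrite mulrA e1 mul1r.
rewrite (_ : Q * _ = P * ((1 + 4 * hi ^+ 2) * K) * (c r * W)); last by rewrite /Q; ring.
rewrite [leRHS](_ : _ = P * ((1 + 4 * hi ^+ 2) * K) * (expR 1 * u r y)); last by ring.
by apply: ler_wpM2l => //; rewrite mulr_ge0// mulr_ge0// ltW.
Qed.

Lemma u_le (C : R) r s y y' : 0 < r -> 0 < s ->
  (forall z, gk r (y - z) <= C * gk s (y' - z)) -> u r y <= C * u s y'.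
Proof.
move=> r0 s0 H.
have ir := integrable_conv y r0 (kernel_cst_ge0 n r0) (kernel_gk n r0 (lexx r)) mw gw.
have js := integrable_conv y' s0 (kernel_cst_ge0 n s0) (kernel_gk n s0 (lexx s)) mw gw.
have jC : mu.-integrable setT (EFin \o (fun z => C * (gk s (y' - z) * w z))).
  exact: (integrableZl measurableT C js).
rewrite /u /convolution -(RintegralZl C measurableT js).
apply: (le_Rintegral measurableT ir jC) => z _.
by rewrite mulrA ler_wpM2r.
Qed.

(** Moving from [y] to the origin changes the exponent of a Gaussian by a multiple of
    [|y|^2] once its scale is enlarged (above) or reduced (below); this bounds [u r y]
    on both sides by [exp (O(|y|^2))]. *)
Lemma ln_u_growth lo hi : 0 < lo -> lo <= hi -> exists2 C, 0 < C &
  forall r y, lo <= r -> r <= hi -> `|ln (u r y)| <= C * (1 + nsq y).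
Proof.
move=> lo0 lohi; have hi0 : 0 < hi by lra.
pose s := lo / 2; have s0 : 0 < s by rewrite divr_gt0.
pose t := 2 * hi; have t0 : 0 < t by rewrite mulr_gt0.
pose p : R := pi `^ (- (n%:R / 2)).
have p0 : 0 < p by rewrite powR_gt0 ?pi_gt0.
pose k0 := hi ^- 2; have k00 : 0 < k0 by rewrite invr_gt0 exprn_gt0.
pose k1 := lo ^- 2; have k10 : 0 < k1 by rewrite invr_gt0 exprn_gt0.
pose A := lo ^- n * t ^+ n; have A0 : 0 < A by rewrite mulr_gt0 ?invr_gt0 ?exprn_gt0.
pose B := hi ^- n * s ^+ n; have B0 : 0 < B by rewrite mulr_gt0 ?invr_gt0 ?exprn_gt0.
have up r y : lo <= r -> r <= hi -> u r y <= A * expR (k0 * nsq y) * u t 0.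
  move=> lor rhi; apply: u_le => //; first exact: lt_le_trans lo0 lor.
  move=> z; apply: (le_trans (gk_le (y - z) lo0 lor rhi)).
  rewrite (gkE t) sub0r nsqN -/p -/k0.
  rewrite (_ : A * _ * _ = p * lo ^- n * (expR (k0 * nsq y) * expR (- nsq z / t ^+ 2))); last first.
    by rewrite /A; field; rewrite ?expf_neq0 ?gt_eqF.
  rewrite ler_wpM2l ?mulr_ge0 ?invr_ge0 ?exprn_ge0 ?(ltW lo0) ?(ltW p0)//.
  rewrite -expRD ler_expR.
  have := nsq_shift y z; have := nsq_ge0 z => z0 h.
  have h1 : k0 * (nsq z / 2 - nsq y) <= k0 * nsq (y - z) by rewrite ler_wpM2l// ltW.
  have h2 : 0 <= k0 * nsq z by rewrite mulr_ge0// ltW.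
  by rewrite mulNr (_ : nsq z / t ^+ 2 = k0 * nsq z / 4); [lra|rewrite /k0 /t; field; rewrite gt_eqF].
have lo_ r y : lo <= r -> r <= hi -> B * expR (- (2 * k1 * nsq y)) * u s 0 <= u r y.
  move=> lor rhi; have r0 : 0 < r by exact: lt_le_trans lo0 lor.
  have e0 : 0 < B * expR (- (2 * k1 * nsq y)) by rewrite mulr_gt0 ?expR_gt0.
  rewrite -ler_pdivlMl//; apply: u_le => // z.
  rewrite ler_pdivlMl// (gkE s) (gkE r) sub0r nsqN -/p.
  rewrite (_ : B * _ * _ = p * hi ^- n * (expR (- (2 * k1 * nsq y)) * expR (- nsq z / s ^+ 2))); last first.
    by rewrite /B; field; rewrite ?expf_neq0 ?gt_eqF.
  rewrite -[leLHS]mulrA -[leRHS]mulrA (ler_wpM2l (ltW p0))//; apply: ler_pM.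
  - by rewrite invr_ge0 exprn_ge0// ltW.
  - by rewrite mulr_ge0 ?expR_ge0.
  - exact: invX_le.
  rewrite -expRD ler_expR.
  have := nsqD_le y (- z); have z0 := nsq_ge0 z; rewrite nsqN => h.
  have h1 : r ^- 2 * nsq (y - z) <= k1 * nsq (y - z).
    by rewrite ler_wpM2r ?nsq_ge0// invX_le.
  have h2 : k1 * nsq (y - z) <= k1 * (2 * nsq y + 2 * nsq z) by rewrite ler_wpM2l// ltW.
  have h3 : 0 <= k1 * nsq z by rewrite mulr_ge0// ltW.
  rewrite !mulNr (_ : nsq z / s ^+ 2 = 4 * (k1 * nsq z)); last first.
    by rewrite /k1 /s; field; rewrite gt_eqF.
  by rewrite [_ / r ^+ 2]mulrC; lra.
have ut0 := u_gt0 (0 : Rn) t0; have us0 := u_gt0 (0 : Rn) s0.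
exists (`|ln (A * u t 0)| + `|ln (B * u s 0)| + k0 + 2 * k1 + 1).
  apply: ltr_wpDl => //.
  by rewrite !addr_ge0// ?mulr_ge0 ?(ltW k00) ?(ltW k10).
move=> r y lor rhi; have r0 : 0 < r by exact: lt_le_trans lo0 lor.
have N0 := nsq_ge0 y; have uu := u_gt0 y r0.
have Au0 : 0 < A * u t 0 := mulr_gt0 A0 ut0.
have Bu0 : 0 < B * u s 0 := mulr_gt0 B0 us0.
have a1 : ln (u r y) <= ln (A * u t 0) + k0 * nsq y.
  rewrite -ler_expR expRD (lnK uu) (lnK Au0) mulrAC.
  exact: up.
have a2 : ln (B * u s 0) - 2 * k1 * nsq y <= ln (u r y).
  rewrite -ler_expR expRD (lnK uu) (lnK Bu0) mulrAC.
  exact: lo_.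
exact: (affine_norm_bound N0 (ltW k00) (ltW k10) a1 a2).
Qed.

End heat_extension.

(** * The logarithm of the heat extension *)

Lemma Rintegral_sum (R : realType) d (T : measurableType d)
    (m : {measure set T -> \bar R}) (I : Type) (s : seq I) (F : I -> T -> R) :
  (forall i, m.-integrable setT (EFin \o F i)) ->
  m.-integrable setT (EFin \o (fun z => \sum_(i <- s) F i z)) /\
  \int[m]_z (\sum_(i <- s) F i z) = \sum_(i <- s) \int[m]_z F i z.
Proof.
move=> iF; elim: s => [|a s [IH1 IH2]].
  under eq_fun do rewrite big_nil.
  split; first exact: integrable0.
  by rewrite big_nil /Rintegral integral0.
under eq_fun do rewrite big_cons.
split; first exact: (integrableD measurableT (iF a) IH1).
by rewrite big_cons (RintegralD measurableT (iF a) IH1) IH2.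
Qed.

Section log_heat.
Context {R : realType} (n : nat) (D : R) (w : 'rV[R]_n -> R).
Hypothesis ww : is_weight w.
Hypothesis dw : doubling_bound (weight_measure w) D.
Hypothesis wT : weight_measure w setT != 0%E.
Local Notation Rn := 'rV[R]_n.
Local Notation mu := (@lebesgue_rV R n).
Local Notation u := (u w).

Let w0 : forall x, 0 <= w x. Proof. by have [] := ww. Qed.
Let mw : measurable_fun setT w. Proof. by have [] := ww. Qed.
Let gw : gauss_integrable w. Proof. exact: doubling_gauss_integrable dw. Qed.
Let u_gt0 r y : 0 < r -> 0 < u r y. Proof. exact: u_gt0 dw wT r y. Qed.

(** [v1], [v2] and [vr] are the derivatives of [v], as [u1], [u2] and [ur] are those of
    [u]. *)
Definition v r y : R := ln (u r y).
Definition v1 i r y : R := u1 w i r y / u r y.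
Definition v2 i r y : R := u2 w i r y / u r y - v1 i r y ^+ 2.
Definition vr r y : R := ur w r y / u r y.

(** The heat equation for [u] becomes
    [d_r v = (r/2) (Lap v + |grad v|^2)] for the logarithm. *)
Lemma vrE r y : 0 < r -> vr r y = r / 2 * \sum_i (v2 i r y + v1 i r y ^+ 2).
Proof.
move=> r0; rewrite /vr /ur.
have -> : convolution (@gkr R n r) w y = r / 2 * \sum_i u2 w i r y.
  have ik i : mu.-integrable setT (EFin \o (fun z => gk2 i r (y - z) * w z)).
    apply: (integrable_conv _ r0 (kernel_cst_ge0 n r0)) => //.
    exact: kernel_gk2.
  rewrite /convolution.
  transitivity (\int[mu]_z (r / 2 * \sum_i (gk2 i r (y - z) * w z))).
    apply: eq_Rintegral => z _; rewrite gkrE ?gt_eqF// -mulrA; congr (_ * _).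
    by rewrite mulr_suml.
  have [isum sumE] := Rintegral_sum (index_enum 'I_n) ik.
  by rewrite (RintegralZl _ measurableT isum) sumE.
rewrite -[LHS]mulrA; congr (_ * _); rewrite mulr_suml; apply: eq_bigr => i _.
by rewrite /v2 subrK.
Qed.

Let kc_ge0 (r : R) : 0 < r -> 0 <= kernel_cst n r.
Proof. exact: kernel_cst_ge0. Qed.

Lemma is_derive_v i r y : 0 < r ->
  is_derive (0 : R) (1 : R) (fun t : R => v r (y + t *: unit_rV i)) (v1 i r y).
Proof.
move=> r0.
have Du : is_derive (0 : R) (1 : R) (fun t : R => u r (y + t *: unit_rV i)) (u1 w i r y).
  apply: (is_derive_conv_line _ r0 (kc_ge0 r0)) => //.
  - exact: kernel_gk.
  - exact: kernel_gk1.
  - by move=> x h; exact: is_derive_gk.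
have u0 : 0 < u r (y + 0 *: unit_rV i) by exact: u_gt0.
have Dl := is_derive1_ln u0.
have := is_derive1_comp Dl Du.
by rewrite scale0r addr0 mulrC.
Qed.

Lemma is_derive_v1 i r y : 0 < r ->
  is_derive (0 : R) (1 : R) (fun t : R => v1 i r (y + t *: unit_rV i)) (v2 i r y).
Proof.
move=> r0.
have Du : is_derive (0 : R) (1 : R) (fun t : R => u r (y + t *: unit_rV i)) (u1 w i r y).
  apply: (is_derive_conv_line _ r0 (kc_ge0 r0)) => //.
  - exact: kernel_gk.
  - exact: kernel_gk1.
  - by move=> x h; exact: is_derive_gk.
have Du1 : is_derive (0 : R) (1 : R) (fun t : R => u1 w i r (y + t *: unit_rV i)) (u2 w i r y).
  apply: (is_derive_conv_line _ r0 (kc_ge0 r0)) => //.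
  - exact: kernel_gk1.
  - exact: kernel_gk2.
  - by move=> x h; exact: is_derive_gk1.
have u0 : u r (y + 0 *: unit_rV i) != 0 by rewrite gt_eqF// u_gt0.
have DV := @is_deriveV R (fun t : R => u r (y + t *: unit_rV i)) 0 _ 1 u0 Du.
have DM := is_deriveM Du1 DV.
apply: (is_derive_eq DM); rewrite scale0r addr0 in u0 *.
rewrite /GRing.scale/= /v2 /v1; move: u0; move: (u r y) (u1 w i r y) (u2 w i r y) => a b c a0.
by field.
Qed.

Lemma is_derive_v_time r y : 0 < r ->
  is_derive (r : R) (1 : R) (fun t => v t y) (vr r y).
Proof.
move=> r0; have r20 : 0 < r / 2 by rewrite divr_gt0.
have Du : is_derive (r : R) (1 : R) (fun t => u t y) (ur w r y).
  apply: (@is_derive_conv_time R n (kernel_cst n (r / 2)) (r / 2) (2 * r)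
    (fun t => @gk R n t) (fun t => @gkr R n t)) => //; try lra.
  - exact: kc_ge0.
  - by move=> t t1 t2; apply: kernel_gk => //; exact: ltW.
  - by move=> t t1 t2; apply: kernel_gkr => //; exact: ltW.
  - by move=> x t t1 t2; apply: is_derive_gkr; exact: lt_trans t1.
have := is_derive1_comp (is_derive1_ln (u_gt0 y r0)) Du.
by rewrite mulrC.
Qed.

Lemma continuous_v1_time i r y : 0 < r ->
  {for r, continuous (fun t => v1 i t y)}.
Proof.
move=> r0; have r20 : 0 < r / 2 by rewrite divr_gt0.
have r2 : r / 2 < r by lra.
have r3 : r < 2 * r by lra.
have cu : {for r, continuous (fun t => u t y)}.
  apply: (@continuous_conv_time R n (kernel_cst n (r / 2)) (r / 2) (2 * r)
    (fun t => @gk R n t)) => //.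
  - exact: kc_ge0.
  - by move=> t t1 t2; apply: kernel_gk => //; exact: ltW.
  - move=> x t t1 t2; apply: differentiable_continuous.
    apply/derivable1_diffP.
    by have [] := is_derive_gkr x (lt_trans r20 t1).
have cu1 : {for r, continuous (fun t => u1 w i t y)}.
  apply: (@continuous_conv_time R n (kernel_cst n (r / 2)) (r / 2) (2 * r)
    (fun t => @gk1 R n i t)) => //.
  - exact: kc_ge0.
  - by move=> t t1 t2; apply: kernel_gk1 => //; exact: ltW.
  - move=> x t t1 t2; have t0 := lt_trans r20 t1.
    have ck : {for t, continuous (fun t => gk t x)}.
      apply: differentiable_continuous; apply/derivable1_diffP.
      by have [] := is_derive_gkr x t0.
    apply: cvgM; last exact: ck.
    apply: cvgN; apply: cvgM; first exact: cvg_cst.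
    apply: cvgV; first by rewrite expf_neq0// gt_eqF.
    exact: exprn_continuous.
by apply: cvgM => //; apply: cvgV => //; rewrite gt_eqF// u_gt0.
Qed.

Lemma measurable_u r : measurable_fun setT (u r).
Proof. by apply: measurable_conv => //; exact: measurable_gk. Qed.

Lemma measurable_v r : measurable_fun setT (v r).
Proof. by apply: measurableT_comp => //; exact: measurable_u. Qed.

Lemma measurable_v1_2 i :
  measurable_fun setT (fun p : measurableTypeR R * Rn => v1 i p.1 p.2).
Proof.
apply: measurable_funM; first exact: (measurable_conv2 (measurable_gk1_2 i)).
apply: (measurableT_comp measurable_inv).
exact: (measurable_conv2 (@measurable_gk2 R n)).
Qed.

Lemma measurable_v1 i r : measurable_fun setT (v1 i r).
Proof. by have := measurable_section r (measurable_v1_2 i). Qed.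

Lemma measurable_v2 i r : 0 < r -> measurable_fun setT (v2 i r).
Proof.
move=> r0; apply: measurable_funB; last by apply: measurable_funX; exact: measurable_v1.
apply: measurable_funM; last by apply: (measurableT_comp measurable_inv); exact: measurable_u.
by apply: measurable_conv => //; have [] := kernel_gk2 i r0 (lexx r).
Qed.

(** The derivatives of [v] are ratios of the form controlled by [conv_ratio]. *)
Lemma v_derivatives_bound lo hi : 0 < lo -> lo <= hi -> exists2 C, 0 < C &
  forall r y, lo <= r -> r <= hi ->
    [/\ forall i, `|v1 i r y| <= C, forall i, `|v2 i r y| <= C & `|vr r y| <= C].
Proof.
move=> lo0 lohi; have hi0 := lt_le_trans lo0 lohi.
have [C C0 HC] := conv_ratio ww dw hi0.
pose P := kernel_cst n lo; have P0 : 0 <= P := kc_ge0 lo0.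
have Q0 : 0 <= P * C by rewrite mulr_ge0// ltW.
exists (P * C + (P * C) ^+ 2 + 1).
  by apply: ltr_wpDl => //; rewrite addr_ge0// exprn_ge0.
move=> r y lor rhi; have r0 := lt_le_trans lo0 lor; have uy := u_gt0 y r0.
have key k : gauss_kernel P r k -> `|convolution k w y / u r y| <= P * C.
  move=> kk; rewrite normrM normfV (gtr0_norm uy) ler_pdivrMr//.
  exact: HC.
have b1 i : `|v1 i r y| <= P * C by apply: key; exact: kernel_gk1.
have Q20 : 0 <= (P * C) ^+ 2 by rewrite exprn_ge0.
split.
- by move=> i; have := b1 i; move: (P * C) Q20 Q0 `|_| => *; lra.
- move=> i; apply: (le_trans (ler_normB _ _)).
  have c1 : `|u2 w i r y / u r y| <= P * C by apply: key; exact: kernel_gk2.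
  have c2 : `|v1 i r y ^+ 2| <= (P * C) ^+ 2.
    by rewrite normrX lerXn2r ?nnegrE.
  by move: (P * C) Q20 Q0 `|_| `|_ ^+ 2| c1 c2 => *; lra.
- have c1 : `|vr r y| <= P * C by apply: key; exact: kernel_gkr.
  by move: (P * C) Q20 Q0 `|_| c1 => *; lra.
Qed.

End log_heat.

(** * Integration by parts on the whole space *)

Section parts.
Context {R : realType} (n : nat).
Local Notation Rn := 'rV[R]_n.
Local Notation mu := (@lebesgue_rV R n).

Lemma integrable_expR_nsq (C kappa : R) : 0 < kappa ->
  mu.-integrable setT (EFin \o (fun y : Rn => C * expR (- (kappa * nsq y)))).
Proof.
move=> k0; pose r := (Num.sqrt kappa)^-1.
have r0 : 0 < r by rewrite invr_gt0 sqrtr_gt0.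
have r2 : r ^+ 2 = kappa^-1 by rewrite /r exprVn sqr_sqrtr// ltW.
pose p : R := pi `^ (- (n%:R / 2)) * r ^- n.
have p0 : p != 0 by rewrite mulf_neq0 ?gt_eqF ?powR_gt0 ?pi_gt0 ?invr_gt0 ?exprn_gt0.
have /(integrableZl measurableT (C / p)) := integrable_gk (0 : Rn) r0.
apply: eq_integrable => // y _ /=; rewrite -EFinM; congr EFin.
rewrite gkE sub0r nsqN -/p r2 invrK mulrA divfK//.
by rewrite mulNr [_ * kappa]mulrC.
Qed.

(** The majorants for functions of quadratic growth, such as [v]. *)
Lemma kernel_growth_dom (P C0 lo hi B : R) : 0 < lo -> lo <= hi -> 0 <= P -> 0 <= C0 ->
  exists C kappa : R, [/\ 0 < C, 0 < kappa & forall r k (x y : Rn) g,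
    lo <= r -> r <= hi -> nsq x <= B -> gauss_kernel P r k ->
    `|g| <= C0 * (1 + nsq y) -> `|k (x - y) * g| <= C * expR (- (kappa * nsq y))].
Proof.
move=> lo0 lohi P0 C00.
have [C [kappa [C1 k0 H]]] := @gk_dom R n lo hi B lo0 lohi.
exists (P * C * C0 * (1 + 2 / kappa) + 1), (kappa / 2); split.
- apply: ltr_wpDl => //; rewrite !mulr_ge0 ?addr_ge0 ?divr_ge0 ?(ltW C1)//.
  exact: ltW.
- by rewrite divr_gt0.
move=> r k x y g lor rhi xB [mk kP] gy.
have N0 := nsq_ge0 y.
rewrite normrM; apply: (@le_trans _ _ (P * (C * expR (- (kappa * nsq y))) * (C0 * (1 + nsq y)))).
  apply: ler_pM => //; apply: (le_trans (kP _)).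
  by rewrite ler_wpM2l//; exact: H.
rewrite (_ : P * _ * _ = P * C * C0 * ((1 + nsq y) * expR (- (kappa * nsq y)))); last by ring.
apply: (@le_trans _ _ (P * C * C0 * ((1 + 2 / kappa) * expR (- (kappa / 2 * nsq y))))).
  rewrite ler_wpM2l//; first by rewrite !mulr_ge0// ltW.
  exact: expR_absorb.
by rewrite mulrA ler_wpM2r ?expR_ge0// lerDl.
Qed.

Lemma integrable_le_expR (f : Rn -> R) (C kappa : R) : 0 < kappa ->
  measurable_fun setT f -> (forall y, `|f y| <= C * expR (- (kappa * nsq y))) ->
  mu.-integrable setT (EFin \o f).
Proof.
move=> k0 mf fC; apply: (le_integrable measurableT _ _ (integrable_expR_nsq C k0)).
  exact/measurable_EFinP.
move=> y _; rewrite /= lee_fin; apply: (le_trans (fC y)); exact: ler_norm.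
Qed.

Lemma integral_translate (f : Rn -> \bar R) (c : Rn) : measurable_fun setT f ->
  (\int[mu]_x f (x + c)%R = \int[mu]_x f x)%E.
Proof.
move=> mf; rewrite integralE [RHS]integralE; congr (_ - _)%E.
  rewrite -[RHS](@ge0_integral_translate R n f^\+%E c).
  - by apply: eq_integral => x _; rewrite !funeposE.
  - exact: measurable_funepos.
  - by move=> x; exact: funepos_ge0.
rewrite -[RHS](@ge0_integral_translate R n f^\-%E c).
- by apply: eq_integral => x _; rewrite !funenegE.
- exact: measurable_funeneg.
- by move=> x; exact: funeneg_ge0.
Qed.

Lemma nsq_line_le (y : Rn) i (t : R) : -1 < t -> t < 1 ->
  nsq y / 2 - 1 <= nsq (y + t *: unit_rV i).
Proof.
move=> t1 t2; have h := nsq_shift (t *: unit_rV i) (- y).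
rewrite opprK nsqN [t *: _ + _]addrC in h; apply: le_trans h.
rewrite lerD2l lerN2 nsqZ /nsq (bigD1 i)//= big1 => [|j ji].
  by rewrite mxE !eqxx expr1n addr0 mulr1; nra.
by rewrite mxE eqxx/= (negbTE ji) expr0n.
Qed.

(** By translation invariance the integral of [G] along a line of translates is
    constant; differentiating under the integral at 0 gives the claim. *)
Lemma Rintegral_line_derivative0 (G G' : Rn -> R) i (C kappa : R) :
  0 < kappa -> 0 < C -> measurable_fun setT G ->
  (forall y, is_derive (0 : R) (1 : R) (fun t : R => G (y + t *: unit_rV i)) (G' y)) ->
  (forall y, `|G y| <= C * expR (- (kappa * nsq y))) ->
  (forall y, `|G' y| <= C * expR (- (kappa * nsq y))) ->
  \int[mu]_y G' y = 0.
Proof.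
move=> k0 C0 mG dG GC G'C.
have mGt t : measurable_fun setT (fun y : Rn => G (y + t *: unit_rV i)).
  by apply: (measurableT_comp mG); exact: measurable_funD_rV.
have bnd (F : Rn -> R) t y : -1 < t -> t < 1 ->
    (forall y, `|F y| <= C * expR (- (kappa * nsq y))) ->
    `|F (y + t *: unit_rV i)| <= C * expR kappa * expR (- (kappa / 2 * nsq y)).
  move=> t1 t2 FC; apply: (le_trans (FC _)).
  rewrite -mulrA (ler_wpM2l (ltW C0))// -expRD ler_expR.
  have h : kappa * (nsq y / 2 - 1) <= kappa * nsq (y + t *: unit_rV i).
    by rewrite (ler_wpM2l (ltW k0))//; exact: nsq_line_le.
  by lra.
have k20 : 0 < kappa / 2 by rewrite divr_gt0.
have := @is_derive_integral R _ Rn mu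
  (fun t y => G (y + t *: unit_rV i)) (fun t y => G' (y + t *: unit_rV i))
  (fun y => C * expR kappa * expR (- (kappa / 2 * nsq y))) 0 (-1) 1.
have -> : (fun t : R => \int[mu]_y G (y + t *: unit_rV i)) = cst (\int[mu]_y G y).
  apply/funext => t; rewrite /Rintegral; congr fine.
  by rewrite (integral_translate (f := EFin \o G))//; exact/measurable_EFinP.
move=> H.
have {}H : is_derive (0 : R) (1 : R) (cst (\int[mu]_y G y)) (\int[mu]_y G' (y + 0 *: unit_rV i)).
  apply: H.
  - by rewrite in_itv/=; lra.
  - move=> t; rewrite in_itv/= => /andP[t1 t2].
    apply: (integrable_le_expR k20 (mGt t)) => y; exact: bnd.
  - by move=> t y _; exact: is_derive_line0.
  - exact: integrable_expR_nsq.
  - by move=> t y; rewrite in_itv/= => /andP[t1 t2]; exact: bnd.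
have [_ E1] := H; have [_ E2] := is_derive_cst (\int[mu]_y G y) (0 : R) (1 : R).
rewrite [RHS](_ : 0 = 'D_1 (cst (\int[mu]_y G y)) (0 : R)); last by rewrite -E2.
by rewrite E1; apply: eq_Rintegral => y _; rewrite scale0r addr0.
Qed.

End parts.

(** * The entropy along the backward heat flow *)

Section entropy.
Context {R : realType} (n : nat) (D : R) (w : 'rV[R]_n -> R).
Hypothesis ww : is_weight w.
Hypothesis dw : doubling_bound (weight_measure w) D.
Hypothesis wT : weight_measure w setT != 0%E.
Local Notation Rn := 'rV[R]_n.
Local Notation mu := (@lebesgue_rV R n).
Local Notation u := (u w).
Local Notation v := (v w).
Local Notation v1 := (v1 w).
Local Notation v2 := (v2 w).
Local Notation vr := (vr w).
Variables (x0 : Rn) (rad : R).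
Hypothesis rad0 : 0 < rad.

Let mw : measurable_fun setT w. Proof. by have [] := ww. Qed.
Let gw : gauss_integrable w. Proof. exact: doubling_gauss_integrable dw. Qed.

Lemma gkN s (x : Rn) : gk s (- x) = gk s x.
Proof. by rewrite !gkE nsqN. Qed.

Lemma gauss_kernelN P s (k : Rn -> R) :
  gauss_kernel P s k -> gauss_kernel P s (fun x => k (- x)).
Proof.
move=> [mk kP]; split.
  apply: (measurableT_comp mk); apply: measurable_fun_rVP => i.
  rewrite (_ : _ \o _ = (fun x : Rn => - x 0 i)); last first.
    by apply/funext => x /=; rewrite /coord_rV mxE.
  by apply: measurableT_comp => //; exact: measurable_coord.
by move=> x; rewrite -(nsqN x) -(gkN s x).
Qed.

Lemma measurable_subr (k : Rn -> R) :
  measurable_fun setT k -> measurable_fun setT (fun y : Rn => k (y - x0)).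
Proof. by move=> mk; apply: (measurableT_comp mk); exact: measurable_funB_rV. Qed.

Lemma kernel_growth_domr (P C0 lo hi : R) : 0 < lo -> lo <= hi -> 0 <= P -> 0 <= C0 ->
  exists C kappa : R, [/\ 0 < C, 0 < kappa & forall r k (y : Rn) g,
    lo <= r -> r <= hi -> gauss_kernel P r k ->
    `|g| <= C0 * (1 + nsq y) -> `|k (y - x0) * g| <= C * expR (- (kappa * nsq y))].
Proof.
move=> lo0 lohi P0 C00.
have [C [kappa [C1 k0 H]]] := @kernel_growth_dom R n P C0 lo hi (nsq x0) lo0 lohi P0 C00.
exists C, kappa; split => // r k y g lor rhi kk gy.
rewrite -opprB; exact: (H r (fun x => k (- x)) x0 y g lor rhi (lexx _) (gauss_kernelN kk)).
Qed.

(** All the functions that are integrated against Gaussian kernels below grow at most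
    quadratically; one constant for all of them keeps the majorants uniform. *)
Lemma v_growth lo hi : 0 < lo -> lo <= hi -> exists2 C, 0 < C &
  forall r y, lo <= r -> r <= hi ->
    [/\ `|v r y| <= C * (1 + nsq y), forall i, `|v1 i r y| <= C * (1 + nsq y),
        forall i, `|v2 i r y| <= C * (1 + nsq y), `|vr r y| <= C * (1 + nsq y) &
        `|\sum_i v1 i r y ^+ 2| <= C * (1 + nsq y)].
Proof.
move=> lo0 lohi.
have [C C0 HC] := ln_u_growth ww dw wT lo0 lohi.
have [B B0 HB] := v_derivatives_bound ww dw wT lo0 lohi.
have nB : 0 <= n%:R * B ^+ 2 by rewrite mulr_ge0// exprn_ge0// ltW.
exists (C + B + n%:R * B ^+ 2); first by rewrite ltr_wpDr// addr_gt0.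
move=> r y lor rhi; have N0 := nsq_ge0 y.
have [b1 b2 b3] := HB r y lor rhi; have bC := HC r y lor rhi.
have le1 z : `|z| <= B -> `|z| <= (C + B + n%:R * B ^+ 2) * (1 + nsq y).
  move=> zB; apply: (le_trans zB).
  have d1 := mulr_ge0 (ltW C0) N0; have d2 := mulr_ge0 (ltW B0) N0.
  have d3 := mulr_ge0 nB N0.
  by clear -d1 d2 d3 nB C0 B0; lra.
split => [|i|i||].
- apply: (le_trans bC); rewrite ler_wpM2r ?addr_ge0//.
  by rewrite -addrA lerDl addr_ge0// ltW.
- exact: le1.
- exact: le1.
- exact: le1.
apply: (@le_trans _ _ (n%:R * B ^+ 2)).
  apply: (le_trans (ler_norm_sum _ _ _)).
  rewrite (_ : n%:R * B ^+ 2 = \sum_(i < n) B ^+ 2); last first.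
    by rewrite sumr_const card_ord mulr_natl.
  apply: ler_sum => i _; rewrite normrX lerXn2r ?nnegrE//; exact: ltW.
rewrite -[leLHS]mulr1; apply: ler_pM => //; last by rewrite lerDl.
by rewrite lerDr addr_ge0// ltW.
Qed.

Lemma measurable_sumv1 r : measurable_fun setT (fun y => \sum_i v1 i r y ^+ 2).
Proof.
by apply: measurable_sum => i; apply: measurable_funX; exact: (measurable_v1 ww).
Qed.

Lemma integrable_kernel_growth P s (k g : Rn -> R) C : 0 < s -> 0 <= P -> 0 <= C ->
  gauss_kernel P s k -> measurable_fun setT g ->
  (forall y, `|g y| <= C * (1 + nsq y)) ->
  mu.-integrable setT (EFin \o (fun y => k (y - x0) * g y)).
Proof.
move=> s0 P0 C0 kk mg gC.
have [B [kappa [B0 k0 H]]] := kernel_growth_domr s0 (lexx s) P0 C0.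
apply: (integrable_le_expR (C := B) k0); last by move=> y; exact: H.
by apply: measurable_funM => //; apply: measurable_subr; have [] := kk.
Qed.

(** The integrand is the derivative in direction [i] of
    [(d_i g) v - g (d_i v)], so that two integrations by parts are done at once. *)
Lemma integral_parts i s r : 0 < s -> 0 < r ->
  \int[mu]_y (gk2 i s (y - x0) * v r y - gk s (y - x0) * v2 i r y) = 0.
Proof.
move=> s0 r0; pose P := kernel_cst n s; have P0 : 0 <= P := kernel_cst_ge0 n s0.
have [C C0 HC] := v_growth r0 (lexx r).
have [B [kappa [B0 k0 H]]] := kernel_growth_domr s0 (lexx s) P0 (ltW C0).
have [e0 e1 e2 _ _] : [/\ forall y, `|v r y| <= C * (1 + nsq y),
   forall y, `|v1 i r y| <= C * (1 + nsq y), forall y, `|v2 i r y| <= C * (1 + nsq y), True & True].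
  by split => // y; have [] := HC r y (lexx r) (lexx r).
have kg := kernel_gk n s0 (lexx s).
have kg1 := kernel_gk1 i s0 (lexx s).
have kg2 := kernel_gk2 i s0 (lexx s).
have mgk : measurable_fun setT (@gk R n s) by have [] := kg.
have mgk1 : measurable_fun setT (@gk1 R n i s) by have [] := kg1.
have B20 : 0 < B + B by rewrite addr_gt0.
pose G y := gk1 i s (y - x0) * v r y - gk s (y - x0) * v1 i r y.
pose G' y := gk2 i s (y - x0) * v r y - gk s (y - x0) * v2 i r y.
apply: (@Rintegral_line_derivative0 R n G G' i (B + B) kappa k0 B20); rewrite /G /G'.
- apply: measurable_funB.
    by apply: measurable_funM; [exact: measurable_subr|exact: (measurable_v ww)].
  by apply: measurable_funM; [exact: measurable_subr|exact: (measurable_v1 ww)].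
- move=> y.
  have Dv := is_derive_v ww dw wT i y r0.
  have Dv1 := is_derive_v1 ww dw wT i y r0.
  have Dg := is_derive_gk i s (y - x0) 0.
  have Dg1 := is_derive_gk1 i s (y - x0) 0.
  have e t : y + t *: unit_rV i - x0 = y - x0 + t *: unit_rV i by rewrite addrAC.
  have -> : (fun t : R => gk1 i s (y + t *: unit_rV i - x0) * v r (y + t *: unit_rV i) -
      gk s (y + t *: unit_rV i - x0) * v1 i r (y + t *: unit_rV i)) =
    (fun t : R => gk1 i s (y - x0 + t *: unit_rV i) * v r (y + t *: unit_rV i) -
      gk s (y - x0 + t *: unit_rV i) * v1 i r (y + t *: unit_rV i)).
    by apply/funext => t; rewrite e.
  apply: is_derive_eq; rewrite !scale0r !addr0 /GRing.scale/=; ring.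
- move=> y; apply: (le_trans (ler_normB _ _)); rewrite mulrDl.
  by apply: lerD; apply: H.
- move=> y; apply: (le_trans (ler_normB _ _)); rewrite mulrDl.
  by apply: lerD; apply: H.
Qed.

(** Chosen so that [rho rad r ^+ 2 + r ^+ 2] is constant: the outer kernel then
    evolves backwards in time while [v] evolves forwards, and the two scales meet at
    [r = rad]. *)
Definition rho r : R := Num.sqrt (2 * rad ^+ 2 - r ^+ 2).

(* A factor above 1 makes rho differentiable in a neighbourhood of the endpoint
   r = rad; this one is small enough for rho >= rad / 2. *)
Let hi := 6 / 5 * rad.

Lemma rho_sqr r : 0 < r -> r < hi -> rho r ^+ 2 = 2 * rad ^+ 2 - r ^+ 2 /\
  rad / 2 <= rho r <= 2 * rad.
Proof.
rewrite /hi => r0 rhi.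
have h0 : (rad / 2) ^+ 2 <= 2 * rad ^+ 2 - r ^+ 2 by nra.
have h1 : 0 <= 2 * rad ^+ 2 - r ^+ 2 by apply: le_trans h0; exact: sqr_ge0.
split; first by rewrite sqr_sqrtr.
apply/andP; split.
  rewrite -[leLHS]ger0_norm ?divr_ge0 ?(ltW rad0)// -sqrtr_sqr.
  by rewrite ler_wsqrtr.
rewrite -[leRHS]ger0_norm ?mulr_ge0 ?(ltW rad0)// -sqrtr_sqr.
by rewrite ler_wsqrtr//; nra.
Qed.

Lemma is_derive_rho r : 0 < r -> r < hi ->
  is_derive (r : R) (1 : R) rho (- (r / rho r)).
Proof.
move=> r0 rhi; have [rho2 /andP[rho_ge _]] := rho_sqr r0 rhi.
have rho0 : 0 < rho r by apply: lt_le_trans rho_ge; rewrite divr_gt0.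
have s0 : 0 < 2 * rad ^+ 2 - r ^+ 2 by rewrite -rho2 exprn_gt0.
have Ds := is_derive1_sqrt s0.
have Dq : is_derive (r : R) (1 : R) (fun r : R => 2 * rad ^+ 2 - r ^+ 2) (- (2 * r)).
  by apply: is_derive_eq; rewrite /GRing.scale/=; ring.
have := @is_derive1_comp R Num.sqrt (fun r : R => 2 * rad ^+ 2 - r ^+ 2)
  r _ _ Ds Dq; rewrite -/(rho r).
rewrite (_ : _ * - (2 * r) = - (r / rho r)); first exact.
by field; rewrite gt_eqF.
Qed.

Definition entropy r : R := \int[mu]_y (gk (rho r) (y - x0) * v r y).

Definition entropy_prod r : R :=
  r / 2 * \int[mu]_y (gk (rho r) (y - x0) * \sum_i v1 i r y ^+ 2).

Lemma is_derive_gk_rho r (x : Rn) : 0 < r -> r < hi ->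
  is_derive (r : R) (1 : R) (fun t => gk (rho t) x) (- (r / rho r) * gkr (rho r) x).
Proof.
move=> r0 rhi; have [rho2 /andP[rho_ge _]] := rho_sqr r0 rhi.
have rho0 : 0 < rho r by apply: lt_le_trans rho_ge; rewrite divr_gt0.
by rewrite mulrC; exact: (is_derive1_comp (is_derive_gkr x rho0) (is_derive_rho r0 rhi)).
Qed.

(** Differentiating the kernel gives [-(r/2) Lap] of it, differentiating [v] gives
    [(r/2) (Lap v + |grad v|^2)].  The Laplacians cancel by [integral_parts], and only
    the nonnegative gradient term remains. *)
Lemma is_derive_entropy r : 0 < r -> r < hi ->
  is_derive (r : R) (1 : R) entropy (entropy_prod r).
Proof.
move=> r0 rhi; pose lo := r / 2.
have lo0 : 0 < lo by rewrite divr_gt0.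
have lor : lo < r by rewrite /lo; lra.
have lohi : lo <= hi by exact/ltW/(lt_trans lor).
have [C C0 HC] := v_growth lo0 lohi.
have q0 : 0 < rad / 2 by rewrite divr_gt0.
have qq : rad / 2 <= 2 * rad by lra.
pose P := kernel_cst n (rad / 2); have P0 : 0 <= P := kernel_cst_ge0 n q0.
have hi2 : 0 <= hi / (rad / 2) by rewrite divr_ge0 ?(ltW q0)// mulr_ge0 ?(ltW rad0).
have [B [kappa [B0 k0 H]]] := kernel_growth_domr q0 qq P0 (ltW C0).
pose f t y := gk (rho t) (y - x0) * v t y.
pose f' t y := - (t / rho t) * gkr (rho t) (y - x0) * v t y + gk (rho t) (y - x0) * vr t y.
have kg t : 0 < t -> t < hi -> gauss_kernel P (rho t) (@gk R n (rho t)).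
  by move=> t0 th; have [_ /andP[t1 _]] := rho_sqr t0 th; exact: kernel_gk.
have kgr t : 0 < t -> t < hi -> gauss_kernel P (rho t) (@gkr R n (rho t)).
  by move=> t0 th; have [_ /andP[t1 _]] := rho_sqr t0 th; exact: kernel_gkr.
have rgt0 t : 0 < t -> t < hi -> 0 < rho t.
  by move=> t0 th; have [_ /andP[t1 _]] := rho_sqr t0 th; exact: lt_le_trans t1.
have D1 : is_derive (r : R) (1 : R) entropy (\int[mu]_y f' r y).
  apply: (@is_derive_integral R _ Rn mu f f'
    (fun y => ((hi / (rad / 2)) * B + B) * expR (- (kappa * nsq y))) r lo hi).
  - by rewrite in_itv/= lor.
  - move=> t; rewrite in_itv/= => /andP[t1 t2]; have t0 := lt_trans lo0 t1.
    apply: (integrable_kernel_growth (rgt0 t t0 t2) P0 (ltW C0) (kg t t0 t2)).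
      exact: (measurable_v ww).
    by move=> y; have [] := HC t y (ltW t1) (ltW t2).
  - move=> t y; rewrite in_itv/= => /andP[t1 t2]; have t0 := lt_trans lo0 t1.
    have Dv := is_derive_v_time ww dw wT y t0.
    have Dg := is_derive_gk_rho (y - x0) t0 t2.
    by apply: is_derive_eq; rewrite /f' /GRing.scale/=; ring.
  - exact: integrable_expR_nsq.
  - move=> t y; rewrite in_itv/= => /andP[t1 t2]; have t0 := lt_trans lo0 t1.
    have [b1 _ _ b2 _] := HC t y (ltW t1) (ltW t2).
    have [_ /andP[g1 g2]] := rho_sqr t0 t2.
    apply: (le_trans (ler_normD _ _)); rewrite mulrDl; apply: lerD; last first.
      by apply: (H (rho t)) => //; exact: kg.
    rewrite -mulrA normrM -[leRHS]mulrA; apply: ler_pM => //; last first.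
      by apply: (H (rho t)) => //; exact: kgr.
    rewrite normrN ger0_norm ?divr_ge0 ?(ltW t0) ?(ltW (rgt0 t t0 t2))//.
    apply: ler_pM => //; [exact: ltW|by rewrite invr_ge0 ltW// rgt0|exact: ltW|].
    by rewrite lef_pV2 ?posrE// rgt0.
apply: (is_derive_eq D1).
have s0 := rgt0 r r0 rhi.
have [rr1 rr2] : lo <= r /\ r <= hi by split; exact: ltW.
have hh y := HC r y rr1 rr2.
have iS : mu.-integrable setT (EFin \o (fun y => gk (rho r) (y - x0) * \sum_i v1 i r y ^+ 2)).
  apply: (integrable_kernel_growth s0 P0 (ltW C0) (kg r r0 rhi)).
    exact: measurable_sumv1.
  by move=> y; have [] := hh y.
pose F i y := gk2 i (rho r) (y - x0) * v r y - gk (rho r) (y - x0) * v2 i r y.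
have iF i : mu.-integrable setT (EFin \o F i).
  apply: (@integrableB _ Rn R mu setT measurableT
    (EFin \o (fun y => gk2 i (rho r) (y - x0) * v r y))
    (EFin \o (fun y => gk (rho r) (y - x0) * v2 i r y))).
    apply: (integrable_kernel_growth s0 P0 (ltW C0) (k := gk2 i (rho r))).
    - by have [_ /andP[t1 _]] := rho_sqr r0 rhi; exact: kernel_gk2.
    - exact: (measurable_v ww).
    - by move=> y; have [] := hh y.
  apply: (integrable_kernel_growth s0 P0 (ltW C0) (kg r r0 rhi)).
    exact: (measurable_v2 ww).
  by move=> y; have [] := hh y.
have [iSF SF] := Rintegral_sum (index_enum 'I_n) iF.
rewrite big1 in SF; last by move=> i _; exact: integral_parts.
transitivity (r / 2 * (\int[mu]_y (gk (rho r) (y - x0) * \sum_i v1 i r y ^+ 2)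
    - \int[mu]_y \sum_i F i y)); last by rewrite SF subr0.
rewrite -(RintegralB measurableT iS iSF).
rewrite -(RintegralZl (r / 2) measurableT); last first.
  exact: (integrableB measurableT iS iSF).
apply: eq_Rintegral => y _; rewrite /f' /F (vrE ww dw y r0) gkrE ?gt_eqF//.
have -> : \sum_i (gk2 i (rho r) (y - x0) * v r y - gk (rho r) (y - x0) * v2 i r y) =
    (\sum_i gk2 i (rho r) (y - x0)) * v r y - gk (rho r) (y - x0) * \sum_i v2 i r y.
  by rewrite sumrB -mulr_suml -mulr_sumr.
rewrite big_split/=; have : rho r != 0 by rewrite gt_eqF.
move: (rho r) (\sum_i gk2 _ _ _) (\sum_i v2 _ _ _) (\sum_i v1 _ _ _ ^+ 2) => p a b c p0.
by field.
Qed.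

Lemma continuous_sumr (I : Type) (s : seq I) (F : I -> R -> R) (t : R) :
  (forall i, {for t, continuous (F i)}) ->
  {for t, continuous (fun r => \sum_(i <- s) F i r)}.
Proof.
move=> cF; elim: s => [|a s IH].
  rewrite (_ : (fun r : R => _) = cst 0); first exact: cvg_cst.
  by apply/funext => r; rewrite big_nil.
rewrite (_ : (fun r : R => _) = (fun r => F a r + \sum_(i <- s) F i r)).
  by apply: cvgD; [exact: cF|exact: IH].
by apply/funext => r; rewrite big_cons.
Qed.

Lemma continuous_entropy_prod r : 0 < r -> r < hi ->
  {for r, continuous entropy_prod}.
Proof.
move=> r0 rhi; pose lo := r / 2.
have lo0 : 0 < lo by rewrite divr_gt0.
have lor : lo < r by rewrite /lo; lra.
have lohi : lo <= hi by exact/ltW/(lt_trans lor).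
have [C C0 HC] := v_growth lo0 lohi.
have q0 : 0 < rad / 2 by rewrite divr_gt0.
have qq : rad / 2 <= 2 * rad by lra.
pose P := kernel_cst n (rad / 2); have P0 : 0 <= P := kernel_cst_ge0 n q0.
have [B [kappa [B0 k0 H]]] := kernel_growth_domr q0 qq P0 (ltW C0).
have kg t : 0 < t -> t < hi -> gauss_kernel P (rho t) (@gk R n (rho t)).
  by move=> t0 th; have [_ /andP[t1 _]] := rho_sqr t0 th; exact: kernel_gk.
have rgt0 t : 0 < t -> t < hi -> 0 < rho t.
  by move=> t0 th; have [_ /andP[t1 _]] := rho_sqr t0 th; exact: lt_le_trans t1.
pose f t y := gk (rho t) (y - x0) * \sum_i v1 i t y ^+ 2.
apply: cvgM; first by apply: cvgM; [exact: cvg_id|exact: cvg_cst].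
have rI : r \in `]lo, hi[%classic by rewrite inE/= in_itv/= lor.
apply: (@continuity_under_integral R _ Rn mu f setT measurableT lo hi _ _
  (fun y => B * expR (- (kappa * nsq y))) _ _ r rI).
- move=> t; rewrite /= in_itv/= => /andP[t1 t2]; have t0 := lt_trans lo0 t1.
  apply: (integrable_kernel_growth (rgt0 t t0 t2) P0 (ltW C0) (kg t t0 t2)).
    exact: measurable_sumv1.
  by move=> y; have [] := HC t y (ltW t1) (ltW t2).
- apply: aeW => y _ t; rewrite inE/= in_itv/= => /andP[t1 t2].
  have t0 := lt_trans lo0 t1.
  have ck : {for t, continuous (fun t => gk (rho t) (y - x0))}.
    apply: differentiable_continuous; apply/derivable1_diffP.
    by have [] := is_derive_gk_rho (y - x0) t0 t2.
  apply: cvgM; first exact: ck.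
  apply: (continuous_sumr (F := fun i t => v1 i t y ^+ 2)) => i.
  have cv : {for t, continuous (fun t => v1 i t y)}.
    exact: (continuous_v1_time ww dw wT t0).
  exact: (cvgM cv cv).
- exact: integrable_expR_nsq.
- move=> t; rewrite /= in_itv/= => /andP[t1 t2]; have t0 := lt_trans lo0 t1.
  apply: aeW => y _; have [_ /andP[g1 g2]] := rho_sqr t0 t2.
  by apply: (H (rho t)) => //; [exact: kg|have [] := HC t y (ltW t1) (ltW t2)].
Qed.

Lemma entropy_FTC a : 0 < a -> a < rad ->
  (\int[lebesgue_measure]_(r in `[a, rad]) (entropy_prod r)%:E =
   (entropy rad)%:E - (entropy a)%:E)%E.
Proof.
move=> a0 arad.
have radhi : rad < hi by rewrite /hi; lra.
have ct t : 0 < t -> t <= rad -> {for t, continuous entropy}.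
  move=> t0 tr; apply: differentiable_continuous; apply/derivable1_diffP.
  by have [] := is_derive_entropy t0 (le_lt_trans tr radhi).
apply: continuous_FTC2 => //.
- apply: continuous_in_subspaceT => t; rewrite inE/= in_itv/= => /andP[t1 t2].
  apply: continuous_entropy_prod; first exact: lt_le_trans t1.
  exact: le_lt_trans radhi.
- split.
  + move=> t; rewrite in_itv/= => /andP[t1 t2].
    by have [] := is_derive_entropy (lt_trans a0 t1) (lt_trans t2 radhi).
  + by apply: cvg_at_right_filter; apply: ct => //; exact: ltW.
  + by apply: cvg_at_left_filter; apply: ct.
- move=> t; rewrite in_itv/= => /andP[t1 t2].
  have [_ <-] := is_derive_entropy (lt_trans a0 t1) (lt_trans t2 radhi).
  by rewrite derive1E.
Qed.

End entropy.

(** * Carleson measures control the growth of the entropy *)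

Section carleson.
Context {R : realType} (n : nat).
Local Notation Rn := 'rV[R]_n.
Local Notation mu := (@lebesgue_rV R n).

Lemma le_carleson_norm (nu : set (measurableTypeR R * Rn)%type -> \bar R)
    (delta : R) (x : Rn) r : (carleson_norm nu <= delta%:E)%E -> 0 < r ->
  (nu (tent x r) <= delta%:E * mu (eball x r))%E.
Proof.
move=> nud r0.
have mf := lebesgue_eball_fin x r0; have m0 := lebesgue_eball_gt0 x r0.
have : (nu (tent x r) / mu (eball x r) <= delta%:E)%E.
  by apply: (le_trans _ nud); apply: ereal_sup_ubound; exists x => //; exists r.
rewrite -(fineK mf); set m := fine _.
have {}m0 : 0 < m by rewrite fine_gt0// m0/= ltey_eq mf.
by rewrite inver gt_eqF// lee_pdivrMr.
Qed.

Lemma carleson_norm_ge0 (nu : set (measurableTypeR R * Rn)%type -> \bar R) :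
  (forall A, 0 <= nu A)%E -> (0 <= carleson_norm nu)%E.
Proof.
move=> nu0; apply: (@le_trans _ _ (nu (tent 0 1) / mu (eball (0 : Rn) 1))%E).
  by rewrite mule_ge0// inve_ge0.
by apply: ereal_sup_ubound; exists 0 => //; exists 1 => //=.
Qed.

(** For [r < rad] the kernel at scale [rho] is at most a multiple of
    [rad^-n exp (-|y - x0|^2 / (2 rad^2))].  So the growth of the entropy is bounded by
    the integral of a Gaussian over the strip [0 < r < rad]; the part of the strip over
    the ball of radius [2^k rad] lies in the tent of that radius, and [annuli_bound]
    sums the contributions. *)
Lemma entropy_growth : exists2 K : R, 0 < K &
  forall (D : R) (w : Rn -> R) (delta : R), is_weight w ->
  doubling_bound (weight_measure w) D -> weight_measure w setT != 0%E ->
  (carleson_norm (gradient_measure w) <= delta%:E)%E -> 0 <= delta ->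
  forall (x0 : Rn) (rad a : R), 0 < a -> a < rad ->
  entropy w x0 rad rad - entropy w x0 rad a <= K * delta.
Proof.
have A1 : 1 <= (2 : R) ^+ n by rewrite exprn_ege1// ler1n.
have k0 : 0 < (2^-1 : R) by rewrite invr_gt0.
have [K0 K00 HK] := annuli_bound A1 k0.
pose p : R := pi `^ (- (n%:R / 2)).
have p0 : 0 < p by rewrite powR_gt0 ?pi_gt0.
exists (2^-1 * p * K0 * 2 ^+ n); first by rewrite !mulr_gt0 ?exprn_gt0.
move=> D w delta ww dw wT cd delta0 x0 rad a a0 arad.
have rad0 : 0 < rad := lt_trans a0 arad.
have rad20 : 0 < rad ^+ 2 by rewrite exprn_gt0.
have mw : measurable_fun setT w by have [] := ww.
pose S (q : measurableTypeR R * Rn) : R := \sum_i v1 w i q.1 q.2 ^+ 2.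
have S0 q : 0 <= S q by apply: sumr_ge0 => i _; exact: sqr_ge0.
have mS : measurable_fun setT S.
  apply: measurable_sum => i; apply: measurable_funX.
  exact: (measurable_v1_2 ww).
have energy r y : 0 < r -> enorm (gradient
    (fun x => ln (convolution (dilate (@gaussian R n) r) w x)) y) ^+ 2 = S (r, y).
  move=> r0; rewrite enorm_sqr /nsq; apply: eq_bigr => i _; rewrite mxE.
  have Dv := is_derive_line (is_derive_v ww dw wT i y r0).
  by have [_ E] := Dv; rewrite -E.
pose T := (measurableTypeR R * Rn)%type.
pose strip : set T := [set q | 0 < (q.1 : R) < rad].
have mstrip : measurable strip.
  rewrite (_ : strip = `]0, rad[%classic `*` setT).
    by apply: measurableX => //; exact: measurable_itv.
  by apply/seteqP; split => [[r y] /= ry|[r y] /= [ry _]];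
    move: ry; rewrite /strip/= in_itv.
pose g (q : T) : \bar R := (S q * (q.1 : R))%:E.
have mg : measurable_fun setT g.
  by apply/measurable_EFinP; apply: measurable_funM => //; exact: measurable_fst.
pose f := g \_ strip.
have mf : measurable_fun setT f.
  exact: (measurable_restrictT g mstrip).1 (measurable_funTS mg).
have f0 q : (0 <= f q)%E.
  rewrite /f patchE; case: ifPn => //; rewrite inE => /andP[q1 _].
  by rewrite lee_fin mulr_ge0// ltW.
pose s (q : T) : R := nsq (q.2 - x0) / rad ^+ 2.
have ms : measurable_fun setT s.
  apply: measurable_funM => //; apply: (measurableT_comp (@measurable_nsq R n)).
  by apply: measurable_funB_rV => //; exact: measurable_snd.
have s0 q : 0 <= s q by rewrite divr_ge0 ?nsq_ge0// ltW.
have M0 : 0 <= delta * (2 * rad) ^+ n.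
  by rewrite mulr_ge0// exprn_ge0// mulr_ge0// ltW.
have tents k : (\int[lebesgue_measure \x mu]_(q in [set q | (s q < 4 ^+ k)%R]) f q
    <= (delta * (2 * rad) ^+ n * (2 ^+ n) ^+ k)%:E)%E.
  have rk0 : 0 < 2 ^+ k * rad by rewrite mulr_gt0// exprn_gt0.
  have mE : measurable [set q : T | s q < 4 ^+ k] by exact: measurable_lt_cst.
  have mB : measurable (eball x0 (2 ^+ k * rad)) by exact: measurable_eball.
  have mt : measurable (tent x0 (2 ^+ k * rad)).
    apply: measurableX => //.
    rewrite (_ : [set t : measurableTypeR R | _] = `]0, 2 ^+ k * rad[%classic).
      exact: measurable_itv.
    by apply/seteqP; split => t /=; rewrite in_itv.
  apply: (@le_trans _ _ (gradient_measure w (tent x0 (2 ^+ k * rad)))).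
    rewrite /gradient_measure.
    rewrite (_ : tent _ _ `&` _ = tent x0 (2 ^+ k * rad)); last first.
      by apply/seteqP; split => [q []//|q qt]; split => //; have [/andP[]] := qt.
    rewrite [leRHS](_ : _ = \int[lebesgue_measure \x mu]_(q in tent x0 (2 ^+ k * rad)) g q)%E; last first.
      apply: eq_integral => -[r y]; rewrite inE => -[/= /andP[r0 _] _].
      by rewrite /g energy.
    rewrite /f -integral_mkcondr; apply: ge0_subset_integral => //.
    - exact: measurableI.
    - exact: measurable_funTS.
    - move=> q [/= /andP[q1 _] _]; rewrite lee_fin mulr_ge0//; exact: ltW.
    - move=> q [/= sq /andP[q1 q2]]; split => /=.
        rewrite q1/=; apply: (lt_le_trans q2).
        by rewrite -[leLHS]mul1r ler_wpM2r ?(ltW rad0)// exprn_ege1// ler1n.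
      rewrite eballE//=; move: sq; rewrite /s ltr_pdivrMr// exprMn => sq.
      by rewrite -exprM mulnC exprM (_ : 2 ^+ 2 = 4)//; ring.
  apply: (le_trans (le_carleson_norm x0 cd rk0)).
  apply: (@le_trans _ _ (delta%:E * ((2 * (2 ^+ k * rad)) ^+ n)%:E)%E).
    by apply: lee_wpmul2l; [rewrite lee_fin|exact: lebesgue_eball_le].
  rewrite -EFinM lee_fin -mulrA ler_wpM2l// -exprM mulnC exprM -exprMn.
  by rewrite (_ : 2 * (2 ^+ k * rad) = 2 * rad * 2 ^+ k)//; ring.
have bound := HK _ _ (lebesgue_measure \x mu)%E f s _ mf f0 ms s0 M0 tents.
pose c : R := p * rad ^- n.
have c0 : 0 < c by rewrite mulr_gt0// invr_gt0 exprn_gt0.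
have h2 : 0 <= 2^-1 * c by rewrite mulr_ge0// ltW.
pose F (q : T) : \bar R := ((expR (- (2^-1 * s q)))%:E * f q)%E.
have F0 q : (0 <= F q)%E by rewrite mule_ge0// lee_fin expR_ge0.
have mF : measurable_fun setT F.
  apply: emeasurable_funM => //; apply/measurable_EFinP.
  apply: measurableT_comp => //; apply: measurableT_comp => //.
  exact: measurable_funM.
have radhi : rad < 6 / 5 * rad by clear -rad0; lra.
have mep : measurable_fun `]a, rad[ (fun r => (entropy_prod w x0 rad r)%:E).
  apply/measurable_EFinP; apply: open_continuous_measurable_fun.
    exact: interval_open.
  move=> r; rewrite inE/= in_itv/= => /andP[r1 r2].
  exact: (continuous_entropy_prod ww dw wT rad0 (lt_trans a0 r1)
    (lt_trans r2 radhi)).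
have key r : a < r -> r < rad ->
    ((entropy_prod w x0 rad r)%:E <= (2^-1 * c)%:E * fubini_F mu F r)%E.
  move=> r1 r2; have r0 := lt_trans a0 r1.
  have rhi := lt_trans r2 radhi.
  have [rho2 /andP[rho_ge rho_le]] := rho_sqr rad0 r0 rhi.
  have rhor : rad <= rho rad r.
    rewrite -(@ler_pXn2r _ 2) ?nnegrE ?(ltW rad0) ?sqrtr_ge0// rho2.
    have : r ^+ 2 <= rad ^+ 2 by rewrite lerXn2r ?nnegrE ?ltW.
    by clear; lra.
  have rho0 : 0 < rho rad r by exact: lt_le_trans rhor.
  rewrite /entropy_prod.
  have iS : mu.-integrable setT (EFin \o (fun y => gk (rho rad r) (y - x0) * S (r, y))).
    have [C C0 HC] := v_growth ww dw wT r0 (lexx r).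
    apply: (integrable_kernel_growth x0 rho0 (kernel_cst_ge0 n rho0) (ltW C0)).
    - exact: kernel_gk.
    - by have := measurable_section r mS.
    - by move=> y; have [] := HC r y (lexx r) (lexx r).
  rewrite -(RintegralZl (r / 2) measurableT iS) /Rintegral fineK; last first.
    apply: integrable_fin_num => //.
    exact: (integrableZl measurableT (r / 2) iS).
  have mFr := measurable_section r mF.
  rewrite /fubini_F.
  have -> : ((2^-1 * c)%:E * \int[mu]_y F (r, y) =
      \int[mu]_y ((2^-1 * c)%:E * F (r, y)))%E.
    by rewrite ge0_integralZl ?lee_fin.
  apply: ge0_le_integral => //.
  - move=> y _; rewrite lee_fin mulr_ge0 ?divr_ge0 ?(ltW r0)// mulr_ge0//.
    exact: gk_ge0.
  - apply/measurable_EFinP; apply: measurable_funM => //.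
    by have /integrableP[/measurable_EFinP] := iS.
  - exact: measurable_funeM.
  move=> y _; rewrite /F /f patchE ifT; last by rewrite inE /strip/= r0.
  rewrite /g -!EFinM lee_fin /s/=.
  rewrite (_ : 2^-1 * c * _ = r / 2 * (c * expR (- (2^-1 * (nsq (y - x0) / rad ^+ 2))) * S (r, y))); last by ring.
  rewrite ler_wpM2l ?divr_ge0 ?(ltW r0)// ler_wpM2r//.
  have rho2le : rho rad r <= Num.sqrt 2 * rad.
    rewrite -(@ler_pXn2r _ 2) ?nnegrE ?mulr_ge0 ?sqrtr_ge0 ?(ltW rad0)//.
    by rewrite rho2 exprMn sqr_sqrtr// gerBl sqr_ge0.
  apply: (le_trans (gk_le (y - x0) rad0 rhor rho2le)).
  rewrite exprMn sqr_sqrtr// -/p -/c ler_wpM2l ?(ltW c0)// ler_expR lerN2.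
  rewrite [leLHS](_ : _ = (2 * rad ^+ 2)^-1 * nsq (y - x0))//.
  by field; rewrite gt_eqF.
have final : ((entropy w x0 rad rad - entropy w x0 rad a)%:E <=
    (2^-1 * c)%:E * (K0 * (delta * (2 * rad) ^+ n))%:E)%E.
  rewrite EFinB -(entropy_FTC ww dw wT x0 rad0 a0 arad).
  rewrite (integral_itv_bndoo _ _ mep).
  have mFF : measurable_fun setT (fubini_F mu F) by exact: measurable_fun_fubini_tonelli_F.
  have FF0 r : (0 <= fubini_F mu F r)%E by apply: integral_ge0 => y _.
  apply: (@le_trans _ _ (\int[lebesgue_measure]_(r in `]a, rad[) ((2^-1 * c)%:E * fubini_F mu F r))%E).
    apply: ge0_le_integral => //.
    - move=> r; rewrite /= in_itv/= => /andP[r1 r2].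
      rewrite lee_fin mulr_ge0 ?divr_ge0 ?(ltW (lt_trans a0 r1))//.
      apply: Rintegral_ge0 => y _; rewrite mulr_ge0 ?sumr_ge0//; last by move=> i _; exact: sqr_ge0.
      apply: gk_ge0.
      have [_ /andP[h _]] := rho_sqr rad0 (lt_trans a0 r1) (lt_trans r2 radhi).
      by apply: lt_le_trans h; rewrite divr_gt0.
    - by apply: measurable_funeM; exact: measurable_funTS.
    - by move=> r; rewrite /= in_itv/= => /andP[r1 r2]; exact: key.
  have mFa := measurable_funTS mFF : measurable_fun `]a, rad[ (fubini_F mu F).
  rewrite ge0_integralZl ?lee_fin//.
  apply: lee_wpmul2l; first by rewrite lee_fin.
  apply: le_trans bound; rewrite fubini_tonelli1//.
  by apply: ge0_subset_integral.
move: final; rewrite -EFinM lee_fin => h; apply: (le_trans h).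
rewrite le_eqVlt; apply/orP; left; apply/eqP.
rewrite /c exprMn; have : rad ^+ n != 0 by rewrite expf_neq0// gt_eqF.
by move: (rad ^+ n) (2 ^+ n) => X Y X0; field.
Qed.

End carleson.

(** * The heat semigroup *)

Section semigroup.
Context {R : realType} (n : nat).
Local Notation Rn := 'rV[R]_n.
Local Notation mu := (@lebesgue_rV R n).

Lemma integrable_gk_mul (f : Rn -> R) s x : 0 < s -> measurable_fun setT f ->
  gauss_integrable f ->
  mu.-integrable setT (fun z => (gk s (x - z) * f z)%:E).
Proof.
move=> s0 mf gf; apply: (integrable_conv _ s0 (kernel_cst_ge0 n s0)) => //.
exact: kernel_gk.
Qed.

(** By [gk_mul] and Fubini.  The integrability of the inner convolution against the
    kernel is part of the statement since [Rintegral] is total. *)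
Lemma gauss_semigroup (f : Rn -> R) s a x : 0 < s -> 0 < a ->
  measurable_fun setT f -> gauss_integrable f ->
  mu.-integrable setT (fun y => (gk s (x - y) * convolution (@gk R n a) f y)%:E) /\
  convolution (@gk R n s) (fun y => convolution (@gk R n a) f y) x =
  convolution (@gk R n (Num.sqrt (s ^+ 2 + a ^+ 2))) f x.
Proof.
move=> s0 a0 mf gf; set t := Num.sqrt _.
have t0 : 0 < t by rewrite sqrtr_gt0 addr_gt0// exprn_gt0.
have st0 : 0 < s * a / t by rewrite divr_gt0// mulr_gt0.
pose F (q : Rn * Rn) : \bar R := (gk s (x - q.1) * gk a (q.1 - q.2) * f q.2)%:E.
have mF : measurable_fun setT F.
  apply/measurable_EFinP; apply: measurable_funM; last first.
    exact: (measurableT_comp mf measurable_snd).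
  apply: measurable_funM.
    apply: (measurableT_comp (measurable_gk s)).
    by apply: measurable_funB_rV => //; exact: measurable_fst.
  apply: (measurableT_comp (measurable_gk a)).
  by apply: measurable_funB_rV; [exact: measurable_fst|exact: measurable_snd].
pose m z := (s ^+ 2 + a ^+ 2)^-1 *: (a ^+ 2 *: x + s ^+ 2 *: z).
have FE y z : F (y, z) = ((gk t (x - z) * f z) * gk (s * a / t) (m z - y))%:E.
  by rewrite /F/= (gk_mul x y z s0 a0) -/t -/(m z) mulrAC.
have it := integrable_gk_mul x t0 mf gf.
have ig z : mu.-integrable setT (fun y => (gk (s * a / t) (m z - y))%:E).
  exact: integrable_gk.
have iF : (mu \x mu)%E.-integrable setT F.
  apply: (@integrable21ltyP _ _ _ _ R mu mu F mF).2.
  rewrite (_ : (fun z => _) = (fun z => `|(gk t (x - z) * f z)%:E|)%E); last first.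
    apply/funext => z; under eq_integral do rewrite FE EFinM abseM.
    rewrite ge0_integralZl//; last first.
      by apply: measurableT_comp => //; have /integrableP[] := ig z.
    under eq_integral do rewrite gee0_abs ?lee_fin ?gk_ge0//.
    by rewrite integral_gk// mule1.
  by have /integrableP[] := it.
have innerE y : (\int[mu]_z F (y, z) = (gk s (x - y) * convolution (@gk R n a) f y)%:E)%E.
  rewrite /F/=.
  have iy := integrable_gk_mul y a0 mf gf.
  transitivity (\int[mu]_z ((gk s (x - y))%:E * (gk a (y - z) * f z)%:E))%E.
    by apply: eq_integral => z _; rewrite -EFinM -[in LHS]mulrA.
  rewrite (integralZl measurableT iy) [RHS]EFinM /convolution /Rintegral fineK//.
  exact: integrable_fin_num.
have outerE z : (\int[mu]_y F (y, z) = (gk t (x - z) * f z)%:E)%E.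
  under eq_integral do rewrite FE EFinM.
  by rewrite (integralZl measurableT (ig z)) integral_gk// mule1.
split.
  have := integrable_fubini_F iF; rewrite (_ : fubini_F _ _ = (fun y : Rn => (gk s (x - y) * convolution (@gk R n a) f y)%:E))//.
  by apply/funext => y; rewrite /fubini_F innerE.
have := Fubini iF.
under eq_integral do rewrite innerE.
under [in RHS]eq_integral do rewrite outerE.
by rewrite /convolution /Rintegral => ->.
Qed.

Lemma gauss_integrable_growth (f : Rn -> R) C : measurable_fun setT f ->
  0 <= C -> (forall y, `|f y| <= C * (1 + nsq y)) -> gauss_integrable f.
Proof.
move=> mf C0 fC kappa k0.
have k20 : 0 < kappa / 2 by rewrite divr_gt0.
apply: (integrable_le_expR (C := C * (1 + 2 / kappa)) k20).
  apply: measurable_funM => //; apply: measurableT_comp => //.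
  by apply: measurableT_comp => //; apply: measurable_funM => //; exact: measurable_nsq.
move=> y; rewrite normrM (ger0_norm (expR_ge0 _)) mulrC.
apply: (@le_trans _ _ (C * (1 + nsq y) * expR (- (kappa * nsq y)))).
  by rewrite ler_wpM2r ?expR_ge0.
by rewrite -[leLHS]mulrA -[leRHS]mulrA ler_wpM2l// expR_absorb// nsq_ge0.
Qed.

Lemma integrable_bounded (A : set Rn) (f : Rn -> R) c : measurable A ->
  (mu A < +oo)%E -> measurable_fun A f -> (forall y, A y -> `|f y| <= c) ->
  mu.-integrable A (EFin \o f).
Proof.
move=> mA fA mf fc.
have ic : mu.-integrable A (EFin \o (fun=> c)).
  by apply: measurable_bounded_integrable => //; exact: bounded_cst.
apply: (le_integrable mA _ _ ic); first exact/measurable_EFinP.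
by move=> y Ay; rewrite /= lee_fin; apply: (le_trans (fc y Ay)); exact: ler_norm.
Qed.

Lemma Rintegral_subset_le (A : set Rn) (h : Rn -> R) : measurable A ->
  (forall y, 0 <= h y) -> mu.-integrable setT (EFin \o h) ->
  \int[mu]_(y in A) h y <= \int[mu]_y h y.
Proof.
move=> mA h0 ih; rewrite /Rintegral fine_le//.
- by apply: integrable_fin_num => //; exact: integrableS ih.
- exact: integrable_fin_num.
have /integrableP[mh _] := ih.
apply: ge0_subset_integral => //.
by move=> y _; rewrite lee_fin.
Qed.

End semigroup.

(** * The Jensen deficit bounds the growth of the entropy from below *)

Section lower_bound.
Context {R : realType} (n : nat).
Local Notation Rn := 'rV[R]_n.
Local Notation mu := (@lebesgue_rV R n).

Definition avg (f : Rn -> R) (A : set Rn) : R :=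
  (\int[mu]_(y in A) f y) / fine (mu A).

Lemma subr1_ln_ge0 (t : R) : 0 < t -> 0 <= t - 1 - ln t.
Proof.
move=> t0; have := expR_ge1Dx (ln t); rewrite (lnK t0) => h.
by clear -h; lra.
Qed.

Lemma ln_tangent (m t : R) : 0 < m -> 0 < t -> 0 <= m^-1 * t + (ln m - 1) - ln t.
Proof.
move=> m0 t0; have := @subr1_ln_ge0 (t / m) (divr_gt0 t0 m0).
rewrite ln_div ?posrE// => hh; apply: (le_trans hh).
by rewrite le_eqVlt; apply/orP; left; apply/eqP; ring.
Qed.

Lemma ln_tangentM (g m b c t : R) : g * (m * t + (b - 1) - c) =
  m * (g * t) + (b - 1) * g - g * c.
Proof. by ring. Qed.

Lemma ln_tangent_avg (M m A B l : R) :
  m * (A * M) + (l - 1) * M - B * M = M * (m * A + (l - 1) - ln A) + M * (ln A - B).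
Proof. by ring. Qed.

(** At scale [rad], both the outer Gaussian and the kernel [P_s] with
    [s^2 = rad^2 - a^2] are at least a multiple of [rad^-n] on the ball.  The Jensen
    deficit of [P_s] at [x] is an integral of the nonnegative function
    [h x = u_a / m - 1 - ln (u_a / m)] with [m = u_rad x]; on the ball its mean is at
    least [ln (avg u_a) - avg (ln u_a)], whatever [m] is. *)
Lemma entropy_lower_bound : exists2 K : R, 0 < K &
  forall (D : R) (w : Rn -> R), is_weight w ->
  doubling_bound (weight_measure w) D -> weight_measure w setT != 0%E ->
  forall (x0 : Rn) (rad a : R), 0 < a -> a <= rad / 2 ->
  [/\ mu.-integrable (eball x0 rad) (EFin \o u w a),
      mu.-integrable (eball x0 rad) (EFin \o v w a) &
  ln (avg (u w a) (eball x0 rad)) - avg (v w a) (eball x0 rad) <=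
  K * Num.max 0 (entropy w x0 rad rad - entropy w x0 rad a)].
Proof.
pose p : R := pi `^ (- (n%:R / 2)).
have p0 : 0 < p by rewrite powR_gt0 ?pi_gt0.
pose k : R := (p * expR (- 1)) * (p * expR (- 6)) * ((2 / n.+1%:R) ^+ n) ^+ 2.
have k0 : 0 < k.
  by rewrite !mulr_gt0 ?expR_gt0 ?exprn_gt0 ?divr_gt0 ?ltr0n.
exists k^-1; first by rewrite invr_gt0.
move=> D w ww dw wT x0 rad a a0 arad.
have rad0 : 0 < rad by clear -a0 arad; lra.
have [w0 mw _] := ww.
have gw : gauss_integrable w by exact: doubling_gauss_integrable dw.
set Dl := eball x0 rad.
have mD : measurable Dl by exact: measurable_eball.
have muf : mu Dl \is a fin_num by exact: lebesgue_eball_fin.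
pose M := fine (mu Dl).
have M0 : 0 < M by rewrite fine_gt0// lebesgue_eball_gt0// ltey_eq muf.
have [C C0 HC] := v_growth ww dw wT a0 (lexx a).
have vC y : `|v w a y| <= C * (1 + nsq y).
  by have [] := HC a y (lexx a) (lexx a).
have mua : measurable_fun setT (u w a) by exact: measurable_u.
have mva : measurable_fun setT (v w a) by exact: measurable_v.
have gva : gauss_integrable (v w a) by exact: gauss_integrable_growth (ltW C0) vC.
have u0 y : 0 < u w a y by exact: (u_gt0 ww dw wT).
pose C' := C * (1 + (2 * rad ^+ 2 + 2 * nsq x0)).
(* On the ball, ln u is bounded; this gives all the integrability needed there. *)
have vC' y : Dl y -> `|v w a y| <= C'.
  rewrite /Dl eballE//= => yD; apply: (le_trans (vC y)).
  rewrite ler_wpM2l ?(ltW C0)// lerD2l.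
  have := nsqD_le (y - x0) x0; rewrite subrK => h.
  by apply: (le_trans h); rewrite lerD2r ler_wpM2l// ltW.
have uE y : u w a y = expR (v w a y) by rewrite /v lnK// posrE.
have muD : (mu Dl < +oo)%E by rewrite ltey_eq muf.
have icst r : mu.-integrable Dl (EFin \o (fun=> r)).
  by apply: (@integrable_bounded R n Dl (fun=> r) `|r| mD muD).
have iuD : mu.-integrable Dl (EFin \o u w a).
  apply: (@integrable_bounded R n Dl _ (expR C') mD muD) => //.
    exact: measurable_funTS.
  move=> y Dy; rewrite gtr0_norm// uE ler_expR.
  by apply: (le_trans (ler_norm _)); exact: vC'.
have ivD : mu.-integrable Dl (EFin \o v w a).
  by apply: (@integrable_bounded R n Dl _ C' mD muD) => //; exact: measurable_funTS.
split => //.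
set A := avg (u w a) Dl; set B := avg (v w a) Dl; pose L := ln A - B.
have k_ge0 : 0 <= k^-1 by rewrite invr_ge0 ltW.
have [L0|L0] := leP L 0.
  by apply: (le_trans L0); rewrite mulr_ge0// le_max lexx.
have A0 : 0 < A.
  rewrite /A divr_gt0//; apply: (@lt_le_trans _ _ (expR (- C') * M)).
    by rewrite mulr_gt0// expR_gt0.
  rewrite -(Rintegral_cst mu mD); apply: le_Rintegral => // y Dy.
  rewrite uE ler_expR lerNl; apply: (le_trans (ler_norm _)).
  by rewrite normrN; exact: vC'.
pose s := Num.sqrt (rad ^+ 2 - a ^+ 2).
have s2_ge : 3 / 4 * rad ^+ 2 <= rad ^+ 2 - a ^+ 2.
  have : a ^+ 2 <= (rad / 2) ^+ 2 by rewrite lerXn2r ?nnegrE ?divr_ge0// ltW.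
  by clear; rewrite expr_div_n; lra.
have rad20 : 0 < rad ^+ 2 by rewrite exprn_gt0.
have s20 : 0 < rad ^+ 2 - a ^+ 2 by apply: lt_le_trans s2_ge; clear -rad20; lra.
have s2 : s ^+ 2 = rad ^+ 2 - a ^+ 2 by rewrite sqr_sqrtr// ltW.
have s0 : 0 < s by rewrite sqrtr_gt0.
have s_le : s <= rad.
  rewrite -[leRHS]ger0_norm ?(ltW rad0)// -sqrtr_sqr ler_wsqrtr// gerBl.
  exact: sqr_ge0.
(* The Jensen deficit ln (P_s u_a) - P_s (ln u_a), as P_s u_a = u_rad. *)
pose J x := v w rad x - convolution (@gk R n s) (v w a) x.
have sa : Num.sqrt (s ^+ 2 + a ^+ 2) = rad.
  by rewrite s2 subrK sqrtr_sqr gtr0_norm.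
pose h x y := (u w rad x)^-1 * u w a y + (ln (u w rad x) - 1) - v w a y.
have m0 x : 0 < u w rad x by exact: (u_gt0 ww dw wT).
have h0 x y : 0 <= h x y.
  exact: ln_tangent.
have iu_ x : mu.-integrable setT (fun y => (gk s (x - y) * u w a y)%:E).
  by have [] := gauss_semigroup x s0 a0 mw gw.
have uS x : convolution (@gk R n s) (u w a) x = u w rad x.
  by have [_] := gauss_semigroup x s0 a0 mw gw; rewrite sa.
have iv_ x := integrable_gk_mul x s0 mva gva.
have ig_ (x : Rn) := integrable_gk x s0.
have ih_ x : mu.-integrable setT (EFin \o (fun y => gk s (x - y) * h x y)) /\
    \int[mu]_y (gk s (x - y) * h x y) = J x.
  pose f1 y := (u w rad x)^-1 * (gk s (x - y) * u w a y).
  pose f2 y := (ln (u w rad x) - 1) * gk s (x - y).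
  pose f3 y := gk s (x - y) * v w a y.
  have i1 : mu.-integrable setT (EFin \o f1) by exact: (integrableZl measurableT _ (iu_ x)).
  have i2 : mu.-integrable setT (EFin \o f2) by exact: (integrableZl measurableT _ (ig_ x)).
  have i12 : mu.-integrable setT (EFin \o (fun y => f1 y + f2 y)).
    exact: (integrableD measurableT i1 i2).
  have E : (fun y => gk s (x - y) * h x y) = (fun y => f1 y + f2 y - f3 y).
    by apply/funext => y; exact: ln_tangentM.
  rewrite E; split; first exact: (integrableB measurableT i12 (iv_ x)).
  rewrite (RintegralB measurableT i12 (iv_ x)) (RintegralD measurableT i1 i2).
  rewrite (RintegralZl _ measurableT (iu_ x)) (RintegralZl _ measurableT (ig_ x)).
  rewrite Rintegral_gk// mulr1 -[\int[mu]_y _]/(convolution (@gk R n s) (u w a) x) uS.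
  rewrite mulVf ?gt_eqF// /J /v -/(convolution _ _ _).
  by rewrite [1 + _]addrC subrK.
have J0 x : 0 <= J x.
  have [_ <-] := ih_ x; apply: Rintegral_ge0 => y _; rewrite mulr_ge0//.
  exact: gk_ge0.
(* A lower bound of the kernel at scale s between points of the ball:
   |x - y|^2 <= 4 rad^2 and s^2 >= 3/4 rad^2 give an exponent of at least -6. *)
pose q := p * rad ^- n * expR (- 6).
have q0 : 0 < q by rewrite !mulr_gt0 ?expR_gt0// invr_gt0 exprn_gt0.
have JL x : Dl x -> q * M * L <= J x.
  move=> Dx; have [ih <-] := ih_ x.
  apply: le_trans (Rintegral_subset_le mD _ ih); last first.
    by move=> y; rewrite mulr_ge0// gk_ge0.
  have i1 : mu.-integrable Dl (EFin \o (fun y => (u w rad x)^-1 * u w a y)).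
    exact: (integrableZl mD _ iuD).
  have i12 : mu.-integrable Dl (EFin \o (fun y => (u w rad x)^-1 * u w a y + (ln (u w rad x) - 1))).
    exact: (integrableD mD i1 (icst _)).
  have iDh : mu.-integrable Dl (EFin \o h x) by exact: (integrableB mD i12 ivD).
  apply: (@le_trans _ _ (q * \int[mu]_(y in Dl) h x y)).
    rewrite -mulrA (ler_wpM2l (ltW q0))//.
    rewrite /h (RintegralB mD i12 ivD) (RintegralD mD i1 (icst _)).
    rewrite (RintegralZl _ mD iuD) (Rintegral_cst mu mD) -/M.
    have -> : \int[mu]_(y in Dl) u w a y = A * M by rewrite /A /avg divfK// gt_eqF.
    have -> : \int[mu]_(y in Dl) v w a y = B * M by rewrite /B /avg divfK// gt_eqF.
    rewrite ln_tangent_avg mulrC lerDr; apply: mulr_ge0; first exact: ltW.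
    exact: ln_tangent.
  rewrite -(RintegralZl _ mD iDh).
  apply: le_Rintegral => //.
  - exact: (integrableZl mD _ iDh).
  - by apply: (integrableS measurableT mD) ih.
  move=> y Dy; rewrite ler_wpM2r//.
  rewrite gkE -/p /q; apply: ler_pM.
  - by rewrite mulr_ge0 ?(ltW p0)// invr_ge0 exprn_ge0// ltW.
  - exact: expR_ge0.
  - by rewrite (ler_wpM2l (ltW p0))// invX_le.
  rewrite ler_expR mulNr lerN2 ler_pdivrMr ?exprn_gt0// s2.
  have d : nsq (x - y) <= 4 * rad ^+ 2.
    have := nsqD_le (x - x0) (x0 - y); rewrite addrA subrK (nsqBC x0 y).
    move: Dx Dy; rewrite /Dl !eballE//= => Dx Dy h1; apply: (le_trans h1).
    by move: (nsq (x - x0)) (nsq (y - x0)) Dx Dy => b c; clear; lra.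
  apply: (le_trans d); move: s2_ge; clear -rad20; lra.
have rho_rad : rho rad rad = rad.
  by rewrite /rho (_ : _ - _ = rad ^+ 2) ?sqrtr_sqr ?gtr0_norm//; ring.
have rho_a : rho rad a = Num.sqrt (rad ^+ 2 + s ^+ 2).
  by rewrite /rho s2; congr Num.sqrt; ring.
have ev t f : \int[mu]_y (gk t (y - x0) * f y) = convolution (@gk R n t) f x0.
  by apply: eq_Rintegral => y _; rewrite -opprB gkN.
have radhalf : rad <= 2 * rad by clear -rad0; lra.
have gvr : gauss_integrable (v w rad).
  have [E E0 HE] := v_growth ww dw wT rad0 (lexx rad).
  apply: gauss_integrable_growth (ltW E0) _; first exact: measurable_v.
  by move=> y; have [] := HE rad y (lexx rad) (lexx rad).
have ivr := integrable_gk_mul x0 rad0 (measurable_v ww rad) gvr.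
have [ivs vS] := gauss_semigroup x0 rad0 s0 mva gva.
have iJ : mu.-integrable setT (EFin \o (fun x => gk rad (x0 - x) * J x)).
  rewrite (_ : EFin \o _ = (fun x : Rn => (gk rad (x0 - x) * v w rad x)%:E -
    (gk rad (x0 - x) * convolution (@gk R n s) (v w a) x)%:E)%E); last first.
    by apply/funext => x; rewrite /= /J mulrBr EFinB.
  exact: (integrableB measurableT ivr ivs).
have diff : entropy w x0 rad rad - entropy w x0 rad a = \int[mu]_x (gk rad (x0 - x) * J x).
  have e1 : entropy w x0 rad rad = \int[mu]_x (gk rad (x0 - x) * v w rad x).
    by rewrite /entropy rho_rad; exact: (ev rad (v w rad)).
  have e2 : entropy w x0 rad a =
      \int[mu]_x (gk rad (x0 - x) * convolution (@gk R n s) (v w a) x).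
    apply: etrans (esym vS); rewrite /entropy rho_a; exact: (ev _ (v w a)).
  rewrite e1 e2 -(RintegralB measurableT ivr ivs).
  by apply: eq_Rintegral => x _; exact/esym/mulrBr.
rewrite -/L diff mulrC -ler_pdivrMr ?invr_gt0// invrK le_max; apply/orP; right.
apply: le_trans (Rintegral_subset_le mD _ iJ); last first.
  by move=> x; rewrite mulr_ge0// gk_ge0.
pose z := p * rad ^- n * expR (- 1).
have z0 : 0 < z by rewrite !mulr_gt0 ?expR_gt0// invr_gt0 exprn_gt0.
apply: (@le_trans _ _ (\int[mu]_(x in Dl) (z * (q * M * L)))); last first.
  apply: le_Rintegral => //; first by apply: (integrableS measurableT mD) iJ.
  move=> x Dx; apply: ler_pM => //.
  - exact: ltW.
  - by apply: mulr_ge0; [apply: mulr_ge0; exact: ltW|exact: ltW].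
  - rewrite gkE -/p /z ler_wpM2l ?mulr_ge0 ?(ltW p0) ?invr_ge0 ?exprn_ge0 ?(ltW rad0)//.
    rewrite ler_expR mulNr lerN2 ler_pdivrMr// mul1r.
    by move: Dx; rewrite /Dl eballE//= nsqBC => /ltW.
  - exact: JL.
rewrite (Rintegral_cst mu mD) -/M.
have Mge : (2 * rad / n.+1%:R) ^+ n <= M.
  by have := lebesgue_eball_ge x0 rad0; rewrite -(fineK muf) lee_fin.
have N0 : 0 <= (2 * rad / n.+1%:R) ^+ n.
  by rewrite exprn_ge0// divr_ge0// mulr_ge0// ltW.
rewrite [leRHS](_ : _ = z * q * M ^+ 2 * L); last first.
  by rewrite expr2 !mulrA (mulrAC _ L).
rewrite mulrC (ler_wpM2r (ltW L0))//.
apply: (@le_trans _ _ (z * q * ((2 * rad / n.+1%:R) ^+ n) ^+ 2)).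
  rewrite /k /z /q le_eqVlt; apply/orP; left; apply/eqP.
  rewrite !expr_div_n !exprMn.
  have : rad ^+ n != 0 by rewrite expf_neq0// gt_eqF.
  have : n.+1%:R ^+ n != 0 :> R by rewrite expf_neq0// pnatr_eq0.
  by move: (rad ^+ n) (n.+1%:R ^+ n) (2 ^+ n) => X Y Z Y0 X0; field; rewrite X0 Y0.
apply: ler_wpM2l; first by apply: mulr_ge0; exact: ltW.
by rewrite lerXn2r ?nnegrE// ltW.
Qed.

End lower_bound.

(** * Convergence of the heat extension to the weight *)

Section density.
Context {R : realType} (n : nat).
Local Notation Rn := 'rV[R]_n.
Local Notation mu := (@lebesgue_rV R n).

(** A reference weight that dominates, up to a constant, the heat kernels of all
    scales between 1 and [sqrt 2]. *)
Definition gauss_wt (y : Rn) : R := expR (- (2^-1 * nsq y)).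

Lemma gauss_wt_ge0 y : 0 <= gauss_wt y.
Proof. exact: expR_ge0. Qed.

Lemma measurable_gauss_wt : measurable_fun setT gauss_wt.
Proof.
apply: measurableT_comp => //; apply: measurableT_comp => //.
by apply: measurable_funM => //; exact: measurable_nsq.
Qed.

Definition gauss_dist (f g : Rn -> R) : \bar R :=
  (\int[mu]_y (`|f y - g y| * gauss_wt y)%:E)%E.

Lemma measurable_dist (f g : Rn -> R) : measurable_fun setT f ->
  measurable_fun setT g ->
  measurable_fun setT (fun y : Rn => (`|f y - g y| * gauss_wt y)%:E).
Proof.
move=> mf mg; apply/measurable_EFinP/measurable_funM.
  by apply: measurableT_comp => //; exact: measurable_funB.
exact: measurable_gauss_wt.
Qed.

Lemma gauss_dist_ge0 f g : (0 <= gauss_dist f g)%E.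
Proof. by apply: integral_ge0 => y _; rewrite lee_fin mulr_ge0// gauss_wt_ge0. Qed.

Lemma gauss_dist_leD (F f g h k : Rn -> R) : measurable_fun setT F ->
  measurable_fun setT f -> measurable_fun setT g ->
  measurable_fun setT h -> measurable_fun setT k ->
  (forall y, `|F y| <= `|f y - g y| + `|h y - k y|) ->
  (\int[mu]_y (`|F y| * gauss_wt y)%:E <= gauss_dist f g + gauss_dist h k)%E.
Proof.
move=> mF mf mg mh mk H; rewrite /gauss_dist -ge0_integralD//.
- apply: ge0_le_integral => //.
  + by move=> y _; rewrite lee_fin mulr_ge0// gauss_wt_ge0.
  + apply/measurable_EFinP/measurable_funM; last exact: measurable_gauss_wt.
    exact: measurableT_comp.
  + by apply: emeasurable_funD; exact: measurable_dist.
  + by move=> y _; rewrite -EFinD lee_fin -mulrDl ler_wpM2r// gauss_wt_ge0.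
- by move=> y _; rewrite lee_fin mulr_ge0// gauss_wt_ge0.
- exact: measurable_dist.
- by move=> y _; rewrite lee_fin mulr_ge0// gauss_wt_ge0.
- exact: measurable_dist.
Qed.

(** One constant bounds both the function and its Lipschitz seminorm for the
    Euclidean distance. *)
Definition bounded_lipschitz (h : Rn -> R) := measurable_fun setT h /\
  exists2 B, 0 <= B & (forall x, `|h x| <= B) /\
    forall x y, `|h x - h y| <= B * Num.sqrt (nsq (x - y)).

(** Membership in the closure, in [L^1] of the Gaussian weight, of the bounded
    Lipschitz functions.  It contains all integrable nonnegative functions
    ([lip_dense_ge0]). *)
Definition lip_dense (f : Rn -> R) := measurable_fun setT f /\
  forall e, 0 < e -> exists2 h, bounded_lipschitz h & (gauss_dist f h <= e%:E)%E.

Lemma bounded_lipschitz_dense h : bounded_lipschitz h -> lip_dense h.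
Proof.
move=> bh; split; first by have [] := bh.
move=> e e0; exists h => //; rewrite /gauss_dist.
under eq_integral do rewrite subrr normr0 mul0r.
by rewrite integral0 lee_fin ltW.
Qed.

Lemma bounded_lipschitz_cst (c : R) : bounded_lipschitz (fun=> c).
Proof.
split => //; exists `|c| => //; split => // x y.
by rewrite subrr normr0 mulr_ge0// sqrtr_ge0.
Qed.

(** Shared by the sum, the difference and the maximum, which [lip_dense2] treats
    together, and by the minimum, used for [clamp]. *)
Definition nonexp2 (F : R -> R -> R) :=
  forall a b c d, `|F a b - F c d| <= `|a - c| + `|b - d|.

Lemma lip_dense2 (F : R -> R -> R) f g : nonexp2 F -> F 0 0 = 0 ->
  (forall f g : Rn -> R, measurable_fun setT f -> measurable_fun setT g ->
    measurable_fun setT (fun x => F (f x) (g x))) ->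
  lip_dense f -> lip_dense g -> lip_dense (fun x => F (f x) (g x)).
Proof.
move=> HF F0 mF [mf df] [mg dg]; split; first exact: mF.
move=> e e0; have e20 : 0 < e / 2 by rewrite divr_gt0.
have [h bh fh] := df _ e20; have [k bk gk_] := dg _ e20.
have [mh [B B0 [hB hL]]] := bh; have [mk [C C0 [kC kL]]] := bk.
exists (fun x => F (h x) (k x)).
  split; first exact: mF.
  exists (B + C); first exact: addr_ge0.
  split=> [x|x y].
    have := HF (h x) (k x) 0 0; rewrite F0 !subr0 => /le_trans; apply.
    exact: lerD.
  by apply: (le_trans (HF _ _ _ _)); rewrite mulrDl lerD.
rewrite [X in (_ <= X%:E)%E](splitr e) EFinD.
apply: (@le_trans _ _ (gauss_dist f h + gauss_dist g k)%E); last exact: leeD.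
apply: gauss_dist_leD => //.
by apply: measurable_funB; exact: mF.
Qed.

Lemma lip_denseZ c f : lip_dense f -> lip_dense (fun x => c * f x).
Proof.
move=> [mf df]; split; first exact: measurable_funM.
move=> e e0; have c0 : 0 < `|c| + 1 by rewrite ltr_wpDl.
have [h bh fh] := df _ (divr_gt0 e0 c0).
have [mh [B B0 [hB hL]]] := bh.
exists (fun x => c * h x).
  split; first exact: measurable_funM.
  exists (`|c| * B); first exact: mulr_ge0.
  split=> [x|x y]; first by rewrite normrM ler_wpM2l.
  by rewrite -mulrBr normrM -mulrA ler_wpM2l.
have -> : gauss_dist (fun x => c * f x) (fun x => c * h x) = (`|c|%:E * gauss_dist f h)%E.
  rewrite /gauss_dist -ge0_integralZl//.
  - by apply: eq_integral => y _; rewrite -mulrBr normrM -EFinM mulrA.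
  - exact: measurable_dist.
  - by move=> y _; rewrite lee_fin mulr_ge0// gauss_wt_ge0.
apply: (@le_trans _ _ ((`|c| + 1)%:E * (e / (`|c| + 1))%:E)%E); last first.
  by rewrite -EFinM mulrC divfK// gt_eqF.
apply: lee_pmul => //; last by rewrite lee_fin lerDl.
exact: gauss_dist_ge0.
Qed.

Lemma nonexp2D : nonexp2 (fun a b => a + b).
Proof. by move=> a b c d; rewrite opprD addrACA; exact: ler_normD. Qed.

Lemma nonexp2B : nonexp2 (fun a b => a - b).
Proof.
move=> a b c d; rewrite (_ : _ - _ = (a - c) - (b - d)); first exact: ler_normB.
by ring.
Qed.

Lemma nonexp2_max : nonexp2 (fun a b : R => Num.max a b).
Proof.
move=> a b c d; rewrite ler_norml !maxEle.
have := ler_norm (a - c); have := ler_norm (c - a).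
have := ler_norm (b - d); have := ler_norm (d - b).
rewrite (distrC c a) (distrC d b); move: `|a - c| (normr_ge0 (a - c)) `|b - d| (normr_ge0 (b - d)) => p p0 q q0 h1 h2 h3 h4.
by case: (leP a b) => ?; case: (leP c d) => ?; apply/andP; split; lra.
Qed.

Lemma nonexp2_min : nonexp2 (fun a b : R => Num.min a b).
Proof.
move=> a b c d; rewrite ler_norml !minEle.
have := ler_norm (a - c); have := ler_norm (c - a).
have := ler_norm (b - d); have := ler_norm (d - b).
rewrite (distrC c a) (distrC d b); move: `|a - c| (normr_ge0 (a - c)) `|b - d| (normr_ge0 (b - d)) => p p0 q q0 h1 h2 h3 h4.
by case: (leP a b) => ?; case: (leP c d) => ?; apply/andP; split; lra.
Qed.

Lemma lip_denseD f g : lip_dense f -> lip_dense g -> lip_dense (fun x => f x + g x).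
Proof.
apply: (lip_dense2 nonexp2D); first by rewrite addr0.
by move=> *; exact: measurable_funD.
Qed.

Lemma lip_denseB f g : lip_dense f -> lip_dense g -> lip_dense (fun x => f x - g x).
Proof.
apply: (lip_dense2 nonexp2B); first by rewrite subr0.
by move=> *; exact: measurable_funB.
Qed.

Lemma lip_dense_max f g : lip_dense f -> lip_dense g ->
  lip_dense (fun x => Num.max (f x) (g x)).
Proof.
apply: (lip_dense2 nonexp2_max); first by rewrite maxxx.
by move=> *; exact: measurable_maxr.
Qed.

(** By dominated convergence the [f_ k] tend to [f] in the weighted [L^1] norm, and
    each of them is close to a bounded Lipschitz function. *)
Lemma lip_dense_cvg (f_ : nat -> Rn -> R) (f G : Rn -> R) : (forall k, lip_dense (f_ k)) ->
  measurable_fun setT f -> (forall y, f_ k y @[k --> \oo] --> f y) ->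
  (forall k y, `|f_ k y| <= G y) ->
  mu.-integrable setT (fun y => (gauss_wt y * G y)%:E) -> lip_dense f.
Proof.
move=> df mf ff fG iG; split => // e e0.
have e20 : 0 < e / 2 by rewrite divr_gt0.
have mf_ k : measurable_fun setT (f_ k) by have [] := df k.
have h1 k : measurable_fun setT (fun y : Rn => (gauss_wt y * f_ k y)%:E).
  by apply/measurable_EFinP/measurable_funM => //; exact: measurable_gauss_wt.
have h2 : measurable_fun setT (fun y : Rn => (gauss_wt y * f y)%:E).
  by apply/measurable_EFinP/measurable_funM => //; exact: measurable_gauss_wt.
have h3 : {ae mu, forall y, setT y ->
    (gauss_wt y * f_ k y)%:E @[k --> \oo] --> (gauss_wt y * f y)%:E}.
  by apply: aeW => y _; apply: cvg_EFin; [exact: nearW|apply: cvgMr; exact: ff].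
have h4 : {ae mu, forall y k, setT y ->
    (`|(gauss_wt y * f_ k y)%:E| <= (gauss_wt y * G y)%:E)%E}.
  apply: aeW => y k _; rewrite abse_EFin lee_fin normrM ger0_norm ?gauss_wt_ge0//.
  by rewrite ler_wpM2l// gauss_wt_ge0.
have [_ + _] := dominated_convergence measurableT h1 h2 h3 iG h4.
rewrite (_ : [sequence _]_k = (fun k => gauss_dist f (f_ k))); last first.
  apply/funext => k; apply: eq_integral => y _.
  rewrite -EFinB -mulrBr abse_EFin normrM ger0_norm ?gauss_wt_ge0//.
  by rewrite mulrC distrC.
move=> /fine_cvgP[fin /cvgrPdist_le /(_ _ e20) dist0].
have [k [fk dk]] := filter_ex (filterI fin dist0).
have {}dk : (gauss_dist f (f_ k) <= (e / 2)%:E)%E.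
  rewrite -(fineK fk) lee_fin; move: dk; rewrite /= sub0r normrN.
  exact: le_trans (ler_norm _).
have [h bh kh] := (df k).2 _ e20; exists h => //.
rewrite [X in (_ <= X%:E)%E](splitr e) EFinD.
apply: (@le_trans _ _ (gauss_dist f (f_ k) + gauss_dist (f_ k) h)%E); last exact: leeD.
have mh : measurable_fun setT h by have [] := bh.
apply: gauss_dist_leD => //; first exact: measurable_funB.
by move=> y; exact: ler_distD.
Qed.

Definition lip_dense_set (A : set Rn) := measurable A /\ lip_dense (\1_A : Rn -> R).

Lemma integrable_gauss_wt (c : R) : mu.-integrable setT (fun y => (gauss_wt y * c)%:E).
Proof.
have h0 : 0 < 2^-1 :> R by rewrite invr_gt0.
rewrite (_ : (fun y => _) = EFin \o (fun y => c * expR (- (2^-1 * nsq y)))).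
  exact: integrable_expR_nsq.
by apply/funext => y /=; rewrite mulrC.
Qed.

Lemma lip_dense_indic (F : nat -> Rn -> R) (A : set Rn) :
  (forall k, lip_dense (F k)) -> measurable A ->
  (forall k y, 0 <= F k y <= 1) ->
  (forall y, A y -> \forall k \near \oo, F k y = 1) ->
  (forall y k, ~ A y -> F k y = 0) -> lip_dense_set A.
Proof.
move=> dF mA F01 F1 F0; split => //.
apply: (@lip_dense_cvg F _ (fun=> 1)) => //.
- move=> y; rewrite indicE; have [|] := boolP (y \in A).
    by move=> /set_mem Ay; apply: cvg_near_cst; exact: F1.
  move=> /negP yA; rewrite (_ : (fun k => F k y) = (fun=> 0)); first exact: cvg_cst.
  by apply/funext => k; apply: F0 => Ay; apply: yA; exact: mem_set.
- by move=> k y; have /andP[h0 h1] := F01 k y; rewrite ger0_norm.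
- exact: integrable_gauss_wt.
Qed.

Lemma lip_dense_set0 : lip_dense_set set0.
Proof.
split => //; rewrite indic0; apply: bounded_lipschitz_dense; exact: bounded_lipschitz_cst.
Qed.

Lemma lip_dense_setC A : lip_dense_set A -> lip_dense_set (~` A).
Proof.
move=> [mA dA]; split; first exact: measurableC.
rewrite (_ : \1_ _ = (fun y => 1 - \1_A y)).
  by apply: lip_denseB => //; apply: bounded_lipschitz_dense; exact: bounded_lipschitz_cst.
by apply/funext => y; rewrite !indicE in_setC; case: (y \in A); rewrite ?subrr ?subr0.
Qed.

Lemma lip_dense_setU A B : lip_dense_set A -> lip_dense_set B -> lip_dense_set (A `|` B).
Proof.
move=> [mA dA] [mB dB]; split; first exact: measurableU.
rewrite (_ : \1_ _ = (fun y => Num.max (\1_A y) (\1_B y))).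
  exact: lip_dense_max.
apply/funext => y; rewrite !indicE in_setU.
by case: (y \in A); case: (y \in B); rewrite /= ?maxxx// ?(max_l ler01) ?(max_r ler01).
Qed.

Lemma lip_dense_set_bigcup (A : (set Rn)^nat) : (forall k, lip_dense_set (A k)) ->
  lip_dense_set (\bigcup_k A k).
Proof.
move=> dA; pose U k := \big[setU/set0]_(i < k) A i.
have dU k : lip_dense_set (U k).
  rewrite /U; elim/big_ind: _ => //; first exact: lip_dense_set0.
  exact: lip_dense_setU.
apply: (@lip_dense_indic (fun k => \1_(U k))).
- by move=> k; have [] := dU k.
- by apply: bigcupT_measurable => k; have [] := dA k.
- by move=> k y; rewrite indicE; case: (_ \in _); rewrite /= ?lexx ?ler01.
- move=> y [i _ Aiy]; exists i.+1 => // k /= ik.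
  rewrite indicE mem_set// /U -(bigcup_mkord k A); exists i => //=.
- move=> y k nA; rewrite indicE memNset// /U -(bigcup_mkord k A) => -[i _ Aiy].
  by apply: nA; exists i.
Qed.

(** Truncation to the unit interval; [clamp (k * (t - c))] increases to the indicator of
    the open ray beyond [c] as [k] grows. *)
Definition clamp (s : R) : R := Num.min 1 (Num.max 0 s).

Lemma clamp_lip s t : `|clamp s - clamp t| <= `|s - t|.
Proof.
apply: (le_trans (nonexp2_min 1 _ 1 _)); rewrite subrr normr0 add0r.
by apply: (le_trans (nonexp2_max 0 _ 0 _)); rewrite subrr normr0 add0r.
Qed.

Lemma clamp01 s : 0 <= clamp s <= 1.
Proof. by rewrite /clamp le_min ler01 ge_min lexx le_max lexx. Qed.

Lemma bounded_lipschitz_clamp i (t k : R) : 0 <= k -> bounded_lipschitz (fun y => clamp (k * (y 0 i - t))).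
Proof.
move=> k0; split.
  apply: measurable_minr => //; apply: measurable_maxr => //.
  apply: measurable_funM => //; apply: measurable_funB => //.
  exact: measurable_coord.
exists (1 + k); first exact: addr_ge0.
split=> [x|x y].
  by have /andP[h0 h1] := clamp01 (k * (x 0 i - t)); rewrite ger0_norm// (le_trans h1)// lerDl.
apply: (le_trans (clamp_lip _ _)).
rewrite -mulrBr normrM ger0_norm// mulrDl; apply: ler_wpDl.
  by rewrite mul1r sqrtr_ge0.
rewrite ler_wpM2l// opprB addrA subrK -sqrtr_sqr ler_wsqrtr//.
by have := coord_le_nsq (x - y) i; rewrite !mxE.
Qed.

Lemma lip_dense_set_ray i t : lip_dense_set (coord_rV i @^-1` `]t, +oo[%classic).
Proof.
apply: (@lip_dense_indic (fun k y => clamp (k%:R * (y 0 i - t)))).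
- by move=> k; apply: bounded_lipschitz_dense; exact: bounded_lipschitz_clamp.
- by rewrite -[X in measurable X]setTI; apply: measurable_coord_rV.
- by move=> k y; exact: clamp01.
- move=> y /=; rewrite in_itv/= andbT /coord_rV => ty.
  have d0 : 0 < y 0 i - t by rewrite subr_gt0.
  near=> k; rewrite /clamp min_l// le_max; apply/orP; right.
  rewrite -ler_pdivrMr// div1r; near: k; exact: nbhs_infty_ger.
- move=> y k /=; rewrite in_itv/= andbT /coord_rV => /negP; rewrite -leNgt => yt.
  rewrite /clamp max_l ?min_r// mulr_ge0_le0// subr_le0//.
Unshelve. all: by end_near. Qed.

(** The sets whose indicator is in the class form a sigma-algebra; it contains the
    half spaces bounded by coordinate hyperplanes, hence all measurable sets. *)
Lemma lip_dense_set_measurable A : measurable A -> lip_dense_set A.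
Proof.
suff : g_sigma_preimage (@coord_rV R n) `<=` lip_dense_set by exact.
apply: smallest_sub.
  split; first exact: lip_dense_set0.
    by move=> B dB; rewrite setTD; exact: lip_dense_setC.
  exact: lip_dense_set_bigcup.
move=> B; rewrite -bigcup_seq => -[i _ [C mC <-]] /=; rewrite setTI.
suff : <<s @RGenOInfty.G R >> `<=` [set C | lip_dense_set (coord_rV i @^-1` C)].
  by apply; rewrite -[<<s _ >>]/(measurable : set (set (g_sigma_algebraType (@RGenOInfty.G R)))) -RGenOInfty.measurableE.
apply: smallest_sub.
  split => /=; first by rewrite preimage_set0; exact: lip_dense_set0.
    by move=> E dE; rewrite setTD -preimage_setC; exact: lip_dense_setC.
  by move=> F dF; rewrite preimage_bigcup; exact: lip_dense_set_bigcup.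
by move=> E [t ->] /=; exact: lip_dense_set_ray.
Qed.

Import HBSimple HBNNSimple.

Lemma lip_dense_sfun (f : {nnsfun Rn >-> R}) : lip_dense f.
Proof.
have H (s : seq R) : lip_dense (fun x => \sum_(y <- s) (y * \1_(f @^-1` [set y]) x)).
  elim: s => [|y s IH].
    rewrite (_ : (fun x => _) = (fun=> 0)); first exact/bounded_lipschitz_dense/bounded_lipschitz_cst.
    by apply/funext => x; rewrite big_nil.
  rewrite (_ : (fun x => _) = (fun x => y * \1_(f @^-1` [set y]) x +
    \sum_(z <- s) (z * \1_(f @^-1` [set z]) x))).
    apply: lip_denseD => //; apply: lip_denseZ.
    by have [] := @lip_dense_set_measurable (f @^-1` [set y]) (measurable_sfunP f (measurable_set1 y)).
  by apply/funext => x; rewrite big_cons.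
apply: (eq_ind _ lip_dense (H (finmap.enum_fset (fset_set (range f))))).
by apply/funext => x; rewrite [RHS]fimfunE fsbig_finite.
Qed.

Lemma lip_dense_ge0 (f : Rn -> R) : measurable_fun setT f -> (forall y, 0 <= f y) ->
  mu.-integrable setT (fun y => (gauss_wt y * f y)%:E) -> lip_dense f.
Proof.
move=> mf f0 If.
have mEf : measurable_fun setT (EFin \o f) by exact/measurable_EFinP.
pose F k := nnsfun_approx measurableT mEf k.
have cvF y : EFin \o (fun k => F k y) @ \oo --> (f y)%:E.
  by apply: (cvg_nnsfun_approx measurableT mEf) => // z _; rewrite lee_fin.
apply: (@lip_dense_cvg F f f) => //.
- by move=> k; exact: lip_dense_sfun.
- by move=> y; have /fine_cvgP[_] := cvF y.
- move=> k y; rewrite ger0_norm//.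
  have nd : nondecreasing_seq (fun k => F k y).
    by move=> a b ab; exact/(lefP _ _ (nd_nnsfun_approx measurableT mEf ab)).
  have /fine_cvgP[_ cF] := cvF y.
  rewrite -(cvg_lim (@Rhausdorff R) cF); apply: nondecreasing_cvgn_le => //.
  by apply/cvg_ex; exists (f y).
Qed.

Lemma bounded_lipschitz_gauss_integrable h : bounded_lipschitz h -> gauss_integrable h.
Proof.
move=> [mh [B B0 [hB _]]] kappa k0.
apply: (integrable_le_expR (C := B) k0).
  apply: measurable_funM => //; apply: measurableT_comp => //.
  by apply: measurableT_comp => //; apply: measurable_funM => //; exact: measurable_nsq.
by move=> y; rewrite normrM (ger0_norm (expR_ge0 _)) mulrC ler_wpM2r ?expR_ge0.
Qed.

(** An inequality of arithmetic and geometric means that trades the distance for its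
    square, which the Gaussian absorbs. *)
Lemma sqrt_le_absorb (s a : R) : 0 < a -> 0 <= s -> Num.sqrt s <= a * (1 + s / a ^+ 2).
Proof.
move=> a0 s0; rewrite -[in leRHS](sqr_sqrtr s0); move: (Num.sqrt s) (sqrtr_ge0 s) => t t0.
rewrite (_ : a * _ = a + t ^+ 2 / a); last by field; rewrite gt_eqF.
rewrite -subr_ge0 (_ : _ - _ = ((t - a) ^+ 2 + t * a) / a); last first.
  by field; rewrite gt_eqF.
by rewrite divr_ge0 ?(ltW a0)// addr_ge0 ?sqr_ge0// mulr_ge0// ltW.
Qed.

(** The kernel at scale [a] lives at distances of order [a]. *)
Lemma gk_sqrt_le (a : R) (x : Rn) : 0 < a ->
  gk a x * Num.sqrt (nsq x) <= 3 * Num.sqrt 2 ^+ n * a * gk (Num.sqrt 2 * a) x.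
Proof.
move=> a0; have s20 : 0 < Num.sqrt 2 :> R by rewrite sqrtr_gt0.
apply: (@le_trans _ _ (gk a x * (a * (1 + nsq x / a ^+ 2)))).
  by rewrite ler_wpM2l ?gk_ge0// sqrt_le_absorb// nsq_ge0.
rewrite !gkE; set p := pi `^ _.
have p0 : 0 < p by rewrite powR_gt0 ?pi_gt0.
set s := nsq x / a ^+ 2.
have s0 : 0 <= s by rewrite divr_ge0 ?nsq_ge0// exprn_ge0// ltW.
have := @expR_absorb R s 1 s0 ltr01; rewrite mul1r div1r => h.
have -> : - nsq x / a ^+ 2 = - s by rewrite mulNr.
have -> : - nsq x / (Num.sqrt 2 * a) ^+ 2 = - (2^-1 * s).
  by rewrite exprMn sqr_sqrtr// /s mulNr invfM mulrCA.
rewrite exprMn invfM.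
have E : p * a ^- n * expR (- s) * (a * (1 + s)) = p * a ^- n * a * ((1 + s) * expR (- s)).
  by move: (expR _) (a ^- n) => ? ?; ring.
rewrite E.
have z0 : Num.sqrt 2 ^+ n != 0 :> R by rewrite expf_neq0// gt_eqF.
rewrite (_ : 3 * _ * a * _ = p * a ^- n * a * (3 * expR (- (2^-1 * s)))); last first.
  move: (expR _) (a ^- n) (Num.sqrt 2 ^+ n) z0 => ? ? z z0.
  by field.
rewrite ler_wpM2l//; last by rewrite (le_trans h)// ler_wpM2r ?expR_ge0//; lra.
by rewrite !mulr_ge0// ?(ltW p0) ?(ltW a0)// invr_ge0 exprn_ge0// ltW.
Qed.

(** The average of [h] at scale [a] differs from [h] by at most the Lipschitz constant
    times the mean distance for the kernel. *)
Lemma bounded_lipschitz_conv h : bounded_lipschitz h -> exists2 C, 0 <= C &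
  forall a y, 0 < a -> `|convolution (@gk R n a) h y - h y| <= C * a.
Proof.
move=> bh; have [mh [B B0 [hB hL]]] := bh.
have s20 : 0 < Num.sqrt 2 :> R by rewrite sqrtr_gt0.
pose c := 3 * Num.sqrt 2 ^+ n : R.
have c0 : 0 <= c by rewrite mulr_ge0// exprn_ge0// ltW.
exists (B * c); first exact: mulr_ge0.
move=> a y a0.
have i1 := integrable_gk_mul y a0 mh (bounded_lipschitz_gauss_integrable bh).
have ig := integrable_gk y a0.
have i2 : mu.-integrable setT (EFin \o (fun z => h y * gk a (y - z))).
  exact: (integrableZl measurableT _ ig).
have E : convolution (@gk R n a) h y - h y = \int[mu]_z (gk a (y - z) * h z - h y * gk a (y - z)).
  by rewrite (RintegralB measurableT i1 i2) (RintegralZl _ measurableT ig) Rintegral_gk// mulr1.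
have i3 : mu.-integrable setT (EFin \o (fun z => gk a (y - z) * h z - h y * gk a (y - z))).
  exact: (integrableB measurableT i1 i2).
have s2a : 0 < Num.sqrt 2 * a by rewrite mulr_gt0.
rewrite E; apply: (le_trans (le_normr_Rintegral measurableT i3)).
have -> : B * c * a = \int[mu]_z (B * (c * a) * gk (Num.sqrt 2 * a) (y - z)).
  by rewrite (RintegralZl _ measurableT (integrable_gk y s2a)) Rintegral_gk// mulr1; exact/esym/mulrA.
apply: le_Rintegral => //.
- exact: integrable_norm i3.
- exact: (integrableZl measurableT _ (integrable_gk y s2a)).
move=> z _; rewrite (_ : _ - _ = gk a (y - z) * (h z - h y)); last first.
  by rewrite mulrBr (mulrC (h y)).
rewrite normrM (ger0_norm (gk_ge0 _ a0)).
apply: (@le_trans _ _ (gk a (y - z) * (B * Num.sqrt (nsq (y - z))))).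
  by rewrite ler_wpM2l ?gk_ge0// distrC.
by rewrite mulrCA -mulrA ler_wpM2l// gk_sqrt_le.
Qed.

Lemma gk_le_gauss_wt (r : R) (y : Rn) : 1 <= r -> r ^+ 2 <= 2 ->
  gk r (0 - y) <= pi `^ (- (n%:R / 2)) * gauss_wt y.
Proof.
move=> r1 r2; have r0 : 0 < r by apply: lt_le_trans r1.
have p0 : 0 < pi `^ (- (n%:R / 2)) :> R by rewrite powR_gt0 ?pi_gt0.
rewrite gkE sub0r nsqN -[leLHS]mulrA (ler_wpM2l (ltW p0))//.
rewrite -[leRHS]mul1r; apply: ler_pM.
- by rewrite invr_ge0 exprn_ge0// ltW.
- exact: expR_ge0.
- by rewrite invf_le1 ?exprn_gt0// exprn_ege1.
rewrite /gauss_wt ler_expR mulNr lerN2 mulrC ler_wpM2l ?nsq_ge0//.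
by rewrite lef_pV2// posrE// exprn_gt0.
Qed.

(** Approximate [w] by a bounded Lipschitz [h].  The error splits into
    [P_a |w - h|], [|P_a h - h|] and [|w - h|].  The second is [O(a)] by [bounded_lipschitz_conv]; by
    the semigroup law the first integrates to the average of [|w - h|] at scale
    [sqrt (1 + a^2)], which like the third is controlled by the approximation. *)
Lemma heat_cvg_L1 (w : Rn -> R) : measurable_fun setT w -> (forall y, 0 <= w y) ->
  gauss_integrable w -> forall e, 0 < e -> exists2 a0, 0 < a0 &
  forall a, 0 < a -> a < a0 ->
  (\int[mu]_y (gk 1 (0 - y) * `|convolution (@gk R n a) w y - w y|)%:E <= e%:E)%E.
Proof.
move=> mw w0 gw e e0.
pose p : R := pi `^ (- (n%:R / 2)).
have p0 : 0 < p by rewrite powR_gt0 ?pi_gt0.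
pose e1 := e / (3 * p).
have e10 : 0 < e1 by rewrite divr_gt0// mulr_gt0.
have h0 : 0 < 2^-1 :> R by rewrite invr_gt0.
have [_ /(_ _ e10)[h bh dwh]] := lip_dense_ge0 mw w0 (gw _ h0).
have [C C0 HC] := bounded_lipschitz_conv bh.
have mh : measurable_fun setT h by have [] := bh.
have gh := bounded_lipschitz_gauss_integrable bh.
pose f y := `|w y - h y|.
have mf : measurable_fun setT f by apply: measurableT_comp => //; exact: measurable_funB.
have gf : gauss_integrable f.
  move=> kappa k0.
  have := integrable_norm (integrableB measurableT (gw _ k0) (gh _ k0)).
  apply: eq_integrable => // y _.
  by rewrite /= -mulrBr normrM (ger0_norm (expR_ge0 _)).
(* The bound a <= 1 keeps sqrt (1 + a^2) below sqrt 2. *)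
exists (Num.min 1 (e / (3 * (C + 1)))).
  by rewrite lt_min ltr01 divr_gt0// mulr_gt0// ltr_wpDl.
move=> a a0; rewrite lt_min => /andP[a1 aC].
have key y : `|convolution (@gk R n a) w y - w y| <=
    convolution (@gk R n a) f y + (C * a + f y).
  have iw := integrable_gk_mul y a0 mw gw.
  have ih := integrable_gk_mul y a0 mh gh.
  have if_ := integrable_gk_mul y a0 mf gf.
  have E : convolution (@gk R n a) w y - convolution (@gk R n a) h y =
      \int[mu]_z (gk a (y - z) * w z - gk a (y - z) * h z).
    by rewrite (RintegralB measurableT iw ih).
  have iwh : mu.-integrable setT (EFin \o (fun z => gk a (y - z) * w z - gk a (y - z) * h z)).
    exact: (integrableB measurableT iw ih).
  have b1 : `|convolution (@gk R n a) w y - convolution (@gk R n a) h y| <=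
      convolution (@gk R n a) f y.
    rewrite E; apply: (le_trans (le_normr_Rintegral measurableT iwh)).
    rewrite le_eqVlt; apply/orP; left; apply/eqP; apply: eq_Rintegral => z _.
    by rewrite -mulrBr normrM (ger0_norm (gk_ge0 _ a0)).
  have b2 := HC a y a0.
  rewrite (_ : _ - w y = (convolution (@gk R n a) w y - convolution (@gk R n a) h y)
    + ((convolution (@gk R n a) h y - h y) + (h y - w y))); last first.
    by rewrite (addrA (_ - h y)) subrK [RHS]addrA subrK.
  apply: (le_trans (ler_normD _ _)); apply: lerD => //.
  apply: (le_trans (ler_normD _ _)); apply: lerD => //.
  by rewrite distrC.
have [isg sg] := gauss_semigroup 0 ltr01 a0 mf gf.
pose r := Num.sqrt (1 ^+ 2 + a ^+ 2).
have r2 : r ^+ 2 = 1 + a ^+ 2 by rewrite sqr_sqrtr expr1n// addr_ge0// sqr_ge0.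
have r0 : 0 < r by rewrite sqrtr_gt0 expr1n ltr_pwDl// sqr_ge0.
have r1 : 1 <= r.
  rewrite -[leLHS]sqrtr1 /r ler_wsqrtr// expr1n lerDl.
  exact: sqr_ge0.
have r22 : r ^+ 2 <= 2.
  rewrite r2 (_ : 2 = 1 + 1 :> R)// lerD2l exprn_ile1 ?(ltW a0) ?(ltW a1)//.
have small s : 1 <= s -> s ^+ 2 <= 2 -> convolution (@gk R n s) f 0 <= e / 3.
  move=> s1 s2; have s0 : 0 < s by apply: lt_le_trans s1.
  rewrite -lee_fin /convolution /Rintegral fineK; last first.
    by apply: integrable_fin_num => //; exact: (integrable_gk_mul 0 s0 mf gf).
  apply: (@le_trans _ _ (\int[mu]_y (p * (`|w y - h y| * gauss_wt y))%:E)%E).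
    apply: ge0_le_integral => //.
    - move=> y _; rewrite lee_fin; apply: mulr_ge0; [exact: gk_ge0|exact: normr_ge0].
    - by have /integrableP[] := integrable_gk_mul 0 s0 mf gf.
    - apply/measurable_EFinP; apply: measurable_funM => //.
      by apply: measurable_funM => //; exact: measurable_gauss_wt.
    - move=> y _; rewrite lee_fin [leRHS]mulrCA [leLHS]mulrC.
      by apply: (ler_wpM2l (normr_ge0 _)); exact: gk_le_gauss_wt.
  under eq_integral do rewrite EFinM.
  rewrite ge0_integralZl//; last 3 first.
  - exact: measurable_dist.
  - by move=> y _; rewrite lee_fin mulr_ge0// gauss_wt_ge0.
  - by rewrite lee_fin ltW.
  apply: (@le_trans _ _ (p%:E * e1%:E)%E); first by rewrite lee_pmul2l// lte_fin.
  rewrite -EFinM lee_fin /e1 le_eqVlt; apply/orP; left; apply/eqP.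
  by field; rewrite gt_eqF.
pose f1 y := gk 1 (0 - y) * convolution (@gk R n a) f y.
pose f2 y := C * a * gk 1 ((0 : Rn) - y).
pose f3 y := gk 1 (0 - y) * f y.
have ig := integrable_gk (0 : Rn) (@ltr01 R).
have i2 : mu.-integrable setT (EFin \o f2) by exact: (integrableZl measurableT _ ig).
have i3 : mu.-integrable setT (EFin \o f3) by exact: (integrable_gk_mul 0 ltr01 mf gf).
have i23 : mu.-integrable setT (EFin \o (fun y => f2 y + f3 y)).
  exact: (integrableD measurableT i2 i3).
have i123 : mu.-integrable setT (EFin \o (fun y => f1 y + (f2 y + f3 y))).
  exact: (integrableD measurableT isg i23).
have mc : measurable_fun setT (fun y : Rn => gk 1 (0 - y)).
  by apply: measurable_subl; exact: measurable_gk.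
apply: (@le_trans _ _ (\int[mu]_y (f1 y + (f2 y + f3 y))%:E)%E).
  apply: ge0_le_integral => //.
  - by move=> y _; rewrite lee_fin mulr_ge0// gk_ge0.
  - apply/measurable_EFinP; apply: measurable_funM => //.
    apply: measurableT_comp => //; apply: measurable_funB => //.
    by apply: measurable_conv => //; exact: measurable_gk.
  - by have /integrableP[] := i123.
  - move=> y _; rewrite lee_fin /f1 /f2 /f3 (mulrC (C * a)) -!mulrDr.
    by rewrite ler_wpM2l// gk_ge0.
rewrite -[leLHS]fineK; last exact: integrable_fin_num i123.
rewrite lee_fin -[leLHS]/(\int[mu]_y (f1 y + (f2 y + f3 y))).
rewrite (RintegralD measurableT isg i23) (RintegralD measurableT i2 i3).
rewrite (RintegralZl _ measurableT ig) Rintegral_gk// mulr1.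
have t1 : \int[mu]_y f1 y <= e / 3.
  by rewrite -[leLHS]/(convolution _ _ 0) sg small.
have t3 : \int[mu]_y f3 y <= e / 3 by rewrite -[leLHS]/(convolution _ _ 0) small// expr1n ler1n.
have t2 : C * a <= e / 3.
  have C10 : 0 < C + 1 by rewrite ltr_wpDl.
  apply: (@le_trans _ _ ((C + 1) * (e / (3 * (C + 1))))).
    apply: ler_pM => //; [exact: ltW|by rewrite lerDl|exact: ltW].
  rewrite le_eqVlt; apply/orP; left; apply/eqP; move: C10; clear => C10.
  by field; rewrite gt_eqF.
by move: t1 t2 t3; move: (\int[mu]_y f1 y) (\int[mu]_y f3 y) (C * a); clear => ? ? ?; lra.
Qed.
End density.

(** * Passage to the weight itself *)

Section log_weight.
Context {R : realType} (n : nat).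
Local Notation Rn := 'rV[R]_n.
Local Notation mu := (@lebesgue_rV R n).

Lemma ln_shift_lip (b s t : R) : 0 < b -> 0 <= s -> 0 <= t ->
  ln (s + b) - ln (t + b) <= `|s - t| / b.
Proof.
move=> b0 s0 t0; have sb : 0 < s + b by rewrite ltr_wpDl.
have tb : 0 < t + b by rewrite ltr_wpDl.
rewrite -ln_div ?posrE//.
have := @subr1_ln_ge0 R ((s + b) / (t + b)) (divr_gt0 sb tb).
rewrite subr_ge0 => /le_trans; apply.
rewrite (_ : (s + b) / (t + b) - 1 = (s - t) / (t + b)); last first.
  by field; rewrite gt_eqF.
apply: (@le_trans _ _ (`|s - t| / (t + b))).
  by rewrite ler_wpM2r ?invr_ge0 ?(ltW tb)// ler_norm.
by rewrite ler_wpM2l// lef_pV2 ?posrE// lerDr.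
Qed.

Lemma ln_shift_abs (b s : R) : 0 < b -> 0 <= s -> `|ln (s + b)| <= `|ln b| + s / b.
Proof.
move=> b0 s0.
have h1 := ln_shift_lip b0 s0 (lexx 0); have h2 := ln_shift_lip b0 (lexx 0) s0.
rewrite add0r subr0 (ger0_norm s0) in h1; rewrite add0r sub0r normrN (ger0_norm s0) in h2.
have a1 := ler_norm (ln b); have a2 := ler_norm (- ln b); rewrite normrN in a2.
rewrite ler_norml; move: h1 h2 a1 a2; move: (ln (s + b)) (ln b) (s / b) `|ln b| => ? ? ? ?.
by clear => ? ? ? ?; apply/andP; split; lra.
Qed.

Lemma weight_integrable_ball (w : Rn -> R) (x0 : Rn) (rad : R) : is_weight w ->
  0 < rad -> mu.-integrable (eball x0 rad) (EFin \o w).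
Proof.
move=> ww rad0; have [w0 mw _] := ww; apply/integrableP; split.
  exact/measurable_EFinP/measurable_funTS.
under eq_integral do rewrite /= ger0_norm//.
exact: weight_ball_lty.
Qed.

Lemma integrable_cst_ball (x0 : Rn) (rad r : R) : 0 < rad ->
  mu.-integrable (eball x0 rad) (EFin \o (fun=> r)).
Proof.
move=> rad0; apply: (@integrable_bounded R n _ (fun=> r) `|r|) => //.
  exact: measurable_eball.
by rewrite ltey_eq lebesgue_eball_fin.
Qed.

Lemma integrable_ln_shift (f : Rn -> R) (x0 : Rn) (rad b : R) : 0 < rad -> 0 < b ->
  measurable_fun setT f -> (forall y, 0 <= f y) ->
  mu.-integrable (eball x0 rad) (EFin \o f) ->
  mu.-integrable (eball x0 rad) (EFin \o (fun y => ln (f y + b))).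
Proof.
move=> rad0 b0 mf f0 fi; have mD := measurable_eball x0 rad0.
have i1 : mu.-integrable (eball x0 rad) (EFin \o (fun y => b^-1 * f y)).
  exact: (integrableZl mD _ fi).
apply: (le_integrable mD _ _ (integrableD mD (integrable_cst_ball x0 `|ln b| rad0) i1)).
  apply/measurable_EFinP/measurable_funTS; apply: measurableT_comp => //.
  exact: measurable_funD.
move=> y _; rewrite /= lee_fin; apply: le_trans (ler_norm _).
by rewrite (mulrC b^-1); exact: ln_shift_abs.
Qed.

Lemma weight_avg_gt0 (D : R) (w : Rn -> R) (x0 : Rn) (rad : R) : is_weight w ->
  doubling_bound (weight_measure w) D -> weight_measure w setT != 0%E ->
  0 < rad -> 0 < avg w (eball x0 rad).
Proof.
move=> ww dw wT rad0; have muf := lebesgue_eball_fin x0 rad0.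
rewrite /avg divr_gt0// fine_gt0//.
  by rewrite (doubling_gt0 x0 ww dw wT rad0)/=; exact: weight_ball_lty.
by rewrite lebesgue_eball_gt0// ltey_eq muf.
Qed.

(** Apply [entropy_lower_bound] and [entropy_growth] to [u_a], then let [a] tend to 0.
    The left side is continuous in [L^1] of the ball along [u_a], once [ln u_a] has been
    replaced by the larger [ln (u_a + b)], which is Lipschitz with constant [1 / b]. *)
Lemma avg_ln_shift : exists2 K : R, 0 < K &
  forall (D : R) (w : Rn -> R) (delta : R), is_weight w ->
  doubling_bound (weight_measure w) D -> weight_measure w setT != 0%E ->
  (carleson_norm (gradient_measure w) <= delta%:E)%E -> 0 <= delta ->
  forall (x0 : Rn) (rad b : R), 0 < rad -> 0 < b ->
  ln (avg w (eball x0 rad)) - avg (fun y => ln (w y + b)) (eball x0 rad) <=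
  K * delta.
Proof.
have [K1 K10 H1] := @entropy_growth R n.
have [K2 K20 H2] := @entropy_lower_bound R n.
exists (K2 * K1); first exact: mulr_gt0.
move=> D w delta ww dw wT wdelta d0 x0 rad b rad0 b0.
have [w0 mw _] := ww.
have gw : gauss_integrable w by exact: doubling_gauss_integrable dw.
set Dl := eball x0 rad.
have mD : measurable Dl by exact: measurable_eball.
have muf : mu Dl \is a fin_num by exact: lebesgue_eball_fin.
pose M := fine (mu Dl).
have M0 : 0 < M by rewrite fine_gt0// lebesgue_eball_gt0// ltey_eq muf.
have muD : (mu Dl < +oo)%E by rewrite ltey_eq muf.
have iw : mu.-integrable Dl (EFin \o w) by exact: weight_integrable_ball.
set A := avg w Dl.
have A0 : 0 < A by exact: weight_avg_gt0 dw wT rad0.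
pose p : R := pi `^ (- (n%:R / 2)).
have p0 : 0 < p by rewrite powR_gt0 ?pi_gt0.
pose c := p * expR (- (2 * rad ^+ 2 + 2 * nsq x0)).
have c0 : 0 < c by rewrite mulr_gt0 ?expR_gt0.
have cgk y : Dl y -> c <= gk 1 (0 - y).
  rewrite /Dl eballE//= => yD; rewrite gkE !expr1n !invr1 !mulr1 sub0r nsqN.
  rewrite (ler_wpM2l (ltW p0))// ler_expR lerN2.
  have := nsqD_le (y - x0) x0; rewrite subrK => /le_trans; apply.
  by rewrite lerD2r ler_wpM2l// ltW.
have conv e : 0 < e -> exists2 a0, 0 < a0 & forall a, 0 < a -> a < a0 ->
    (\int[mu]_(y in Dl) (`|u w a y - w y|)%:E <= (e * M)%:E)%E.
  move=> e0; have eMc : 0 < c * (e * M) by rewrite mulr_gt0// mulr_gt0.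
  have [a0 a00 H] := heat_cvg_L1 mw w0 gw eMc; exists a0 => // a a1 a2.
  have mua : measurable_fun setT (u w a) by exact: measurable_u.
  have md : measurable_fun setT (fun y => `|u w a y - w y|).
    by apply: measurableT_comp => //; exact: measurable_funB.
  have mE : measurable_fun setT (fun y : Rn => (gk 1 (0 - y) * `|u w a y - w y|)%:E).
    apply/measurable_EFinP; apply: measurable_funM => //.
    by apply: measurable_subl; exact: measurable_gk.
  rewrite -(lee_pmul2l (x := c%:E))// ?lte_fin// -EFinM.
  apply: le_trans (H a a1 a2).
  rewrite -ge0_integralZl ?lee_fin ?(ltW c0)//; last first.
    by apply/measurable_EFinP; exact: measurable_funTS.
  apply: (@le_trans _ _ (\int[mu]_(y in Dl) (gk 1 (0 - y) * `|u w a y - w y|)%:E)%E).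
    apply: ge0_le_integral => //.
    - by move=> y _; rewrite -EFinM lee_fin mulr_ge0// ltW.
    - apply/measurable_EFinP; apply: measurable_funM => //.
      exact: measurable_funTS.
    - exact: measurable_funTS.
    - by move=> y Dy; rewrite -EFinM lee_fin ler_wpM2r// cgk.
  apply: ge0_subset_integral => //.
  by move=> y _; rewrite lee_fin mulr_ge0// gk_ge0.
have mlb : measurable_fun setT (fun y => ln (w y + b)).
  by apply: measurableT_comp => //; exact: measurable_funD.
set B := avg _ Dl.
apply/ler_addgt0Pr => eps eps0.
(* Errors: at most 2 e / A in ln (avg u_a) and e / b in avg (ln (u_a + b)). *)
pose e := Num.min (A / 2) (eps / (2 / A + b^-1)).
have q0 : 0 < 2 / A + b^-1 by apply: addr_gt0; [exact: divr_gt0|rewrite invr_gt0].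
have e0 : 0 < e by rewrite lt_min; apply/andP; split; exact: divr_gt0.
have eA : e <= A / 2 by rewrite ge_min lexx.
have eq_ : e * (2 / A + b^-1) <= eps.
  by rewrite -ler_pdivlMr// ge_min lexx orbT.
have [a0 a00 Ha] := conv e e0.
pose a := Num.min (a0 / 2) (rad / 2).
have a_gt0 : 0 < a by rewrite lt_min; apply/andP; split; exact: divr_gt0.
have a_lt : a < a0.
  by rewrite gt_min; apply/orP; left; rewrite ltr_pdivrMr// mulr_natr mulr2n ltrDl.
have a_rad : a <= rad / 2 by rewrite ge_min lexx orbT.
have a_rad' : a < rad.
  apply: (le_lt_trans a_rad); rewrite ltr_pdivrMr// mulr_natr mulr2n ltrDl//.
have [iu iv lower] := H2 D w ww dw wT x0 rad a a_gt0 a_rad.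
have ug0 y : 0 < u w a y by exact: (u_gt0 ww dw wT).
have u0 y : 0 <= u w a y by exact: ltW.
have mua : measurable_fun setT (u w a) by exact: measurable_u.
have ent : ln (avg (u w a) Dl) - avg (v w a) Dl <= K2 * K1 * delta.
  apply: (le_trans lower); rewrite -mulrA ler_wpM2l ?(ltW K20)//.
  rewrite ge_max mulr_ge0 ?(ltW K10)//=; exact: (H1 D w delta).
have iuw : mu.-integrable Dl (EFin \o (fun y => u w a y - w y)) by exact: (integrableB mD iu iw).
have L1 : \int[mu]_(y in Dl) `|u w a y - w y| <= e * M.
  rewrite -lee_fin /Rintegral fineK; first exact: Ha.
  apply: integrable_fin_num => //; exact: integrable_norm iuw.
have ilu := integrable_ln_shift rad0 b0 mua u0 iu.
have ilw := integrable_ln_shift rad0 b0 mw w0 iw.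
have avgB (f g : Rn -> R) : mu.-integrable Dl (EFin \o f) ->
    mu.-integrable Dl (EFin \o g) -> avg f Dl - avg g Dl = (\int[mu]_(y in Dl) (f y - g y)) / M.
  by move=> fi gi; rewrite /avg -mulrBl -(RintegralB mD fi gi).
have inorm := integrable_norm iuw.
have dA : `|avg (u w a) Dl - A| <= e.
  rewrite /A (avgB _ _ iu iw) normrM (gtr0_norm (x := M^-1)) ?invr_gt0//.
  rewrite ler_pdivrMr//; apply: le_trans L1.
  exact: le_normr_Rintegral.
have d1 : avg (v w a) Dl <= avg (fun y => ln (u w a y + b)) Dl.
  rewrite /avg ler_wpM2r ?invr_ge0 ?(ltW M0)//; apply: le_Rintegral => // y _.
  by rewrite /v ler_ln ?posrE ?addr_gt0// lerDl ltW.
have d2 : avg (fun y => ln (u w a y + b)) Dl - B <= e / b.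
  rewrite /B (avgB _ _ ilu ilw) ler_pdivrMr//.
  apply: (@le_trans _ _ (\int[mu]_(y in Dl) (b^-1 * `|u w a y - w y|))).
    apply: le_Rintegral => //.
    - exact: (integrableB mD ilu ilw).
    - exact: (integrableZl mD _ inorm).
    - by move=> y _; rewrite mulrC; exact: ln_shift_lip.
  rewrite (RintegralZl _ mD inorm) mulrAC mulrC ler_wpM2r ?invr_ge0 ?(ltW b0)//.
have Au : A / 2 <= avg (u w a) Dl.
  by move: dA eA; rewrite ler_norml => /andP[+ _]; move: (avg (u w a) Dl); clear => t; lra.
have Au0 : 0 < avg (u w a) Dl by apply: lt_le_trans Au; rewrite divr_gt0.
have d3 : ln A - ln (avg (u w a) Dl) <= e * (2 / A).
  rewrite -ln_div ?posrE//.
  have := @subr1_ln_ge0 R (A / avg (u w a) Dl) (divr_gt0 A0 Au0).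
  rewrite subr_ge0 => /le_trans; apply.
  rewrite (_ : _ - 1 = (A - avg (u w a) Dl) / avg (u w a) Dl); last first.
    by rewrite mulrBl divff// gt_eqF.
  apply: (@le_trans _ _ (e / avg (u w a) Dl)).
    rewrite ler_wpM2r ?invr_ge0 ?(ltW Au0)//; apply: le_trans dA.
    by rewrite distrC ler_norm.
  apply: (ler_wpM2l (ltW e0)); rewrite -(invf_div A 2).
  by rewrite (lef_pV2 (y := A / 2)) ?posrE// divr_gt0.
move: ent d1 d2 d3 eq_; rewrite mulrDr; clear.
move: (avg (u w a) Dl) (avg (v w a) Dl) (avg _ _) (ln A) (ln _) (e * _) (e / b) (K2 * K1 * delta).
by move=> ? ? ? ? ? ? ? ? ; lra.
Qed.

Lemma cvg_ln_shift (s : R) : 0 <= s ->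
  ((ln (s + 1) - ln (s + k.+1%:R^-1))%:E @[k --> \oo] -->
  (ln (s + 1))%:E - lne s%:E)%E.
Proof.
rewrite le_eqVlt => /predU1P[<-|s0].
  rewrite le0_lneNy// (_ : (- -oo)%E = +oo%E)// addey//.
  under eq_fun do rewrite !add0r ln1 sub0r lnV ?posrE// opprK.
  apply/cvgeryP/cvgryPge => A.
  near=> k; rewrite -[A]expRK ler_ln ?posrE ?expR_gt0// (@le_trans _ _ k%:R)//.
    by near: k; exact: nbhs_infty_ger.
  by rewrite ler_nat.
rewrite lne_EFin// -EFinB; apply: cvg_EFin; first exact: nearW.
apply: cvgB; first exact: cvg_cst.
apply: continuous_cvg; first exact: continuous_ln.
rewrite -[X in _ --> X]addr0; apply: cvgD; first exact: cvg_cst.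
exact: cvg_harmonic.
Unshelve. all: by end_near. Qed.

End log_weight.

(** * Integrability and mean of the logarithm *)

Section log_mean.
Context {R : realType} (n : nat).
Local Notation Rn := 'rV[R]_n.
Local Notation mu := (@lebesgue_rV R n).

(** For nonnegative [f] compare [exp] with its tangent at [lam], using
    [exp lam >= 1 + lam]; for negative [f], with its tangent at [ln (1 - lam)]. *)
Lemma abs_le_exp (lam f : R) : 0 < lam -> lam < 1 ->
  lam * `|f| <= lam ^+ 2 + (expR f - 1 - f).
Proof.
move=> l0 l1; have [f0|f0] := leP 0 f.
  have h1 := expR_ge1Dx lam; have h2 := expR_ge1Dx (f - lam).
  have h : (1 + lam) * (1 + (f - lam)) <= expR f.
    rewrite (_ : expR f = expR lam * expR (f - lam)); last by rewrite -expRD addrC subrK.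
    by apply: ler_pM => //; clear -l0 l1 f0; lra.
  rewrite (ger0_norm f0); move: (expR f) h => E; clear -l0 l1 f0.
  by rewrite -subr_ge0 => h; rewrite -subr_ge0; apply: le_trans h _; lra.
have l1' : 0 < 1 - lam by rewrite subr_gt0.
have h1 := expR_ge1Dx (f - ln (1 - lam)).
have h2 : ln (1 - lam) <= - lam.
  by rewrite -ler_expR lnK ?posrE//; exact: expR_ge1Dx.
have h : (1 - lam) * (1 + (f + lam)) <= expR f.
  rewrite (_ : expR f = (1 - lam) * expR (f - ln (1 - lam))); last first.
    by rewrite -[X in X * _]lnK ?posrE// -expRD addrC subrK.
  by rewrite ler_wpM2l ?(ltW l1')//; apply: le_trans h1; clear -h2; lra.
rewrite (ltr0_norm f0); move: (expR f) h => E; clear -l0 l1 f0 => h.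
by lra.
Qed.

Lemma average_fin (x0 : Rn) rad (f : Rn -> \bar R) (l : R) : 0 < rad ->
  (\int[mu]_(y in eball x0 rad) f y = (l * fine (mu (eball x0 rad)))%:E)%E ->
  average f (eball x0 rad) = l%:E.
Proof.
move=> rad0 fl; have muf := lebesgue_eball_fin x0 rad0.
have M0 : 0 < fine (mu (eball x0 rad)).
  by rewrite fine_gt0// lebesgue_eball_gt0// ltey_eq muf.
rewrite /average fl -[X in (_ / X)%E](fineK muf) inver gt_eqF// -EFinM mulfK//.
by rewrite gt_eqF.
Qed.

Lemma average_le (x0 : Rn) rad (f : Rn -> \bar R) (l : R) : 0 < rad ->
  (\int[mu]_(y in eball x0 rad) f y <= (l * fine (mu (eball x0 rad)))%:E)%E ->
  (average f (eball x0 rad) <= l%:E)%E.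
Proof.
move=> rad0 fl; have muf := lebesgue_eball_fin x0 rad0.
have M0 : 0 < fine (mu (eball x0 rad)).
  by rewrite fine_gt0// lebesgue_eball_gt0// ltey_eq muf.
by rewrite /average -[X in (_ / X)%E](fineK muf) inver gt_eqF// lee_pdivrMr.
Qed.

(** The functions [ln (w + 1) - ln (w + 1 / (k + 1))] are nonnegative and increase to
    [ln (w + 1) - ln w], with value [+oo] where [w] vanishes.  Their integrals are
    bounded by [avg_ln_shift], so the limit is integrable and [w] vanishes only on a
    null set of the ball. *)
Lemma log_mean : exists2 K : R, 0 < K &
  forall (D : R) (w : Rn -> R) (delta : R), is_weight w ->
  doubling_bound (weight_measure w) D -> weight_measure w setT != 0%E ->
  (carleson_norm (gradient_measure w) <= delta%:E)%E -> 0 <= delta ->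
  forall (x0 : Rn) (rad : R), 0 < rad -> exists A l : R,
  [/\ 0 < A /\ ln A - K * delta <= l,
      mu.-integrable (eball x0 rad) (EFin \o w),
      (\int[mu]_(y in eball x0 rad) (w y)%:E =
        (A * fine (mu (eball x0 rad)))%:E)%E,
      mu.-integrable (eball x0 rad) (fun y => lne (w y)%:E) &
      (\int[mu]_(y in eball x0 rad) lne (w y)%:E =
        (l * fine (mu (eball x0 rad)))%:E)%E].
Proof.
have [K K0 HK] := @avg_ln_shift R n; exists K => //.
move=> D w delta ww dw wT wdelta d0 x0 rad rad0.
have [w0 mw _] := ww.
set Dl := eball x0 rad.
have mD : measurable Dl by exact: measurable_eball.
have muf : mu Dl \is a fin_num by exact: lebesgue_eball_fin.
set M := fine (mu Dl).
have M0 : 0 < M by rewrite fine_gt0// lebesgue_eball_gt0// ltey_eq muf.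
have muD : (mu Dl < +oo)%E by rewrite ltey_eq muf.
have iw : mu.-integrable Dl (EFin \o w) by exact: weight_integrable_ball.
pose A := avg w Dl.
have A0 : 0 < A by exact: weight_avg_gt0 dw wT rad0.
have AE : (\int[mu]_(y in Dl) (w y)%:E = (A * M)%:E)%E.
  by rewrite /A /avg divfK ?gt_eqF// fineK//; exact: integrable_fin_num iw.
have mlb b : measurable_fun setT (fun y => ln (w y + b)).
  by apply: measurableT_comp => //; exact: measurable_funD.
have ilb b : 0 < b -> mu.-integrable Dl (EFin \o (fun y => ln (w y + b))).
  by move=> b0; exact: integrable_ln_shift.
pose g (k : nat) (y : Rn) : \bar R := (ln (w y + 1) - ln (w y + k.+1%:R^-1))%:E.
have k0 (k : nat) : 0 < k.+1%:R^-1 :> R by rewrite invr_gt0 ltr0n.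
have mg k : measurable_fun setT (g k).
  by apply/measurable_EFinP; exact: measurable_funB.
have g0 k y : (0 <= g k y)%E.
  rewrite lee_fin subr_ge0 ler_ln ?posrE ?ltr_wpDl// lerD2l.
  by rewrite invf_le1 ?ler1n ?ltr0n.
have ndg y : nondecreasing_seq (g ^~ y).
  move=> j k jk; rewrite /g lee_fin lerD2l lerN2 ler_ln ?posrE ?ltr_wpDl//.
  by rewrite lerD2l lef_pV2 ?posrE ?ltr0n// ler_nat.
pose E (y : Rn) : \bar R := ((ln (w y + 1))%:E - lne (w y)%:E)%E.
have gE y : g k y @[k --> \oo] --> E y by exact: cvg_ln_shift.
have limg y : limn (g ^~ y) = E y by apply/cvg_lim => //; exact: gE.
have E0 y : (0 <= E y)%E.
  rewrite -limg; apply: lime_ge; first by apply/cvg_ex; exists (E y); exact: gE.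
  exact: nearW.
have mE : measurable_fun setT E.
  by apply: (emeasurable_fun_cvg g) => // y _; exact: gE.
pose b := \int[mu]_(y in Dl) ln (w y + 1) - M * (ln A - K * delta).
have Eb : (\int[mu]_(y in Dl) E y <= b%:E)%E.
  have mgD k : measurable_fun Dl (g k) by exact: measurable_funTS.
  have := @cvg_monotone_convergence _ _ _ mu Dl mD g mgD (fun k y _ => g0 k y) (fun y _ => ndg y).
  rewrite (_ : (fun x => limn _) = E); last by apply/funext => y; exact: limg.
  move=> cv; rewrite -(cvg_lim _ cv)//; apply: lime_le.
    by apply/cvg_ex; eexists; exact: cv.
  apply: nearW => k.
  have ig : mu.-integrable Dl (EFin \o (fun y => ln (w y + 1) - ln (w y + k.+1%:R^-1))).
    exact: (integrableB mD (ilb _ ltr01) (ilb _ (k0 k))).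
  rewrite -[leLHS]fineK; last exact: integrable_fin_num ig.
  rewrite lee_fin -[leLHS]/(\int[mu]_(y in Dl) (ln (w y + 1) - ln (w y + k.+1%:R^-1))).
  rewrite (RintegralB mD (ilb _ ltr01) (ilb _ (k0 k))) /b lerD2l lerN2.
  have := HK D w delta ww dw wT wdelta d0 x0 rad _ rad0 (k0 k).
  by rewrite -/Dl -/A /avg -/M lerBlDr -lerBlDl ler_pdivlMr// (mulrC M).
have iE : mu.-integrable Dl E.
  apply/integrableP; split; first exact: measurable_funTS.
  under eq_integral do rewrite gee0_abs//.
  by apply: (le_lt_trans Eb); exact: ltry.
have lneE : (fun y => lne (w y)%:E) = (fun y => (ln (w y + 1))%:E - E y)%E.
  apply/funext => y; rewrite /E; have := w0 y; rewrite le_eqVlt => /predU1P[<-|wy].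
    by rewrite le0_lneNy.
  by rewrite lne_EFin// -!EFinB opprB addrC subrK.
have il : mu.-integrable Dl (fun y => lne (w y)%:E).
  by rewrite lneE; exact: (integrableB mD (ilb _ ltr01) iE).
have If : (\int[mu]_(y in Dl) lne (w y)%:E)%E \is a fin_num by exact: integrable_fin_num.
pose l := fine (\int[mu]_(y in Dl) lne (w y)%:E)%E / M.
exists A, l; split => //; last by rewrite /l divfK ?gt_eqF// fineK.
split => //; rewrite ler_pdivlMr// mulrC -lee_fin fineK// lneE.
rewrite (integralB mD (ilb _ ltr01) iE).
have f1 : (\int[mu]_(y in Dl) (ln (w y + 1))%:E)%E \is a fin_num by exact: integrable_fin_num (ilb _ ltr01).
have f2 : (\int[mu]_(y in Dl) E y)%E \is a fin_num by exact: integrable_fin_num.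
rewrite -(fineK f1) -(fineK f2) -EFinB lee_fin.
move: Eb; rewrite -(fineK f2) lee_fin /b /Rintegral.
rewrite /=; move: (fine _) (fine _) (M * _) => ? ? ?; clear.
by lra.
Qed.

(** Both quantities are read off from the integrability of
    [G = w / A - 1 - ln (w / A)], of mean [ln A - l <= K * delta], where [A] and [l] are
    the means of [w] and [ln w] over the ball.  For the oscillation, the deviation from
    [ln A] is estimated by [abs_le_exp], and replacing [ln A] by [l] costs [ln A - l]. *)
Lemma Ainfty_BMO : exists2 K : R, 0 < K &
  forall (D : R) (w : Rn -> R) (delta : R), is_weight w ->
  doubling_bound (weight_measure w) D -> weight_measure w setT != 0%E ->
  (carleson_norm (gradient_measure w) <= delta%:E)%E -> 0 <= delta ->
  (Ainfty_constant w <= (expR (K * delta))%:E)%E /\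
  forall lam, 0 < lam -> lam < 1 -> delta <= lam ^+ 2 ->
  (BMO_norm (fun y => lne (w y)%:E) <= ((1 + 2 * K) * lam)%:E)%E.
Proof.
have [K K0 HK] := log_mean; exists K => //.
move=> D w delta ww dw wT wdelta d0; have [w0 mw _] := ww.
have {HK} := HK D w delta ww dw wT wdelta d0.
split=> [|lam lam0 lam1 dlam].
  apply: ge_ereal_sup => _ [x0 _ [rad rad0 <-]].
  have [A [l [[A0 lA] iw Aw il ll]]] := H x0 rad rad0.
  rewrite (average_fin rad0 Aw) (average_fin rad0 ll) /= -EFinM lee_fin.
  rewrite -[X in X * _](@lnK R A) ?posrE// -expRD ler_expR.
  by clear -lA; lra.
apply: ge_ereal_sup => _ [x0 _ [rad rad0 <-]].
have [A [l [[A0 lA] iw Aw il ll]]] := H x0 rad rad0.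
apply: average_le => //.
under eq_integral do rewrite (average_fin rad0 ll).
set Dl := eball x0 rad in iw Aw il ll *.
have mD : measurable Dl by exact: measurable_eball.
have muf : mu Dl \is a fin_num by exact: lebesgue_eball_fin.
set M := fine (mu Dl) in Aw ll *.
have M0 : 0 < M by rewrite fine_gt0// lebesgue_eball_gt0// ltey_eq muf.
have muD : (mu Dl < +oo)%E by rewrite ltey_eq muf.
have icst r : mu.-integrable Dl (EFin \o (fun=> r)) by exact: integrable_cst_ball.
have Icst r : (\int[mu]_(y in Dl) (EFin \o (fun=> r)) y = (r * M)%:E)%E.
  by rewrite /= integral_cst// EFinM /M fineK.
pose F y := A^-1 * w y + (ln A - 1).
have iF : mu.-integrable Dl (EFin \o F).
  exact: (integrableD mD (integrableZl mD _ iw) (icst _)).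
pose G y := ((F y)%:E - lne (w y)%:E)%E.
have iG : mu.-integrable Dl G by exact: (integrableB mD iF il).
have IG : (\int[mu]_(y in Dl) G y = (M * (ln A - l))%:E)%E.
  rewrite (integralB mD iF il) ll.
  rewrite (integralD mD (integrableZl mD _ iw) (icst _)) (integralZl mD iw) Aw.
  rewrite Icst -EFinM -[LHS]/((A^-1 * (A * M) + (ln A - 1) * M - l * M)%:E).
  by congr EFin; move: A0; clear; move: (ln A) => a A0; field; rewrite gt_eqF.
have G0 y : (0 <= G y)%E.
  rewrite /G; have := w0 y; rewrite le_eqVlt => /predU1P[<-|wy].
    by rewrite le0_lneNy// (_ : (- -oo)%E = +oo%E)// addey.
  by rewrite lne_EFin// -EFinB lee_fin; exact: ln_tangent.
have gam0 : 0 <= ln A - l.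
  rewrite -(@pmulr_rge0 _ M)// -lee_fin -IG; exact: integral_ge0.
set gam := ln A - l in IG gam0 *.
have gamK : gam <= K * delta by rewrite /gam; clear -lA; lra.
have key y : (`|lne (w y)%:E - l%:E| <= (gam + lam)%:E + lam^-1%:E * G y)%E.
  rewrite /G; have := w0 y; rewrite le_eqVlt => /predU1P[<-|wy].
    by rewrite le0_lneNy// (_ : (- -oo)%E = +oo%E)// addey// gt0_muley ?lte_fin ?invr_gt0// addey// leey.
  rewrite lne_EFin// -!EFinB -EFinM -EFinD abse_EFin lee_fin.
  have := @abs_le_exp lam (ln (w y) - ln A) lam0 lam1.
  rewrite expRB !lnK ?posrE// => h.
  apply: (@le_trans _ _ (gam + `|ln (w y) - ln A|)).
    rewrite (_ : ln (w y) - l = gam + (ln (w y) - ln A)); last by rewrite /gam [RHS]addrC subrKA.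
    by apply: (le_trans (ler_normD _ _)); rewrite (ger0_norm gam0).
  rewrite -[leRHS]addrA lerD2l -(@ler_pM2l _ lam)//; apply: (le_trans h).
  rewrite /F mulrDr mulVKf ?gt_eqF// le_eqVlt; apply/orP; left; apply/eqP.
  by move: (ln (w y)) (ln A) (w y) (A^-1) => ? ? ? ?; clear; ring.
apply: (@le_trans _ _ (\int[mu]_(y in Dl) ((gam + lam)%:E + lam^-1%:E * G y))%E).
  apply: ge0_le_integral => //.
  - apply: measurableT_comp => //; apply: emeasurable_funB => //.
    by have /integrableP[] := il.
  - apply: emeasurable_funD => //; apply: measurable_funeM.
    by have /integrableP[] := iG.
rewrite (integralD mD (icst _) (integrableZl mD _ iG)) (integralZl mD iG) IG.
rewrite Icst -!EFinM -EFinD lee_fin.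
rewrite [leLHS](_ : _ = (gam + lam + gam / lam) * M); last first.
  by move: (lam^-1) => ?; clear; ring.
rewrite ler_wpM2r ?(ltW M0)//.
have g1 : gam <= K * lam ^+ 2 by apply: (le_trans gamK); rewrite ler_wpM2l// ltW.
have g2 : gam / lam <= K * lam by rewrite ler_pdivrMr// -mulrA -expr2.
have g3 : K * lam ^+ 2 <= K * lam.
  by rewrite ler_wpM2l ?(ltW K0)// expr2 ler_piMl// ltW.
by move: g1 g2 g3; clear; move: (gam / lam) (lam ^+ 2) => ? ?; lra.
Qed.

End log_mean.

Theorem theorem1p1 (R : realType) (n : nat) (D : R) :
  exists eps C1 C2 : R, [/\ 0 < eps, 0 < C1, 0 < C2 &
    forall w : 'rV[R]_n -> R,
      doubling_weight w ->
      is_doubling_constant (weight_measure w) D ->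
      (carleson_norm (gradient_measure w) <= eps%:E)%E ->
      (lne (Ainfty_constant w)
         <= C1%:E * sqrte (carleson_norm (gradient_measure w)))%E /\
      (BMO_norm (fun x => lne (w x)%:E)
         <= C2%:E * poweR (carleson_norm (gradient_measure w)) 4^-1)%E].
Proof.
have [K K0 HK] := @Ainfty_BMO R n.
exists 4^-1, K, (1 + 2 * K); split => //.
  by rewrite addr_gt0// mulr_gt0.
move=> w [ww [wT _]] [dw _] small.
set nu := gradient_measure w in small *.
have nu0 : (0 <= carleson_norm nu)%E.
  apply: carleson_norm_ge0 => B; apply: integral_ge0 => z [_ /= z0].
  by rewrite lee_fin mulr_ge0 ?sqr_ge0// ltW.
have fin : carleson_norm nu \is a fin_num.
  by rewrite ge0_fin_numE//; exact: le_lt_trans small (ltry _).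
rewrite -(fineK fin); set delta := fine _.
have d0 : 0 <= delta by exact: fine_ge0.
have d4 : delta <= 4^-1 by rewrite -lee_fin fineK.
have nud : (carleson_norm nu <= delta%:E)%E by rewrite fineK.
have [Aw Bw] := HK D w delta ww dw wT nud d0.
have d1 : delta <= 1 by apply: (le_trans d4); rewrite invf_le1// ler1n.
have d2 : Num.sqrt delta ^+ 2 = delta by exact: sqr_sqrtr.
have sd : Num.sqrt delta <= 2^-1.
  rewrite -ler_sqr ?nnegrE ?sqrtr_ge0// d2; apply: (le_trans d4).
  by rewrite exprVn -natrX.
have dsd : delta <= Num.sqrt delta.
  rewrite -[leLHS]d2 expr2 ler_piMl ?sqrtr_ge0//; apply: (le_trans sd).
  by rewrite invf_le1// ler1n.
split.
  apply: (@le_trans _ _ (K * delta)%:E); last first.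
    by rewrite /= -EFinM lee_fin ler_wpM2l// ltW.
  case: (Ainfty_constant w) Aw => [r| |_]; last exact: leNye.
    rewrite lee_fin => rK; have [r0|r0] := leP r 0.
      by rewrite le0_lneNy ?lee_fin// leNye.
    by rewrite lne_EFin// lee_fin -ler_expR lnK.
  by rewrite leye_eq.
rewrite poweR_EFin -EFinM.
apply: (@le_trans _ _ ((1 + 2 * K) * Num.sqrt delta)%:E); last first.
  rewrite lee_fin ler_wpM2l//; first by rewrite addr_ge0// mulr_ge0// ltW.
  rewrite -powR12_sqrt//; have := d0; rewrite le_eqVlt => /predU1P[<-|dp].
    by rewrite !powR0 ?invr_eq0 ?pnatr_eq0.
  by rewrite ger_powR ?dp// lef_pV2 ?posrE// ler_nat.
apply/lee_addgt0Pr => e e0.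
have c0 : 0 < 1 + 2 * K by rewrite addr_gt0// mulr_gt0.
pose t := Num.min 4^-1 (e / (1 + 2 * K)).
have t0 : 0 < t by rewrite lt_min; apply/andP; split; [rewrite invr_gt0|exact: divr_gt0].
have lam1 : Num.sqrt delta + t < 1.
  apply: (@le_lt_trans _ _ (2^-1 + 4^-1)); last by clear; lra.
  by rewrite lerD// ge_min lexx.
have lam0 : 0 < Num.sqrt delta + t by rewrite ltr_wpDl ?sqrtr_ge0.
apply: (le_trans (Bw _ lam0 lam1 _)).
  by rewrite -[leLHS]d2 lerXn2r ?nnegrE ?sqrtr_ge0 ?(ltW lam0)// lerDl ltW.
rewrite -EFinD lee_fin mulrDr lerD2l mulrC -ler_pdivlMr//.
by rewrite ge_min lexx orbT.
Qed.
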